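(* Let $p\in(2,3)$, let $\mathbf X=(X,\mathbb X)\in\mathcal D^p([0,T];\mathbb R^d)$ be a càdlàg $p$-rough path, and let $(y,y')\in\mathcal V^p_X([0,T];\mathbb R^k)$ be a given controlled path with respect to $X$. Let $(F,F')\colon \mathcal V^p_X([0,T];\mathbb R^k)\to\mathcal V^p_X([0,T];\mathcal L(\mathbb R^d;\mathbb R^k))$, $(Y,Y')\mapsto(F(Y),F'(Y,Y'))$, be a non-anticipative functional satisfying the following. There exist a constant $C_F>0$ (depending on $p$ and $F$) and, for every $K>0$, a constant $C_{F,K,X}>0$ (depending additionally on $K$ and $X$) such that for all $(Y,Y'),(\widetilde Y,\widetilde Y')\in\mathcal V^p_X([0,T];\mathbb R^k)$ and all $0\le s<t\le T$: (i) (growth conditions) \begin{align*} &|F_t(Y)|\le C_F,\\ &|F_{t-,t}(Y)|\le C_F(1+\|Y\|_{p,[s,t)}+|Y_{t-,t}|),\\ &\|F(Y)\|_{p,[s,t]}\le C_F\big(1+(|Y'_s|+\|Y'\|_{p,[s,t]})\|X\|_{p,[s,t]}+\|R^Y\|_{\frac p2,[s,t]}\big),\\ &\|F(Y),F'(Y,Y')\|_{X,p,[s,t]}\le C_F(1+\|Y,Y'\|_{X,p,[s,t]})^2(1+\|X\|_{p,[s,t]})^2; \end{align*} (ii) (Lipschitz conditions) if $\|Y,Y'\|_{X,p,[s,t]},\|\widetilde Y,\widetilde Y'\|_{X,p,[s,t]}\le K$, then \begin{align*} &\|F(Y)-F(\widetilde Y)\|_{p,[s,t]}\le C_{F,K,X}(|Y_s-\widetilde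 Y_s|+\|Y-\widetilde Y\|_{p,[s,t]}),\\ &\|F(Y),F'(Y,Y');F(\widetilde Y),F'(\widetilde Y,\widetilde Y')\|_{X,p,[s,t]}\le C_{F,K,X}(|Y_s-\widetilde Y_s|+\|Y,Y';\widetilde Y,\widetilde Y'\|_{X,p,[s,t]}). \end{align*} Then there exists a unique controlled path $(Y,Y')\in\mathcal V^p_X([0,T];\mathbb R^k)$, with $Y'=y'+F(Y)$, such that $$Y_t=y_t+\int_0^tF_s(Y)\,\mathrm d\mathbf X_s,\qquad t\in[0,T].$$ Moreover, there exists a componentwise non-decreasing function $K_p\colon[0,\infty)^3\to[0,\infty)$ (depending only on $p$ and the dimensions) such that $$\|Y,Y'\|_{X,p}\le K_p(\|y,y'\|_{X,p},\,C_F,\,\|\mathbf X\|_p).$$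
   Context: Fix $T>0$ and $\Delta_T=\{(s,t)\in[0,T]^2:s\le t\}$. $\mathcal L(E_1;E_2)$ is the space of linear maps. For a path $X$ write $X_{s,t}=X_t-X_s$, $X_{t-}=\lim_{u\uparrow t}X_u$, $X_{t-,t}=X_t-X_{t-}$. Variation norms. For a càdlàg path $X\colon[0,T]\to E$ ($E$ a normed space), $\|X\|_{p,[s,t]}=(\sup_{\mathcal P}\sum_{[u,v]\in\mathcal P}|X_v-X_u|^p)^{1/p}$, supremum over partitions $\mathcal P$ of $[s,t]$, and $\|X\|_p=\|X\|_{p,[0,T]}$; $D^p([0,T];E)$ is the set of càdlàg paths with $\|X\|_p<\infty$. For $\mathbb X\colon\Delta_T\to E$, $\|\mathbb X\|_{\frac p2,[s,t]}=(\sup_{\mathcal P}\sum_{[u,v]\in\mathcal P}|\mathbb X_{u,v}|^{p/2})^{2/p}$, $\|\mathbb X\|_{\frac p2}=\|\mathbb X\|_{\frac p2,[0,T]}$; $D_2^{p/2}(\Delta_T;E)$ is the set of $\mathbb X$ with $\|\mathbb X\|_{\frac p2}<\infty$ such that $s\mapsto\mathbb X_{s,t}$ and $t\mapsto\mathbb X_{s,t}$ are càdlàg. On half-open intervals, $\|\cdot\|_{p,[s,t)}=\sup_{u<t}\|\cdot\|_{p,[s,u]}$. Rough paths. For $p\in(2,3)$, $\mathbf X=(X,\mathbb X)$ is a càdlàg $p$-rough path over $\mathbb R^d$, $\mathbf X\in\mathcal D^p([0,T];\mathbb R^d)$, if $X\in D^p([0,T];\mathbb R^d)$, $\mathbb X\in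 D_2^{p/2}(\Delta_T;\mathbb R^{d\times d})$ and $\mathbb X_{s,t}=\mathbb X_{s,u}+\mathbb X_{u,t}+X_{s,u}\otimes X_{u,t}$ for $0\le s\le u\le t\le T$. $\|\mathbf X\|_{p,[s,t]}=\|X\|_{p,[s,t]}+\|\mathbb X\|_{\frac p2,[s,t]}$, $\|\mathbf X\|_p=\|\mathbf X\|_{p,[0,T]}$. Controlled paths. $(Y,Y')\in\mathcal V^p_X([0,T];E)$ if $Y\in D^p([0,T];E)$, $Y'\in D^p([0,T];\mathcal L(\mathbb R^d;E))$ and $R^Y\in D_2^{p/2}(\Delta_T;E)$, where $R^Y_{s,t}=Y_{s,t}-Y'_sX_{s,t}$. $\|Y,Y'\|_{X,p,[s,t]}=|Y'_s|+\|Y'\|_{p,[s,t]}+\|R^Y\|_{\frac p2,[s,t]}$, $\|Y,Y'\|_{X,p}=\|Y,Y'\|_{X,p,[0,T]}$; and $\|Y,Y';\widetilde Y,\widetilde Y'\|_{X,p,[s,t]}=|Y'_s-\widetilde Y'_s|+\|Y'-\widetilde Y'\|_{p,[s,t]}+\|R^Y-R^{\widetilde Y}\|_{\frac p2,[s,t]}$. Rough integral. For $(V,V')\in\mathcal V^p_X([0,T];\mathcal L(\mathbb R^d;\mathbb R^k))$, $\int_s^tV_r\,\mathrm d\mathbf X_r=\lim_{|\mathcal P|\to0}\sum_{[u,v]\in\mathcal P}(V_uX_{u,v}+V'_u\mathbb X_{u,v})$, limit along partitions $\mathcal P$ of $[s,t]$ with mesh $|\mathcal P|\to0$, using $\mathcal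 L(\mathbb R^d;\mathcal L(\mathbb R^d;\mathbb R^k))\cong\mathcal L(\mathbb R^d\otimes\mathbb R^d;\mathbb R^k)$. The integral $\int_0^t F_s(Y)\,\mathrm d\mathbf X_s$ is taken for the controlled path $(F(Y),F'(Y,Y'))$. Non-anticipative. $(F,F')$ is non-anticipative if for every $(Y,Y')\in\mathcal V^p_X([0,T];\mathbb R^k)$, $(F_\cdot(Y),F'_\cdot(Y,Y'))\in\mathcal V^p_X([0,T];\mathcal L(\mathbb R^d;\mathbb R^k))$ and $(F_t(Y),F'_t(Y,Y'))=(F_t(Y_{\cdot\wedge t}),F'_t(Y_{\cdot\wedge t},Y'_{\cdot\wedge t}))$ for all $t\in[0,T]$. Notation: $F_{t-,t}(Y)=F_t(Y)-F_{t-}(Y)$. *)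

(* Defs.v *)
From HB Require Import structures.
From mathcomp Require Import all_boot all_order all_algebra.
From mathcomp Require Import all_classical all_reals all_analysis.

Set Implicit Arguments.
Unset Strict Implicit.
Unset Printing Implicit Defensive.

Import Order.TTheory GRing.Theory Num.Theory.
Import numFieldNormedType.Exports.

Local Open Scope classical_set_scope.
Local Open Scope ring_scope.

(* A path on [0, T] is a function R -> E of which only the values on [0, T]
   are ever used, and a map on Delta_T is a function R -> R -> E of which only
   the values at 0 <= s <= t <= T are used. *)

Section Variation.
Context {R : realType} {E : normedModType R}.
Implicit Types (q s t : R) (A : R -> R -> E) (Y : R -> E).

(* As in the library, [itv_partition s t P] says that P lists the points of a
   partition of [s, t] other than s, in increasing order; the i-th point is
   then [nth t (s :: P) i], and P is empty when s = t. *)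
Definition variation2_sum q A s t (P : seq R) : R :=
  \sum_(0 <= i < size P)
    `|A (nth t (s :: P) i) (nth t (s :: P) i.+1)| `^ q.

Definition pvar2 q A s t : \bar R :=
  poweR (ereal_sup [set (variation2_sum q A s t P)%:E | P in itv_partition s t])
        q^-1.

Definition pvar q Y s t : \bar R := pvar2 q (fun u v => Y v - Y u) s t.

Definition pvar_left q Y s t : \bar R :=
  ereal_sup [set pvar q Y s u | u in [set u | s <= u < t]].

Definition left_limit Y t : E := lim (Y @ t^'-).

Definition cadlag s t Y : Prop :=
  (forall u, s <= u < t -> Y @ u^'+ --> Y u) /\
  (forall u, s < u <= t -> cvg (Y @ u^'-)).

Definition D_path p T Y : Prop :=
  cadlag 0 T Y /\ (pvar p Y 0 T < +oo)%E.

Definition D_path2 q T A : Prop :=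
  [/\ forall t : R, 0 <= t <= T -> cadlag 0 t (A ^~ t),
      forall s, 0 <= s <= T -> cadlag s T (A s) &
      (pvar2 q A 0 T < +oo)%E].

Definition stopped t Y : R -> E := fun s => Y (Num.min s t).

End Variation.

Section RoughPath.
Context {R : realType} {d : nat}.

(* Vectors are rows, so that x (tensor) y is the matrix (x_i * y_j). *)
Definition tensor (x y : 'rV[R]_d) : 'M[R]_d := x^T *m y.

Definition rough_path (p T : R) (X : R -> 'rV[R]_d) (XX : R -> R -> 'M[R]_d) :
    Prop :=
  [/\ D_path p T X, D_path2 (p / 2) T XX &
      forall s u t, 0 <= s -> s <= u -> u <= t -> t <= T ->
        XX s t = XX s u + XX u t + tensor (X u - X s) (X t - X u)].

Definition rp_norm (p : R) (X : R -> 'rV[R]_d) (XX : R -> R -> 'M[R]_d)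
    (s t : R) : \bar R :=
  (pvar p X s t + pvar2 (p / 2)%R XX s t)%E.

End RoughPath.

(* Linear maps are encoded by matrices acting on rows, following [lin_mx] for
   matrix-valued maps:
   - A : 'M_(d, k) stands for the map x |-> x *m A in L(R^d; R^k);
   - A : 'M_(d, d * k) stands for the map in L(R^d; L(R^d; R^k)) sending the
     i-th basis vector to vec_mx (row i A). *)
Section LinearMaps.
Context {R : realType} {d k : nat}.

Definition ev1 (A : 'M[R]_(d, k)) (x : 'rV[R]_d) : 'rV[R]_k := x *m A.

Definition ev2 (A : 'M[R]_(d, d * k)) (x : 'rV[R]_d) : 'M[R]_(d, k) :=
  vec_mx (x *m A).

(* The image of Z under A seen as an element of L(R^d (tensor) R^d; R^k);
   see [ev_tensorE]. *)
Definition ev_tensor (A : 'M[R]_(d, d * k)) (Z : 'M[R]_d) : 'rV[R]_k :=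
  \sum_(i < d) row i Z *m vec_mx (row i A).

Lemma ev_tensorE A x y : ev_tensor A (tensor x y) = ev1 (ev2 A x) y.
Proof.
rewrite /ev_tensor /tensor /ev1 /ev2 [x *m A]mulmx_sum_row linear_sum /=.
rewrite mulmx_sumr; apply: eq_bigr => i _.
rewrite row_mul linearZ /= -scalemxAr scalemxAl; congr (_ *m _).
by apply/rowP => j; rewrite !mxE big_ord1 !mxE.
Qed.

End LinearMaps.

(* Controlled paths with values in E; the derivative takes its values in a
   space L encoding L(R^d; E) through the evaluation map ev ([ev1] when
   E = R^k, [ev2] when E = L(R^d; R^k)). *)
Section ControlledPath.
Context {R : realType} {d : nat} {E L : normedModType R}.
Variables (ev : L -> 'rV[R]_d -> E) (p : R) (X : R -> 'rV[R]_d).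

Definition remainder (Y : R -> E) (Y' : R -> L) (s t : R) : E :=
  Y t - Y s - ev (Y' s) (X t - X s).

Definition controlled (T : R) (Y : R -> E) (Y' : R -> L) : Prop :=
  [/\ D_path p T Y, D_path p T Y' & D_path2 (p / 2) T (remainder Y Y')].

Definition cnorm (Y : R -> E) (Y' : R -> L) (s t : R) : \bar R :=
  (`|Y' s|%:E + pvar p Y' s t + pvar2 (p / 2)%R (remainder Y Y') s t)%E.

Definition cdist (Y : R -> E) (Y' : R -> L) (Z : R -> E) (Z' : R -> L)
    (s t : R) : \bar R :=
  (`|Y' s - Z' s|%:E + pvar p (fun u => Y' u - Z' u)%R s t
   + pvar2 (p / 2)%R
       (fun u v => remainder Y Y' u v - remainder Z Z' u v)%R s t)%E.

End ControlledPath.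

Section RoughIntegral.
Context {R : realType} {d k : nat}.
Variables (X : R -> 'rV[R]_d) (XX : R -> R -> 'M[R]_d).

(* Convergence along partitions of [s, t] with mesh tending to 0. *)
Definition mesh_filter (s t : R) : set_system (seq R) :=
  [set A | exists2 e : R, 0 < e & forall P, itv_partition s t P ->
     (forall i, (i < size P)%N ->
        nth t (s :: P) i.+1 - nth t (s :: P) i < e) -> A P].

Definition rough_sum (V : R -> 'M[R]_(d, k)) (V' : R -> 'M[R]_(d, d * k))
    (s t : R) (P : seq R) : 'rV[R]_k :=
  \sum_(0 <= i < size P)
    let u := nth t (s :: P) i in let v := nth t (s :: P) i.+1 in
    (ev1 (V u) (X v - X u) + ev_tensor (V' u) (XX u v)).

Definition is_rough_integral (V : R -> 'M[R]_(d, k))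
    (V' : R -> 'M[R]_(d, d * k)) (s t : R) (I : 'rV[R]_k) : Prop :=
  rough_sum V V' s t @ mesh_filter s t --> I.

End RoughIntegral.

Section Functionals.
Context {R : realType} {d k : nat}.
Variables (p T : R) (X : R -> 'rV[R]_d).

Notation controlledY := (controlled ev1 p X T).

Variables
  (F : (R -> 'rV[R]_k) -> R -> 'M[R]_(d, k))
  (F' : (R -> 'rV[R]_k) -> (R -> 'M[R]_(d, k)) -> R -> 'M[R]_(d, d * k)).

(* F and F' are functionals of paths on [0, T]: they do not see the values
   that their arguments take outside [0, T]. *)
Definition on_interval : Prop :=
  forall Y Z Y' Z',
    (forall t : R, 0 <= t <= T -> Y t = Z t) ->
    (forall t : R, 0 <= t <= T -> Y' t = Z' t) ->
    forall t : R, 0 <= t <= T -> F Y t = F Z t /\ F' Y Y' t = F' Z Z' t.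

(* A stopped pair need not be controlled by X (which is not stopped), which is
   why F and F' are total: the second condition says that the values at time t
   are determined by the restrictions of Y and Y' to [0, t]. *)
Definition nonanticipative : Prop :=
  forall Y Y', controlledY Y Y' ->
    controlled ev2 p X T (F Y) (F' Y Y') /\
    forall t : R, 0 <= t <= T ->
      F Y t = F (stopped t Y) t /\
      F' Y Y' t = F' (stopped t Y) (stopped t Y') t.

Definition growth_conditions (C : R) : Prop :=
  forall Y Y', controlledY Y Y' -> forall s t : R, 0 <= s -> s < t -> t <= T ->
  [/\ `|F Y t| <= C,
      (`|F Y t - left_limit (F Y) t|%:E <=
         C%:E * (1 + pvar_left p Y s t + `|Y t - left_limit Y t|%:E))%E,
      (pvar p (F Y) s t <=
         C%:E * (1 + (`|Y' s|%:E + pvar p Y' s t) * pvar p X s t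
                 + pvar2 (p / 2)%R (remainder ev1 X Y Y') s t))%E &
      (cnorm ev2 p X (F Y) (F' Y Y') s t <=
         C%:E * (1 + cnorm ev1 p X Y Y' s t) ^+ 2
         * (1 + pvar p X s t) ^+ 2)%E].

Definition lipschitz_conditions (K C : R) : Prop :=
  forall Y Y' Z Z', controlledY Y Y' -> controlledY Z Z' ->
  forall s t : R, 0 <= s -> s < t -> t <= T ->
  (cnorm ev1 p X Y Y' s t <= K%:E)%E -> (cnorm ev1 p X Z Z' s t <= K%:E)%E ->
  (pvar p (fun u => F Y u - F Z u)%R s t <=
     C%:E * (`|Y s - Z s|%:E + pvar p (fun u => Y u - Z u)%R s t))%E /\
  (cdist ev2 p X (F Y) (F' Y Y') (F Z) (F' Z Z') s t <=
     C%:E * (`|Y s - Z s|%:E + cdist ev1 p X Y Y' Z Z' s t))%E.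

Definition is_solution (XX : R -> R -> 'M[R]_d)
    (y : R -> 'rV[R]_k) (y' : R -> 'M[R]_(d, k))
    (Y : R -> 'rV[R]_k) (Y' : R -> 'M[R]_(d, k)) : Prop :=
  [/\ controlledY Y Y',
      forall t : R, 0 <= t <= T -> Y' t = y' t + F Y t &
      forall t : R, 0 <= t <= T -> exists2 I,
        is_rough_integral X XX (F Y) (F' Y Y') 0 t I & Y t = y t + I].

End Functionals.

(* Main.v *)
(* The Picard map sends (Y, Y') to (y + int F(Y) dX, y' + F(Y)).  Rough integrals
   are estimated by Young's point deletion, in a form where the integrand is only
   seen before the right end of the interval.  Hence, where the variation of the
   rough path on [u, v[ is small, the growth conditions make the Picard map
   preserve explicit bounds on the variation of Y' and on the remainder of Y, on
   all such intervals at once and whatever the initial value.  As [0, T] splits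
   into finitely many of them, their number being controlled by the variation of
   the rough path, all iterates starting from (y, y') obey one global bound that
   does not involve the Lipschitz constants; it is inherited by the limit.
   Convergence and uniqueness follow from a contraction estimate on still smaller
   half-open intervals, propagated over [0, T] by real induction: a jump at the
   right end of an interval only depends on what happens before it.  Initially
   F(Y) is determined by Y(0), as F is non-anticipative. *)

Require Import Defs.
From mathcomp Require Import all_boot all_order all_algebra.
From mathcomp Require Import all_classical all_reals all_analysis.
From mathcomp Require Import ring lra.

Set Implicit Arguments.
Unset Strict Implicit.
Unset Printing Implicit Defensive.

Import Order.TTheory GRing.Theory Num.Theory.
Import numFieldNormedType.Exports.

Local Open Scope classical_set_scope.
Local Open Scope ring_scope.

(** * Partition sums and variation bounds *)

(** Two scales are kept apart. [eps] depends on the growth constants only, and the number of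
    intervals on that scale enters the final bound. [del] depends on the Lipschitz constant for the
    resulting bound K, about whose dependence on K and X nothing is known, so that intervals on that
    scale must never be counted; real induction avoids any count. By Chen's relation, the defect of
    V_u X_{u,v} + V'_u XX_{u,v} consists of two products, of the remainder of V with X and of the
    increment of V' with XX, each of total exponent 2/p + 1/p = 3/p > 1. One half of the surplus
    over 1 keeps the series of deletion costs convergent; the other half becomes a power of the
    oscillation of the left factor. Near a jump the variation stays large however fine the mesh, but
    the oscillation between suitably marked points is small, and this makes the Riemann sums
    converge along all fine meshes. K_p must be fixed before the data: a bound is produced for each
    integer majorizing its three arguments, and summing these bounds makes it monotone. *)

Section PartitionSums.
Context {R : realType}.

(** The sums of [variation2_sum] and [rough_sum] (see [psumE]) by recursion on the list: the left
    end [s] is an argument, so that inductions on partitions need no indices. *)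
Fixpoint psum {V : nmodType} (A : R -> R -> V) (s : R) (P : seq R) : V :=
  if P is u :: P' then A s u + psum A u P' else 0.

Lemma psumE {V : nmodType} (A : R -> R -> V) x0 s P :
  \sum_(0 <= i < size P) A (nth x0 (s :: P) i) (nth x0 (s :: P) i.+1)
  = psum A s P.
Proof.
elim: P s => [|u P IH] s /=; first by rewrite big_geq.
by rewrite big_nat_recl//= -IH.
Qed.

Lemma psum_cat {V : nmodType} (A : R -> R -> V) s P Q :
  psum A s (P ++ Q) = psum A s P + psum A (last s P) Q.
Proof.
by elim: P s => [|u P IH] s /=; [rewrite add0r | rewrite IH addrA].
Qed.

Lemma psumD {V : nmodType} (A B : R -> R -> V) s P :
  psum (fun u v => A u v + B u v) s P = psum A s P + psum B s P.
Proof.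
by elim: P s => [|u P IH] s /=; [rewrite addr0 | rewrite IH addrACA].
Qed.

Lemma psumZ (c : R) (A : R -> R -> R) s P :
  psum (fun u v => c * A u v) s P = c * psum A s P.
Proof.
by elim: P s => [|u P IH] s /=; [rewrite mulr0 | rewrite IH mulrDr].
Qed.

Lemma psum_ge0 (A : R -> R -> R) s P :
  (forall u v, 0 <= A u v) -> 0 <= psum A s P.
Proof. by move=> A0; elim: P s => [|u P IH] s //=; rewrite addr_ge0. Qed.

Lemma partition_tail (s t u : R) P : itv_partition s t (u :: P) ->
  [/\ s < u, u <= t & itv_partition u t P].
Proof.
move=> sP; have sP' := itv_partition_cons sP; split => //.
- by case: sP => /= /andP[].
- exact: itv_partition_le sP'.
Qed.

Lemma ler_psum (A B : R -> R -> R) s t P : itv_partition s t P ->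
  (forall u v, s <= u -> u < v -> v <= t -> A u v <= B u v) ->
  psum A s P <= psum B s P.
Proof.
elim: P s => [//|u P IH] s /= /partition_tail[su ut uP] AB.
rewrite lerD ?AB// IH// => x y ux; exact/AB/(le_trans (ltW su)).
Qed.

Definition segment (s t : R) : seq R := if s < t then [:: t] else [::].

Lemma segmentP (s t : R) : s <= t -> itv_partition s t (segment s t).
Proof.
rewrite /segment le_eqVlt => /orP[/eqP->|st]; first by rewrite ltxx; split=> /=.
by rewrite st; exact: itv_partition1.
Qed.

Lemma partition_prefix (s t : R) P Q : itv_partition s t (P ++ Q) ->
  itv_partition s (last s P) P /\ itv_partition (last s P) t Q.
Proof.
by move=> [/=]; rewrite cat_path last_cat => /andP[sP PQ] lt; split; split.
Qed.

Lemma partition_last (s t : R) P : itv_partition s t P -> last s P = t.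
Proof. by case=> _ /eqP. Qed.

Lemma partition_rcons (s t : R) P : s < t -> itv_partition s t P ->
  exists2 P', P = rcons P' t & itv_partition s (last s P') P' /\ last s P' < t.
Proof.
case/lastP: P => [st /itv_partition_nil/eqP|P' x st sP].
  by rewrite (lt_eqF st).
have xt := partition_last sP; rewrite last_rcons in xt; subst x.
exists P' => //; move: sP; rewrite -cats1 => /partition_prefix[sP'].
by case/partition_tail.
Qed.

Lemma partition_mem (s t : R) P x : itv_partition s t P -> x \in P ->
  s < x /\ x <= t.
Proof.
move=> sP /path.splitPr xP; case: xP sP => P1 P2 /partition_prefix[s1].
case/partition_tail => lx xt _; split=> //.
exact: le_lt_trans (itv_partition_le s1) lx.
Qed.

(** Locates where a partition crosses a threshold: with [G] an inequality it isolates the interval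
    around a given point, with [G] the goodness of [s, x] the step at which the variation becomes
    large. *)
Lemma first_failure (G : pred R) s P : G s -> G (last s P) \/
  exists P1 y P2, [/\ P = P1 ++ y :: P2, G (last s P1) & ~~ G y].
Proof.
elim: P s => [|u P IH] s Gs; [by left | have [Gu|Gu] := boolP (G u)].
- have [|[P1 [y [P2 [-> GP1 Gy]]]]] := IH u Gu; first by left.
  by right; exists (u :: P1), y, P2.
- by right; exists [::], u, P.
Qed.

End PartitionSums.

Section VariationBounds.
Context {R : realType} {E : normedModType R}.
Implicit Types (A : R -> R -> E) (q s t M : R).

(* [vb q A s t M] says that the q-variation of [A] on [s, t] is at most [M] (see
   [pvar2_le]).  Arguing with such bounds keeps extended reals out of the
   estimates. *)
Definition vb q A s t M : Prop := forall P, itv_partition s t P ->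
  psum (fun u v => `|A u v| `^ q) s P <= M `^ q.

Lemma powR2_ge0 q A u v : 0 <= `|A u v| `^ q.
Proof. exact: powR_ge0. Qed.

Lemma vb_restrict q A s t u v M :
  vb q A s t M -> s <= u -> v <= t -> vb q A u v M.
Proof.
move=> AM su vt P uP; have uv := itv_partition_le uP.
have := AM _ (itv_partition_cat (segmentP su)
  (itv_partition_cat uP (segmentP vt))).
rewrite !psum_cat (partition_last (segmentP su)); apply: le_trans.
rewrite -[leLHS]add0r; apply: lerD; first exact/psum_ge0/powR2_ge0.
by rewrite lerDl; exact/psum_ge0/powR2_ge0.
Qed.

Lemma vb_point q A s t u v M : 0 < q -> 0 <= M -> vb q A s t M ->
  s <= u -> u < v -> v <= t -> `|A u v| <= M.
Proof.
move=> q0 M0 /vb_restrict AM su uv vt.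
have := AM _ _ su vt _ (itv_partition1 uv); rewrite /= addr0.
by apply: contraTT; rewrite -!ltNge; apply: gt0_ltr_powR; rewrite ?nnegrE.
Qed.

Lemma vb_le q A s t M M' : 0 <= q -> 0 <= M -> M <= M' ->
  vb q A s t M -> vb q A s t M'.
Proof.
move=> q0 M0 MM' AM P /AM/le_trans; apply.
by apply: ge0_ler_powR; rewrite ?nnegrE// (le_trans M0).
Qed.

Lemma vb_refl q A s t M : t <= s -> vb q A s t M.
Proof.
move=> ts P sP; have := itv_partition_le sP.
rewrite le_eqVlt ltNge ts orbF => /eqP st; move: sP; rewrite st.
by move=> /itv_partitionxx ->; rewrite /= powR_ge0.
Qed.

End VariationBounds.

Section VariationBoundsOperations.
Context {R : realType} {E E1 E2 : normedModType R}.
Implicit Types (q s t M : R).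

Lemma vb_scale q (A : R -> R -> E1) (B : R -> R -> E) s t c M :
  0 <= q -> 0 <= c -> 0 <= M ->
  (forall u v, s <= u -> u < v -> v <= t -> `|B u v| <= c * `|A u v|) ->
  vb q A s t M -> vb q B s t (c * M).
Proof.
move=> q0 c0 M0 BA AM P sP; rewrite powRM//.
apply: le_trans (ler_wpM2l (powR_ge0 _ _) (AM _ sP)).
rewrite -psumZ; apply: ler_psum sP _ => u v su uv vt.
rewrite -powRM//; apply: ge0_ler_powR; rewrite ?nnegrE ?mulr_ge0//.
exact: BA.
Qed.

Lemma vb_eq q (A B : R -> R -> E) s t M :
  (forall u v, s <= u -> u < v -> v <= t -> A u v = B u v) ->
  vb q A s t M -> vb q B s t M.
Proof.
move=> AB AM P sP; have := AM _ sP; apply: le_trans.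
by apply: ler_psum sP _ => u v su uv vt; rewrite AB.
Qed.

Lemma powRD_ge (q x y : R) : 1 <= q -> 0 <= x -> 0 <= y ->
  x `^ q + y `^ q <= (x + y) `^ q.
Proof.
move=> q1 x0 y0; have q0 := lt_le_trans ltr01 q1.
rewrite -(mulr_powRB1 x0 q0) -(mulr_powRB1 y0 q0).
rewrite -(mulr_powRB1 (addr_ge0 x0 y0) q0) mulrDl.
by apply: lerD; apply: ler_wpM2l => //; apply: ge0_ler_powR;
  rewrite ?nnegrE ?subr_ge0 ?addr_ge0// ?lerDl ?lerDr.
Qed.

Lemma powRD_le (q x y : R) : 0 <= q -> 0 <= x -> 0 <= y ->
  (x + y) `^ q <= 2 `^ q * (x `^ q + y `^ q).
Proof.
move=> q0; wlog xy : x y / x <= y => [H x0 y0|x0 y0].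
  have [/H|/ltW/H] := leP x y; first exact.
  by rewrite addrC [_ `^ _ + _]addrC; exact.
apply: (@le_trans _ _ ((2 * y) `^ q)).
  by apply: ge0_ler_powR; rewrite ?nnegrE ?addr_ge0// ?mulr_ge0//; lra.
by rewrite powRM// ler_wpM2l ?powR_ge0// lerDr powR_ge0.
Qed.

(** A crude Minkowski inequality: the factor 2 comes from x + y <= 2 max(x, y) in [powRD_le], and
    superadditivity of the q-th power recombines [a] and [b]. Assuming only a bound on norms lets
    the three maps take values in different spaces. *)
Lemma vbD q (A : R -> R -> E1) (B : R -> R -> E2) (C : R -> R -> E)
    s t a b : 1 <= q -> 0 <= a -> 0 <= b ->
  (forall u v, s <= u -> u < v -> v <= t -> `|C u v| <= `|A u v| + `|B u v|) ->
  vb q A s t a -> vb q B s t b -> vb q C s t (2 * (a + b)).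
Proof.
move=> q1 a0 b0 CAB Aa Bb P sP; have q0 : 0 <= q by rewrite (le_trans _ q1).
rewrite powRM ?addr_ge0//.
apply: (le_trans _ (ler_wpM2l (powR_ge0 _ _) (powRD_ge q1 a0 b0))).
apply: (le_trans _ (ler_wpM2l (powR_ge0 _ _) (lerD (Aa _ sP) (Bb _ sP)))).
rewrite -psumD -psumZ; apply: ler_psum sP _ => u v su uv vt.
apply: (le_trans _ (powRD_le q0 (normr_ge0 _) (normr_ge0 _))).
by apply: ge0_ler_powR; rewrite ?nnegrE ?addr_ge0//; exact: CAB.
Qed.

(** Splitting x^r = x^(r-q) x^q, where the first factor is at most M^(r-q) by [vb_point]. *)
Lemma vb_exponent q r (A : R -> R -> E) s t M : 0 < q -> q <= r -> 0 <= M ->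
  vb q A s t M -> vb r A s t M.
Proof.
move=> q0 qr M0 AM P sP; have r0 := lt_le_trans q0 qr.
have powR_split x : x `^ r = x `^ (r - q) * x `^ q.
  by rewrite -powRD subrK// (gt_eqF r0).
rewrite powR_split; apply: (le_trans _ (ler_wpM2l (powR_ge0 _ _) (AM _ sP))).
rewrite -psumZ; apply: ler_psum sP _ => u v su uv vt.
rewrite powR_split ler_wpM2r ?powR_ge0// ge0_ler_powR ?nnegrE ?subr_ge0//.
exact: vb_point AM su uv vt.
Qed.

(** At most one interval of a partition has [u] in its interior. It is paid by [M3], the others by
    [M1] and [M2], and the q-th powers recombine by superadditivity. *)
Lemma vb_glue q (A : R -> R -> E) s t u M1 M2 M3 :
  1 <= q -> 0 <= M1 -> 0 <= M2 -> 0 <= M3 ->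
  s <= u -> u <= t ->
  vb q A s u M1 -> vb q A u t M2 ->
  (forall x y, s <= x -> x < u -> u < y -> y <= t -> `|A x y| <= M3) ->
  vb q A s t (M1 + M2 + M3).
Proof.
move=> q1 M10 M20 M30 su ut A1 A2 A3 P sP.
have q0 : 0 <= q by rewrite (le_trans _ q1).
apply: le_trans (powRD_ge q1 (addr_ge0 M10 M20) M30).
apply: le_trans (lerD (powRD_ge q1 M10 M20) (lexx _)).
have [Pu|[P1 [y [P2 [PE Pu]]]]] := @first_failure _ (<= u) s P su.
  have tu : t = u.
    by apply/eqP; rewrite eq_le ut andbT -(partition_last sP).
  rewrite tu in sP *; rewrite -addrA.
  by apply: le_trans (A1 _ sP) _; rewrite lerDl addr_ge0 ?powR_ge0.
rewrite -ltNge => uy; move: sP; rewrite PE => sP.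
have [sP1 /partition_tail[_ yt yP2]] := partition_prefix sP.
have xu : last s P1 <= u := Pu.
have sP1u := vb_restrict A1 (lexx _) xu sP1.
rewrite psum_cat /= -addrA; apply: lerD => //.
move: xu; rewrite le_eqVlt => /orP[/eqP xu|xu].
  have := (partition_prefix sP).2; rewrite xu => /A2/le_trans; apply.
  by rewrite lerDl powR_ge0.
rewrite addrC; apply: lerD; first exact: (vb_restrict A2 (ltW uy) (lexx _) yP2).
apply: ge0_ler_powR; rewrite ?nnegrE//.
exact: A3 (itv_partition_le sP1) xu uy yt.
Qed.

(** Only the last interval of a partition reaches [t]; the others lie in some [s, w] with w < t.
    This is how the effect of a jump at [t] is added to estimates on half-open intervals. *)
Lemma vb_close q (A : R -> R -> E) s t M M' : 1 <= q -> 0 <= M -> 0 <= M' ->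
  (forall w, s <= w -> w < t -> vb q A s w M) ->
  (forall u, s <= u -> u < t -> `|A u t| <= M') ->
  vb q A s t (M + M').
Proof.
move=> q1 M0 M'0 AM AM'; have q0 : 0 <= q by rewrite (le_trans _ q1).
have [st|/vb_refl] := ltP s t; last exact.
move=> P /[dup] sP /(partition_rcons st)[P' PE [sP' lt]].
rewrite PE -cats1 psum_cat /= addr0.
have sl := itv_partition_le sP'.
apply: le_trans (powRD_ge q1 M0 M'0); apply: lerD; first exact: AM sP'.
by apply: ge0_ler_powR; rewrite ?nnegrE//; exact: AM'.
Qed.

(* [w u v] is the optimal bound on [u, v], whose q-th power is superadditive. *)
Lemma vb_control q (A : R -> R -> E) s t M : 0 < q -> 0 <= M -> vb q A s t M ->
  exists w : R -> R -> R,
    [/\ forall u v, 0 <= w u v,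
        forall u v, s <= u -> v <= t -> vb q A u v (w u v),
        forall u v, s <= u -> u <= v -> v <= t -> w u v <= M &
        forall P, itv_partition s t P ->
          psum (fun u v => w u v `^ q) s P <= M `^ q].
Proof.
move=> q0 M0 AM.
pose S u v := [set psum (fun x y => `|A x y| `^ q) u P | P in itv_partition u v].
pose W u v := sup (S u v).
have Sub u v : s <= u -> v <= t -> forall x, S u v x -> x <= M `^ q.
  by move=> su vt x [P /(vb_restrict AM su vt)] PM <-.
have S0 u v : u <= v -> S u v !=set0.
  by move=> uv; eexists; exists (segment u v); [exact: segmentP|].
have W_ub u v P : s <= u -> v <= t -> itv_partition u v P ->
    psum (fun x y => `|A x y| `^ q) u P <= W u v.
  move=> su vt uP; apply: ub_le_sup; last by exists P.
  by exists (M `^ q); exact: Sub.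
have W_ge0 u v : s <= u -> u <= v -> v <= t -> 0 <= W u v.
  move=> su uv vt; apply: le_trans (W_ub _ _ _ su vt (segmentP uv)).
  by apply: psum_ge0 => ? ?; exact: powR_ge0.
have W_add u v : forall P, s <= u -> v <= t -> itv_partition u v P ->
    psum W u P <= W u v.
  move=> P; elim: P u => [|x P IH] u su vt uP /=.
    have uv := itv_partition_nil uP; rewrite uv in su *.
    by apply: W_ge0.
  have [ux xv xP] := partition_tail uP.
  have sx : s <= x by rewrite (le_trans su)// ltW.
  have xt : x <= t by exact: le_trans vt.
  (* Superadditivity of the supremum: the two suprema are removed in turn, and the partitions of
     [u, x] and [x, v] are concatenated. *)
  apply: le_trans (lerD (lexx _) (IH _ sx vt xP)) _.
  rewrite -lerBrDr; apply: sup_le_ub; first exact/S0/ltW.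
  move=> _ [P1 uP1 <-]; rewrite lerBrDr -lerBrDl.
  apply: sup_le_ub; first by apply: S0; exact: itv_partition_le xP.
  move=> _ [P2 xP2 <-]; rewrite lerBrDl.
  have := W_ub _ _ _ su vt (itv_partition_cat uP1 xP2).
  by rewrite psum_cat (partition_last uP1).
have powRK x : 0 <= x -> (x `^ q^-1) `^ q = x.
  by move=> x0; rewrite -powRrM mulVf ?powRr1// gt_eqF.
have W_le u v : s <= u -> u <= v -> v <= t -> W u v <= M `^ q.
  by move=> su uv vt; apply: sup_le_ub; [exact: S0 | exact: Sub].
exists (fun u v => W u v `^ q^-1); split.
- by move=> u v; exact: powR_ge0.
- move=> u v su vt P uP; have uv := itv_partition_le uP.
  by rewrite powRK ?W_ge0// W_ub.
- move=> u v su uv vt; rewrite -[leRHS](powRr1 M0) -(mulfV (lt0r_neq0 q0)).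
  rewrite powRrM; apply: ge0_ler_powR; last exact: W_le.
  + by rewrite invr_ge0 ltW.
  + by rewrite nnegrE W_ge0.
  + by rewrite nnegrE powR_ge0.
- move=> P sP; apply: le_trans (W_le s t (lexx _) (itv_partition_le sP) (lexx _)).
  apply: le_trans (W_add _ _ _ (lexx _) (lexx _) sP).
  apply: ler_psum sP _ => u v su uv vt; rewrite powRK// W_ge0//; exact: ltW.
Qed.

End VariationBoundsOperations.

(** * Real induction and small variation near a point *)

Section RealInduction.
Context {R : realType}.

(** Replaces compactness of [a, b]: the supremum of the points where [P] holds is one of them by the
    last hypothesis, and cannot lie below [b] by the one before. *)
Lemma real_induction (P : R -> Prop) a b : a <= b ->
  (forall u v, a <= u -> u <= v -> v <= b -> P v -> P u) ->
  P a ->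
  (forall s, a <= s -> s < b -> P s -> exists v, [/\ s < v, v <= b & P v]) ->
  (forall t, a < t -> t <= b -> (forall s, a <= s -> s < t -> P s) -> P t) ->
  P b.
Proof.
move=> ab Pdown Pa Pright Pleft.
pose S := [set t | a <= t <= b /\ P t].
have Sa : S a by rewrite /S /= lexx ab.
have Sub : has_ubound S by exists b => t [/andP[]].
have a_s : a <= sup S by exact: ub_le_sup.
have s_b : sup S <= b.
  by apply: sup_le_ub; [exists a | move=> t [/andP[]]].
have Plt s : a <= s -> s < sup S -> P s.
  move=> a_le ss; have [|t [/andP[at_ tb] Pt] st] := sup_gt _ ss; first by exists a.
  by apply: Pdown Pt => //; exact: ltW.
have Ps : P (sup S).
  move: a_s; rewrite le_eqVlt => /orP[/eqP <-//|a_s].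
  exact: Pleft.
move: s_b; rewrite le_eqVlt => /orP[/eqP <-//|s_b].
have [v [sv vb Pv]] := Pright _ a_s s_b Ps.
have : v <= sup S.
  by apply: ub_le_sup => //; split=> //; rewrite vb (le_trans a_s) ?ltW.
by rewrite leNgt sv.
Qed.

Lemma near_rightP (P : set R) s : (\forall u \near s^'+, P u) <->
  exists2 v, s < v & forall u, s < u -> u < v -> P u.
Proof.
split=> [/nbhs_right0P|[v sv vP]]; last first.
  near=> u; apply: vP; near: u; first exact: nbhs_right_gt.
  exact: nbhs_right_lt.
move=> [e /= e0 eP]; exists (s + e); rewrite ?ltrDl// => u su ue.
have := eP (u - s); rewrite /ball_ /= sub0r normrN ger0_norm ?subr_ge0 ?ltW//.
by rewrite ltrBlDl subr_gt0 subrKC; apply.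
Unshelve. all: by end_near. Qed.

Lemma near_leftP (P : set R) t : (\forall u \near t^'-, P u) <->
  exists2 v, v < t & forall u, v < u -> u < t -> P u.
Proof.
split=> [/nbhs_left0P|[v vt vP]]; last first.
  near=> u; apply: vP; near: u; first exact: nbhs_left_gt.
  exact: nbhs_left_lt.
move=> [e /= e0 eP]; exists (t - e); rewrite ?ltrBlDr ?ltrDl// => u ue ut.
have := eP (t - u); rewrite /ball_ /= sub0r normrN ger0_norm ?subr_ge0 ?ltW//.
rewrite subr_gt0 opprB subrKC; apply => //.
by rewrite ltrBlDr -ltrBlDl.
Unshelve. all: by end_near. Qed.

End RealInduction.

Section OneSidedLimits.
Context {R : realType} {E : normedModType R}.
Implicit Types (Y : R -> E).

Lemma cvg_rightP Y s l : (Y @ s^'+ --> l) <-> forall e, 0 < e ->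
  exists2 v, s < v & forall u, s < u -> u < v -> `|Y u - l| <= e.
Proof.
rewrite cvgrPdist_le; split=> H e e0.
- have /near_rightP[v sv vP] := H _ e0.
  by exists v => // u su uv; rewrite distrC; exact: vP.
- apply/near_rightP; have [v sv vP] := H _ e0.
  by exists v => // u su uv; rewrite distrC; exact: vP.
Qed.

Lemma cvg_leftP Y t l : (Y @ t^'- --> l) <-> forall e, 0 < e ->
  exists2 v, v < t & forall u, v < u -> u < t -> `|Y u - l| <= e.
Proof.
rewrite cvgrPdist_le; split=> H e e0.
- have /near_leftP[v sv vP] := H _ e0.
  by exists v => // u su uv; rewrite distrC; exact: vP.
- apply/near_leftP; have [v sv vP] := H _ e0.
  by exists v => // u su uv; rewrite distrC; exact: vP.
Qed.

End OneSidedLimits.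

(** * Smallness of the variation on either side of a point, and its semicontinuity *)

Section SmallVariation.
Context {R : realType} {E : normedModType R}.
Implicit Types (A : R -> R -> E) (q s t M : R).

Lemma archi_unbounded (x y : R) : 0 < x -> (forall n : nat, n%:R * x <= y) ->
  False.
Proof.
move=> x0 xy; have := xy (Num.truncn (y / x)).+1.
rewrite leNgt => /negP; apply; rewrite -ltr_pdivrMr//.
exact: truncnS_gt.
Qed.

(** Otherwise every interval ending before [t] can be continued by one whose sum exceeds e^q, and
    finitely many of these exhaust M^q. The point [t] itself is never reached, so its jump may be
    large. *)
Lemma vb_left_small q A a t M e : a < t -> 0 < e -> vb q A a t M ->
  exists u, [/\ a <= u, u < t &
    forall w, u <= w -> w < t -> vb q A u w e].
Proof.
move=> at_ e0 AM; apply: contrapT => H.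
have bad u : a <= u -> u < t -> exists w P,
    [/\ u <= w, w < t, itv_partition u w P &
      e `^ q < psum (fun x y => `|A x y| `^ q) u P].
  move=> au ut; apply: contrapT => nb; apply: H; exists u; split=> //.
  move=> w uw wt P uP; rewrite leNgt; apply/negP => lt; apply: nb.
  by exists w, P.
apply: (@archi_unbounded (e `^ q) (M `^ q)) => [|n]; first exact: powR_gt0.
suff [w [P [aw wt aP nP]]] : exists w P, [/\ a <= w, w < t, itv_partition a w P &
    n%:R * e `^ q <= psum (fun x y => `|A x y| `^ q) a P].
  exact: le_trans nP (vb_restrict AM (lexx _) (ltW wt) aP).
elim: n => [|n [w [P [aw wt aP nP]]]].
  by exists a, [::]; split=> //=; rewrite mul0r.
have [w' [P' [ww' w't wP' eP']]] := bad w aw wt.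
exists w', (P ++ P'); split=> //; first exact: le_trans ww'.
  exact: itv_partition_cat wP'.
rewrite psum_cat (partition_last aP) mulrSr mulrDl mul1r.
by apply: lerD => //; exact: ltW.
Qed.

(** Costly intervals now pile up towards [s]. A costly partition starts at [s], so its first
    interval [s, u] is dropped to make room for the next one: it costs at most half of e^q by the
    convergence of [A s], and the other half is collected on [u, v]. *)
Lemma vb_right_small q A s b M e : 0 < q -> s < b -> 0 < e -> vb q A s b M ->
  (A s @ s^'+ --> (0 : E)) ->
  exists v, [/\ s < v, v <= b & vb q A s v e].
Proof.
move=> q0 sb e0 AM As; apply: contrapT => H.
have bad v : s < v -> v <= b -> exists2 P,
    itv_partition s v P & e `^ q < psum (fun x y => `|A x y| `^ q) s P.
  move=> sv vb; apply: contrapT => nb; apply: H; exists v; split=> //.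
  by move=> P sP; rewrite leNgt; apply/negP => lt; apply: nb; exists P.
set c := e `^ q / 2.
have c0 : 0 < c by rewrite divr_gt0 ?powR_gt0.
have cq0 : 0 < c `^ q^-1 by rewrite powR_gt0.
have [v0 sv0 v0P] := (cvg_rightP _ _ _).1 As _ cq0.
pose v1 := Num.min v0 b.
have sv1 : s < v1 by rewrite lt_min sv0.
have As_small u : s < u -> u < v1 -> `|A s u| `^ q <= c.
  rewrite lt_min => su /andP[uv0 _].
  have -> : c = (c `^ q^-1) `^ q.
    by rewrite -powRrM mulVf ?gt_eqF// powRr1// ltW.
  apply: ge0_ler_powR; rewrite ?nnegrE ?powR_ge0 ?(ltW q0)//.
  by have := v0P _ su uv0; rewrite subr0.
have claim n v : s < v -> v < v1 -> exists u P, [/\ s < u, itv_partition u v P &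
    n%:R * c <= psum (fun x y => `|A x y| `^ q) u P].
  elim: n v => [|n IH] v sv vv1.
    by exists v, [::]; split=> //=; rewrite mul0r.
  have vb : v <= b by move: vv1; rewrite lt_min => /andP[_ /ltW].
  have [[|u P] sP eP] := bad v sv vb; first by move: eP => /=; rewrite ltNge powR_ge0.
  have [su uv uP] := partition_tail sP.
  have uv1 : u < v1 by exact: le_lt_trans vv1.
  have [w [Q [sw wQ nQ]]] := IH u su uv1.
  exists w, (Q ++ P); split=> //; first exact: itv_partition_cat wQ uP.
  rewrite psum_cat (partition_last wQ) mulrSr mulrDl mul1r; apply: lerD => //.
  have := As_small u su uv1; move: eP => /=; rewrite /c.
  by move: (psum _ _ _) (_ `^ _) (_ `^ _) => x y z; lra.
apply: (@archi_unbounded c (M `^ q)) => // n.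
pose v := (s + v1) / 2.
have [||u [P [su uP /le_trans]]] := claim n v; [rewrite /v; lra..|apply].
have vb : v <= b.
  have : v1 <= b by rewrite ge_min lexx orbT.
  by rewrite /v; lra.
exact: (vb_restrict AM (ltW su) vb uP).
Qed.

(** Lower semicontinuity: for a fixed partition, eventually each [|A n u v|] is at least
    [c * |B u v|] with c < 1 and c^q = 1 - e, and then e tends to 0. *)
Lemma vb_lim q (A : nat -> R -> R -> E) (B : R -> R -> E) s t M : 0 < q ->
  (forall u v, s <= u -> u < v -> v <= t ->
     A n u v @[n --> \oo] --> B u v) ->
  (\forall n \near \oo, vb q (A n) s t M) -> vb q B s t M.
Proof.
move=> q0 AB AM P sP.
suff H e : 0 < e -> e < 1 ->
    (1 - e) * psum (fun u v => `|B u v| `^ q) s P <= M `^ q.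
  rewrite leNgt; apply/negP => lt.
  set S := psum _ _ _ in lt H; set m := M `^ q in lt H.
  have m0 : 0 <= m by exact: powR_ge0.
  have S0 : 0 < S by exact: le_lt_trans lt.
  (* For this value of e, (1 - e) S is the midpoint of S and m, hence still above m. *)
  have d0 : 0 < (S - m) / (2 * S) by rewrite divr_gt0 ?subr_gt0 ?mulr_gt0.
  have d1 : (S - m) / (2 * S) < 1 by rewrite ltr_pdivrMr ?mulr_gt0//; lra.
  have := H _ d0 d1.
  have -> : (1 - (S - m) / (2 * S)) * S = (S + m) / 2 by field; rewrite gt_eqF.
  lra.
move=> e0 e1; pose c := (1 - e) `^ q^-1.
have c_q : c `^ q = 1 - e.
  by rewrite /c -powRrM mulVf ?gt_eqF// powRr1// subr_ge0 ltW.
have c0 : 0 <= c by exact: powR_ge0.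
have c1 : c < 1.
  rewrite ltNge; apply/negP => c1.
  have := @ge0_ler_powR _ q (ltW q0) 1 c; rewrite !nnegrE powR1 c_q.
  by move=> /(_ ler01 c0 c1); lra.
have near_le : \forall n \near \oo,
    (1 - e) * psum (fun u v => `|B u v| `^ q) s P <=
    psum (fun u v => `|A n u v| `^ q) s P.
  elim: P s AB sP {AM} => [|u P IH] s AB sP.
    by near=> n; rewrite /= mulr0.
  have [su ut uP] := partition_tail sP.
  have AB' x y : u <= x -> x < y -> y <= t -> A n x y @[n --> \oo] --> B x y.
    by move=> ux; apply: AB; rewrite (le_trans _ ux)// ltW.
  have IHu := IH u AB' uP.
  have head : \forall n \near \oo, (1 - e) * `|B s u| `^ q <= `|A n s u| `^ q.
    have [->|Bsu] := eqVneq (B s u) 0.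
      by near=> n; rewrite normr0 powR0 ?gt_eqF// mulr0 powR_ge0.
    have : \forall n \near \oo, c * `|B s u| <= `|A n s u|.
      have := AB s u (lexx _) su ut.
      move=> /(@cvgr_norm_ge _ _ _ _ _ _ _); apply.
      by rewrite gtr_pMl ?normr_gt0.
    apply: filterS => n cn; rewrite -c_q -powRM//.
    by apply: ge0_ler_powR; rewrite ?nnegrE ?mulr_ge0 ?(ltW q0).
  by near do rewrite /= mulrDr lerD//.
have [n [An Mn]] := filter_ex (filterI near_le AM).
exact: le_trans An (Mn _ sP).
Unshelve. all: by end_near. Qed.

End SmallVariation.

Section LeftLimits.
Context {R : realType} {m n : nat}.

Lemma vb_left_limit q (Y : R -> 'M[R]_(m, n)) a t M : 0 < q -> a < t ->
  vb q (fun u v => Y v - Y u) a t M -> cvg (Y @ t^'-).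
Proof.
move=> q0 at_ YM; apply/cauchy_cvgP/cauchy_exP => e e0.
have [u [au ut uP]] := vb_left_small at_ (divr_gt0 e0 (@ltr0Sn _ 1)) YM.
exists (Y u); apply/near_leftP; exists u => // w uw wt.
rewrite -ball_normE /=; rewrite distrC.
have := @vb_point _ _ _ _ _ _ u w _ q0 (ltW (divr_gt0 e0 (@ltr0Sn _ 1)))
  (uP w (ltW uw) wt) (lexx _) uw (lexx _).
by move=> /le_lt_trans; apply; lra.
Qed.

End LeftLimits.

(** * Sewing *)

Section RiemannSum.
Context {R : realType}.

(* [n^-th <= c (n^-(th-1) - (n+1)^-(th-1))], so the sum telescopes. *)
Lemma riemann_sum_bound (th : R) n : 1 < th ->
  \sum_(1 <= i < n.+1) (i%:R^-1 : R) `^ th <= (th + 1) / (th - 1).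
Proof.
move=> th1; set k := th - 1; have k0 : 0 < k by rewrite subr_gt0.
(* The constant is dictated by i + 1 + k = i + th <= (th + 1) i. The difference is bounded below by
   means of ln(1 + x) <= x and 1 + x <= exp x. *)
have step i : (0 < i)%N -> (i%:R^-1 : R) `^ th <=
    (th + 1) / k * ((i%:R^-1) `^ k - (i.+1%:R^-1) `^ k).
  move=> i0; have i1 : 1 <= i%:R :> R by rewrite ler1n.
  have ii0 : 0 < i%:R :> R by exact: lt_le_trans i1.
  have iV0 : 0 < i%:R^-1 :> R by rewrite invr_gt0.
  have -> : (i%:R^-1 : R) `^ th = (i%:R^-1) `^ k * i%:R^-1.
    by rewrite -[X in _ * X](powRr1 (ltW iV0)) -powRD ?subrK// (gt_eqF iV0) implybT.
  have -> : (i.+1%:R^-1 : R) = i%:R^-1 * (i%:R / i.+1%:R).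
    by rewrite mulrA mulVf ?mul1r// gt_eqF.
  have q0 : 0 < i%:R / i.+1%:R :> R by rewrite divr_gt0// ltr0Sn.
  rewrite powRM ?(ltW iV0) ?(ltW q0)// -[X in X - _]mulr1 -mulrBr mulrCA.
  apply: ler_wpM2l; first exact: powR_ge0.
  have lnq : ln (i%:R / i.+1%:R) <= - (i.+1%:R)^-1 :> R.
    have -> : i%:R / i.+1%:R = 1 + - (i.+1%:R)^-1 :> R.
      by rewrite -natr1; field; rewrite natr1 pnatr_eq0.
    apply: le_ln1Dx; rewrite ltrN2 invf_lt1 ?ltr0Sn// ltr1n ltnS//.
  have qk : (i%:R / i.+1%:R : R) `^ k <= i.+1%:R / (i.+1%:R + k).
    rewrite /powR (gt_eqF q0).
    have : expR (k * ln (i%:R / i.+1%:R)) <= expR (- (k / i.+1%:R)).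
      by rewrite ler_expR -mulrN ler_wpM2l// ltW.
    move=> /le_trans; apply; rewrite expRN.
    have N0 : 0 < i.+1%:R :> R by rewrite ltr0Sn.
    have -> : i.+1%:R / (i.+1%:R + k) = (1 + k / i.+1%:R)^-1.
      move: (i.+1%:R : R) N0 => N N0.
      by field; rewrite !gt_eqF// addr_gt0.
    by rewrite lef_pV2 ?posrE ?expR_gt0 ?addr_gt0 ?divr_gt0// expR_ge1Dx.
  apply: (@le_trans _ _ ((th + 1) / k * (1 - i.+1%:R / (i.+1%:R + k)))); last first.
    apply: ler_wpM2l; last by rewrite lerB.
    by apply: divr_ge0; [lra | exact: ltW].
  have -> : (th + 1) / k * (1 - i.+1%:R / (i.+1%:R + k)) = (th + 1) / (i.+1%:R + k).
    have : 0 < i.+1%:R :> R by rewrite ltr0Sn.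
    by move: (i.+1%:R : R) => N N0; field; rewrite !gt_eqF// addr_gt0.
  rewrite -[leLHS]div1r ler_pdivrMr//.
  have N0 : 0 < i.+1%:R + k by rewrite addr_gt0// ltr0Sn.
  rewrite mulrAC (ler_pdivlMr _ _ N0) mul1r.
  by rewrite -natr1 /k; nra.
apply: (@le_trans _ _ (\sum_(1 <= i < n.+1)
    (th + 1) / k * ((i%:R^-1) `^ k - (i.+1%:R^-1) `^ k))).
  rewrite !big_nat; apply: ler_sum => i /andP[i0 _]; exact: step.
rewrite -mulr_sumr -[leRHS]mulr1; apply: ler_wpM2l.
  by apply: divr_ge0; [lra | exact: ltW].
have -> : \sum_(1 <= i < n.+1) ((i%:R^-1 : R) `^ k - (i.+1%:R^-1) `^ k) =
    1 - (n.+1%:R^-1) `^ k.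
  elim: n => [|n IH]; first by rewrite big_geq// invr1 powR1 subrr.
  by rewrite big_nat_recr//= IH; ring.
by rewrite gerBl powR_ge0.
Qed.

End RiemannSum.

Section Sewing.
Context {R : realType} {E : normedModType R}.
Implicit Types (Xi : R -> R -> E) (marks P Q : seq R).

(** The coboundary of the sewing lemma: the change of a partition sum when the point [u] is deleted
    ([psum_delete]). *)
Definition defect Xi (w u v : R) : E := Xi w v - Xi w u - Xi u v.

Lemma partition_delete (s t m v : R) P Q : itv_partition s t (P ++ m :: v :: Q) ->
  itv_partition s t (P ++ v :: Q).
Proof.
move=> /partition_prefix[sP] /partition_tail[lm mt] /partition_tail[mv vt vQ].
apply: itv_partition_cat sP _; rewrite -cat1s.
exact: itv_partition_cat (itv_partition1 (lt_trans lm mv)) vQ.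
Qed.

Lemma psum_delete Xi s m v P Q :
  psum Xi s (P ++ m :: v :: Q) = psum Xi s (P ++ v :: Q) - defect Xi (last s P) m v.
Proof.
rewrite !psum_cat /=; set w := last s P; set d := defect Xi w m v.
have -> : Xi w v = d + (Xi w m + Xi m v).
  by rewrite /d /defect addrA [_ - _ + Xi w m]addrAC !subrK.
by rewrite -(addrA d) (addrCA (psum Xi s P) d) [RHS]addrC addKr -!addrA.
Qed.

Definition unmarked marks P := count (fun x => x \notin marks) P.

(* Young's argument: the points that are not in [marks] are deleted one at a
   time, always one whose deletion costs least. *)
Lemma deletion marks Xi th K s t P :
  (forall Q, itv_partition s t Q -> {subset marks <= Q} ->
     (0 < unmarked marks Q)%N ->
     exists Q1 m v Q2, [/\ Q = Q1 ++ m :: v :: Q2, m \notin marks &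
       `|defect Xi (last s Q1) m v| <= K * ((unmarked marks Q)%:R^-1) `^ th]) ->
  itv_partition s t P -> {subset marks <= P} ->
  `|psum Xi s P - psum Xi s [seq x <- P | x \in marks]| <=
    K * \sum_(1 <= i < (unmarked marks P).+1) (i%:R^-1 : R) `^ th.
Proof.
move=> H; move En: (unmarked marks P) => n; elim: n P En => [|n IH] P En sP mP.
  have /all_filterP-> : all (mem marks) P.
    by rewrite all_count -(count_predC (mem marks)) [X in (_ + X)%N]En addn0.
  by rewrite subrr normr0 big_geq// mulr0.
have [|Q1 [m [v [Q2 [PE mm dm]]]]] := H P sP mP; first by rewrite En.
have En' : unmarked marks (Q1 ++ v :: Q2) = n.
  move: En; rewrite /unmarked PE !count_cat /= mm => /eqP.
  by rewrite addnCA add1n eqSS => /eqP.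
have mQ : {subset marks <= Q1 ++ v :: Q2}.
  move=> x xm; have := mP x xm; rewrite PE !mem_cat !inE.
  by case: eqP xm mm => [-> ->|].
have := IH _ En' (partition_delete (eq_ind _ _ sP _ PE)) mQ.
have -> : [seq x <- P | x \in marks] = [seq x <- Q1 ++ v :: Q2 | x \in marks].
  by rewrite PE !filter_cat /= (negbTE mm).
move=> h; rewrite PE psum_delete big_nat_recr//= mulrDr addrAC.
by apply: le_trans (ler_normB _ _) _; apply: lerD; [exact: h | rewrite -En].
Qed.

(** The total cost of deleting each unmarked point on its own; [pigeonhole] compares the cheapest
    deletion with the average. *)
Fixpoint triple_sum marks (g : R -> R -> R -> R) s P : R :=
  if P is u :: P' then
    (if P' is v :: _ then (if u \in marks then 0 else g s u v) else 0)
    + triple_sum marks g u P'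
  else 0.

Lemma triple_sum_lower marks g c s P : last s P \in marks ->
  (forall P1 m v P2, P = P1 ++ m :: v :: P2 -> m \notin marks ->
     c <= g (last s P1) m v) ->
  (unmarked marks P)%:R * c <= triple_sum marks g s P.
Proof.
elim: P s => [|u [|v P] IH] s /= lm H; first by rewrite mul0r.
- by rewrite /unmarked /= lm /= mul0r addr0.
- rewrite /unmarked /= natrD mulrDl; apply: lerD.
    case: ifPn => um; rewrite ?mul0r ?mul1r//.
    exact: (H [::] u v P).
  by apply: IH => // P1 m w P2 PE mm; apply: (H (u :: P1) m w P2) => //; rewrite PE.
Qed.

Lemma triple_sum_upper marks (A B : R -> R -> R) s u P :
  (forall x y, 0 <= A x y) -> (forall x y, 0 <= B x y) ->
  triple_sum marks (fun w u v => A w u + B u v) s (u :: P) <=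
    psum A s (belast u P) + psum B u P.
Proof.
move=> A0 B0; elim: P s u => [|v P IH] s u /=; first by rewrite !addr0.
rewrite addrACA; apply: lerD (IH u v).
by case: ifP => // _; exact: addr_ge0.
Qed.

(** The costs add up to at most 2 + 2 < 5, so one of the n deletions costs at most 5/n. The left
    intervals of the triples never include the last interval of the partition: this is why [A] is
    controlled on [s, w] with w < t only, and why all later estimates are blind to a jump of the
    integrand at the right end. *)
Lemma pigeonhole marks (A B : R -> R -> R) s t P :
  (forall x y, 0 <= A x y) -> (forall x y, 0 <= B x y) ->
  t \in marks ->
  (forall w Q, s <= w -> w < t -> itv_partition s w Q -> psum A s Q <= 2) ->
  (forall u Q, s <= u -> itv_partition u t Q -> psum B u Q <= 2) ->
  itv_partition s t P -> (0 < unmarked marks P)%N ->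
  exists P1 m v P2, [/\ P = P1 ++ m :: v :: P2, m \notin marks &
    A (last s P1) m + B m v <= 5 * (unmarked marks P)%:R^-1].
Proof.
move=> A0 B0 tm A2 B2 sP P0; apply: contrapT => H.
have n0 : 0 < (unmarked marks P)%:R :> R by rewrite ltr0n.
have := @triple_sum_lower marks (fun w u v => A w u + B u v)
  (5 * (unmarked marks P)%:R^-1) s P.
rewrite (partition_last sP) mulrCA divff ?gt_eqF// mulr1 => /(_ tm) H5.
have {}H5 : 5 <= triple_sum marks (fun w u v => A w u + B u v) s P.
  apply: H5 => P1 m v P2 PE mm; rewrite leNgt; apply/negP => lt.
  by apply: H; exists P1, m, v, P2; split=> //; exact: ltW.
case: P sP H5 {H P0 n0} => [|u P] sP H5; first by move: H5 => /=; lra.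
have [su ut uP] := partition_tail sP.
have := triple_sum_upper marks s u P A0 B0.
have BP := B2 u P (ltW su) uP.
suff : psum A s (belast u P) <= 2 by move: H5 BP; lra.
case/lastP: P uP sP {H5 BP} => [|P x] uP sP; first by rewrite /=.
have xt := partition_last uP; rewrite last_rcons in xt; subst x.
rewrite belast_rcons.
have := sP; rewrite -rcons_cons -cats1 => /partition_prefix[sP' /partition_tail[lt _ _]].
exact: A2 (itv_partition_le sP') lt sP'.
Qed.

(** As the partition contains all marks and the deleted point [u] is unmarked, no mark lies in (w,
    u] when w is its predecessor; the defect bound is asked for such triples. The constant is the
    pigeonhole factor 5^th times the bound on the series. *)
Lemma marked_sewing marks Xi (A B : R -> R -> R) th K s t P :
  1 < th -> 0 <= K ->
  (forall x y, 0 <= A x y) -> (forall x y, 0 <= B x y) ->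
  t \in marks ->
  (forall w Q, s <= w -> w < t -> itv_partition s w Q -> psum A s Q <= 2) ->
  (forall u Q, s <= u -> itv_partition u t Q -> psum B u Q <= 2) ->
  (forall w u v, s <= w -> w < u -> u < v -> v <= t ->
     (forall x, x \in marks -> w < x -> u < x) ->
     `|defect Xi w u v| <= K * (A w u + B u v) `^ th) ->
  itv_partition s t P -> {subset marks <= P} ->
  `|psum Xi s P - psum Xi s [seq x <- P | x \in marks]| <=
    K * (5 `^ th * ((th + 1) / (th - 1))).
Proof.
move=> th1 K0 A0 B0 tm A2 B2 dXi sP mP.
have th0 : 0 <= th by lra.
apply: le_trans (@deletion marks Xi th (K * 5 `^ th) s t P _ sP mP) _; last first.
  rewrite -mulrA ler_wpM2l// ler_wpM2l ?powR_ge0//.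
  exact: riemann_sum_bound.
move=> Q sQ mQ Q0.
have [Q1 [m [v [Q2 [QE mm ABm]]]]] := pigeonhole A0 B0 tm A2 B2 sQ Q0.
exists Q1, m, v, Q2; split=> //.
have [sQ1 mQ2] := partition_prefix (eq_ind _ _ sQ _ QE).
have [lm mt mvQ2] := partition_tail mQ2.
have [mv vt vQ2] := partition_tail mvQ2.
apply: le_trans (dXi _ _ _ (itv_partition_le sQ1) lm mv vt _) _.
  move=> x xm lx; have := mQ x xm; rewrite QE mem_cat.
  case/orP => [/(partition_mem sQ1)[_]|]; first by rewrite leNgt lx.
  rewrite inE => /orP[/eqP xE|]; first by rewrite xE (negbTE mm) in xm.
  by move=> /(partition_mem mvQ2)[].
rewrite -mulrA ler_wpM2l// -powRM ?invr_ge0//.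
by apply: ge0_ler_powR; rewrite ?nnegrE ?addr_ge0 ?mulr_ge0 ?invr_ge0.
Qed.

End Sewing.

Section YoungSewing.
Context {R : realType} {E : normedModType R}.
Implicit Types (Xi : R -> R -> E) (a b c e : R -> R -> R) (marks P : seq R).

(** The midpoint of 1 and 3/p, where 3/p = 2/p + 1/p is the total exponent of a product of a map of
    finite p/2-variation and one of finite p-variation. *)
Definition young_exponent (p : R) := (3 + p) / (2 * p).

Definition young_const (p : R) : R :=
  locked (5 `^ young_exponent p *
          ((young_exponent p + 1) / (young_exponent p - 1))).

Lemma young_exponent_gt1 (p : R) : 2 < p -> p < 3 -> 1 < young_exponent p.
Proof.
by move=> p2 p3; rewrite /young_exponent ltr_pdivlMr; lra.
Qed.

Lemma young_const_ge0 (p : R) : 2 < p -> p < 3 -> 0 <= young_const p.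
Proof.
move=> p2 p3; have h := young_exponent_gt1 p2 p3.
by rewrite /young_const -lock mulr_ge0 ?powR_ge0 ?divr_ge0//; lra.
Qed.

Lemma vb_normalize (q : R) a (s t r : R) P : 0 < r -> vb q a s t r -> itv_partition s t P ->
  psum (fun u v => (`|a u v| / r) `^ q) s P <= 1.
Proof.
move=> r0 ar sP; have rq0 : 0 < r `^ q by rewrite powR_gt0.
rewrite -(ler_pM2l rq0) mulr1 -psumZ; apply: le_trans (ar _ sP).
apply: ler_psum sP _ => u v _ _ _.
by rewrite -powRM ?(ltW r0) ?divr_ge0 ?(ltW r0)// mulrC divfK ?gt_eqF.
Qed.

Lemma normalized_le (q x r S : R) : 0 < q -> 0 < r -> 0 <= x ->
  (x / r) `^ q <= S -> x <= r * S `^ q^-1.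
Proof.
move=> q0 r0 x0 xS; rewrite mulrC -ler_pdivrMr//.
have xr0 : 0 <= x / r by rewrite divr_ge0// ltW.
rewrite -[leLHS](powRr1 xr0) -(mulfV (lt0r_neq0 q0)) powRrM.
apply: ge0_ler_powR => //; rewrite ?nnegrE ?invr_ge0 ?(ltW q0) ?powR_ge0//.
exact: le_trans (powR_ge0 _ _) xS.
Qed.

(* Interpolating the oscillation bound [al] with the variation bound leaves
   enough integrability to sew. *)
Lemma interpolated_product (q1 q2 eta al r x S A B : R) :
  0 < q1 -> 0 < q2 -> 0 <= eta -> eta < 1 -> 0 < r -> 0 < x ->
  0 <= A -> 0 <= B -> 0 < S ->
  A <= al -> (A / r) `^ q1 <= S -> (B / x) `^ q2 <= S ->
  A * B <= al `^ eta * r `^ (1 - eta) * x *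
    S `^ ((1 - eta) * q1^-1 + q2^-1).
Proof.
move=> q10 q20 eta0 eta1 r0 x0 A0 B0 S0 Aal Ar Bx.
have {}Ar := normalized_le q10 r0 A0 Ar.
have {}Bx := normalized_le q20 x0 B0 Bx.
have A_le : A <= al `^ eta * (r `^ (1 - eta) * S `^ ((1 - eta) * q1^-1)).
  rewrite -[leLHS](powRr1 A0) -[X in A `^ X](subrKC eta) powRD; last first.
    by rewrite subrKC oner_eq0.
  apply: ler_pM; rewrite ?powR_ge0//.
    by apply: ge0_ler_powR; rewrite ?nnegrE// (le_trans A0).
  rewrite [(1 - eta) * q1^-1]mulrC powRrM -powRM ?powR_ge0 ?(ltW r0)//.
  by apply: ge0_ler_powR; rewrite ?nnegrE ?mulr_ge0 ?powR_ge0 ?subr_ge0 ?(ltW r0) ?(ltW eta1).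
rewrite [S `^ _]powRD ?(gt_eqF S0) ?implybT//.
apply: le_trans (ler_pM A0 B0 A_le Bx) _.
by rewrite le_eqVlt; apply/orP; left; apply/eqP; ring.
Qed.

(** Both products are sewn at once: [A] gathers the normalized variations of the two left factors
    and [B] those of the two right factors, whence the bound 2 on their sums. The powers (3 - p)/4
    for the p/2-variation and (3 - p)/2 for the p-variation are those for which both products end up
    with [young_exponent]. *)
Lemma young_deletion (p : R) Xi a b c e (ea ec r x v z : R) marks (s t : R) P :
  2 < p -> p < 3 -> 0 < r -> 0 < x -> 0 < v -> 0 < z -> t \in marks ->
  (forall w, s <= w -> w < t -> vb (p / 2) a s w r) -> vb p b s t x ->
  (forall w, s <= w -> w < t -> vb p c s w v) -> vb (p / 2) e s t z ->
  (forall w u, s <= w -> w < u -> u < t ->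
     (forall y, y \in marks -> w < y -> u < y) ->
     `|a w u| <= ea /\ `|c w u| <= ec) ->
  (forall w u y, s <= w -> w < u -> u < y -> y <= t ->
    `|defect Xi w u y| <= `|a w u| * `|b u y| + `|c w u| * `|e u y|) ->
  itv_partition s t P -> {subset marks <= P} ->
  `|psum Xi s P - psum Xi s [seq x <- P | x \in marks]| <=
   (ea `^ ((3 - p) / 4) * r `^ (1 - (3 - p) / 4) * x +
    ec `^ ((3 - p) / 2) * v `^ (1 - (3 - p) / 2) * z) * young_const p.
Proof.
move=> p2 p3 r0 x0 v0 z0 tm ar bx cv ez osc dXi sP mP.
rewrite /young_const -lock; have p0 : 0 < p by lra.
have p20 : 0 < p / 2 by lra.
pose A w u := (`|a w u| / r) `^ (p / 2) + (`|c w u| / v) `^ p.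
pose B w u := (`|b w u| / x) `^ p + (`|e w u| / z) `^ (p / 2).
apply: (@marked_sewing _ _ marks Xi A B _ _ s t P) => //.
- exact: young_exponent_gt1.
- by rewrite addr_ge0// mulr_ge0 ?mulr_ge0 ?powR_ge0// ltW.
- by move=> w u; rewrite addr_ge0// powR_ge0.
- by move=> w u; rewrite addr_ge0// powR_ge0.
- move=> w Q sw wt sQ; rewrite psumD -[2]/(1 + 1) lerD//.
    exact: vb_normalize (ar _ sw wt) sQ.
  exact: vb_normalize (cv _ sw wt) sQ.
- move=> u Q su uQ; rewrite psumD -[2]/(1 + 1) lerD//.
    exact: vb_normalize (vb_restrict bx su (lexx _)) uQ.
  exact: vb_normalize (vb_restrict ez su (lexx _)) uQ.
move=> w u y sw wu uy yt nomark.
have [aea cec] := osc _ _ sw wu (lt_le_trans uy yt) nomark.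
apply: le_trans (dXi _ _ _ sw wu uy yt) _.
have Ab0 : 0 <= A w u by rewrite addr_ge0// powR_ge0.
have Bb0 : 0 <= B u y by rewrite addr_ge0// powR_ge0.
set S := A w u + B u y.
have h1 : (`|a w u| / r) `^ (p / 2) <= S.
  by rewrite /S /A -!addrA lerDl !addr_ge0 ?powR_ge0.
have h2 : (`|b u y| / x) `^ p <= S.
  by rewrite /S /B addrCA lerDl addr_ge0 ?powR_ge0.
have h3 : (`|c w u| / v) `^ p <= S.
  by rewrite /S /A -addrA addrCA lerDl addr_ge0 ?powR_ge0.
have h4 : (`|e u y| / z) `^ (p / 2) <= S.
  by rewrite /S /B addrA lerDr addr_ge0 ?powR_ge0.
have S_ge0 : 0 <= S by rewrite addr_ge0.
(* If S = 0 then both left factors vanish, and with them the bound on the defect; interpolation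
   requires S > 0. *)
move: S_ge0; rewrite le_eqVlt => /orP[/eqP S0|S0].
  move: h1 h3; rewrite -S0.
  move=> /(normalized_le p20 r0 (normr_ge0 _)).
  rewrite powR0 ?invr_eq0 ?(gt_eqF p20)// mulr0 normr_le0 => /eqP->.
  move=> /(normalized_le p0 v0 (normr_ge0 _)).
  rewrite powR0 ?invr_eq0 ?(gt_eqF p0)// mulr0 normr_le0 => /eqP->.
  by rewrite !normr0 !mul0r addr0 mulr_ge0 ?addr_ge0 ?mulr_ge0 ?powR_ge0// ltW.
have E1 : (1 - (3 - p) / 4) * (p / 2)^-1 + p^-1 = young_exponent p.
  by rewrite /young_exponent; field; rewrite gt_eqF.
have E2 : (1 - (3 - p) / 2) * p^-1 + (p / 2)^-1 = young_exponent p.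
  by rewrite /young_exponent; field; rewrite gt_eqF.
rewrite mulrDl; apply: lerD.
  by rewrite -E1; apply: interpolated_product => //; lra.
by rewrite -E2; apply: interpolated_product => //; lra.
Qed.

(** Normalization divides by the variation bounds, which must be positive; here they are allowed to
    tend to zero values. For h <= 1 the constant [k] dominates the excess per unit of h. *)
Lemma eps_closure (r x v z C y : R) : 0 <= C ->
  0 <= r -> 0 <= x -> 0 <= v -> 0 <= z ->
  (forall h, 0 < h -> y <= C * ((r + h) * (x + h) + (v + h) * (z + h))) ->
  y <= C * (r * x + v * z).
Proof.
move=> C0 r0 x0 v0 z0 H; apply/ler_addgt0Pr => h h0.
set k := C * (r + x + v + z + 2) + 1.
have k0 : 0 < k by rewrite ltr_wpDl// mulr_ge0// !addr_ge0.
pose h1 := Num.min 1 (h / k).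
have h10 : 0 < h1 by rewrite lt_min ltr01 divr_gt0.
have h11 : h1 <= 1 by rewrite ge_min lexx.
have h1k : h1 * k <= h by rewrite -ler_pdivlMr// ge_min lexx orbT.
apply: le_trans (H _ h10) _.
have -> : C * ((r + h1) * (x + h1) + (v + h1) * (z + h1)) =
  C * (r * x + v * z) + C * (h1 * (r + x + v + z + 2 * h1)) by ring.
rewrite lerD2l; apply: le_trans h1k; rewrite /k mulrCA; apply: ler_wpM2l; first exact: ltW.
apply: (@le_trans _ _ (C * (r + x + v + z + 2))); last by rewrite lerDl.
by apply: ler_wpM2l => //; lra.
Qed.

Lemma young_sewing (p : R) Xi a b c e (r x v z s t : R) P :
  2 < p -> p < 3 -> 0 <= r -> 0 <= x -> 0 <= v -> 0 <= z ->
  (forall w, s <= w -> w < t -> vb (p / 2) a s w r) -> vb p b s t x ->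
  (forall w, s <= w -> w < t -> vb p c s w v) -> vb (p / 2) e s t z ->
  (forall w u y, s <= w -> w < u -> u < y -> y <= t ->
    `|defect Xi w u y| <= `|a w u| * `|b u y| + `|c w u| * `|e u y|) ->
  s < t -> itv_partition s t P ->
  `|psum Xi s P - Xi s t| <= young_const p * (r * x + v * z).
Proof.
move=> p2 p3 r0 x0 v0 z0 ar bx cv ez dXi st sP.
have [p0 p20] : 0 <= p /\ 0 <= p / 2 by split; lra.
apply: eps_closure => //; first exact: young_const_ge0.
move=> h h0; rewrite mulrC.
have [rh xh vh zh] : [/\ 0 < r + h, 0 < x + h, 0 < v + h & 0 < z + h].
  by split; lra.
have le_h y : y <= y + h by rewrite lerDl ltW.
have powM (g : R) y : 0 < y -> y `^ g * y `^ (1 - g) = y.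
  by move=> y0; rewrite -powRD ?(gt_eqF y0) ?implybT// subrKC powRr1// ltW.
(* With [t] as the only mark, the oscillation bounds of the left factors are their variation bounds,
   so the two powers recombine. *)
rewrite -{1}(powM ((3 - p) / 4) _ rh) -{1}(powM ((3 - p) / 2) _ vh).
have -> : Xi s t = psum Xi s [seq y <- P | y \in [:: t]].
  have [P' PE [sP' lt]] := partition_rcons st sP.
  rewrite PE filter_rcons inE eqxx.
  have /eqP -> : [seq y <- P' | y \in [:: t]] == [::].
    rewrite -size_eq0 size_filter -leqn0 leqNgt -has_count; apply/hasPn => y.
    by move=> /(partition_mem sP')[_ yl]; rewrite inE lt_eqF// (le_lt_trans yl).
  by rewrite /= addr0.
apply: (@young_deletion _ Xi a b c e _ _ _ _ _ _ [:: t] s t P) => //.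
- by rewrite inE.
- by move=> w sw wt; apply: vb_le (ar _ sw wt).
- by apply: vb_le bx.
- by move=> w sw wt; apply: vb_le (cv _ sw wt).
- by apply: vb_le ez.
- move=> w u sw wu ut _; have su := le_trans sw (ltW wu); split.
  + apply: le_trans (le_h r); apply: (vb_point _ r0 (ar u su ut)) => //; lra.
  + apply: le_trans (le_h v); apply: (vb_point _ v0 (cv u su ut)) => //; lra.
- move=> y; rewrite inE => /eqP->; rewrite -(partition_last sP).
  by case: (P) sP => [/itv_partition_nil/eqP|? ? _ /=]; rewrite ?(lt_eqF st) ?mem_last.
Qed.

End YoungSewing.

(** * The rough integral *)

Section MatrixNorms.
Context {R : realType}.

Lemma mx_entry_le m n (A : 'M[R]_(m, n)) i j : `|A i j| <= `|A|.
Proof. by rewrite {2}/Num.norm /= mx_normrE; exact: (le_bigmax _ _ (i, j)). Qed.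

Lemma mx_norm_le m n (A : 'M[R]_(m, n)) (c : R) : 0 <= c ->
  (forall i j, `|A i j| <= c) -> `|A| <= c.
Proof.
by move=> c0 Ac; rewrite /Num.norm /= mx_normrE; apply: bigmax_le => // -[i j] _.
Qed.

Lemma mulmx_norm_le m n l (A : 'M[R]_(m, n)) (B : 'M[R]_(n, l)) :
  `|A *m B| <= n%:R * (`|A| * `|B|).
Proof.
apply: mx_norm_le => [|i j]; first by rewrite !mulr_ge0.
rewrite mxE; apply: le_trans (ler_norm_sum _ _ _) _.
rewrite -[n in n%:R]card_ord -sum1_card natr_sum mulr_suml.
apply: ler_sum => k _; rewrite mul1r normrM.
by apply: ler_pM => //; exact: mx_entry_le.
Qed.

Lemma row_norm_le m n (A : 'M[R]_(m, n)) i : `|row i A| <= `|A|.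
Proof. by apply: mx_norm_le => // ? j; rewrite mxE mx_entry_le. Qed.

Lemma vec_mx_norm_le m n (A : 'rV[R]_(m * n)) : `|vec_mx A| <= `|A|.
Proof. by apply: mx_norm_le => // i j; rewrite mxE mx_entry_le. Qed.

End MatrixNorms.

Section Evaluation.
Context {R : realType} {d k : nat}.

(** A common constant for the three evaluation maps in the entrywise maximum norm: a matrix product
    costs d and [ev_tensor] costs d^2. [locked] keeps it opaque in computations. *)
Definition evc : R := locked ((d%:R + 1) ^+ 2).

Lemma evc_ge1 : 1 <= evc.
Proof. by rewrite /evc -lock exprn_ege1// lerDr. Qed.

Lemma evc_ge_dim : d%:R <= evc.
Proof. by rewrite /evc -lock; have := ler0n R d; move: (d%:R : R) => x; nra. Qed.

Lemma ev1_norm_le (A : 'M[R]_(d, k)) x : `|ev1 A x| <= evc * (`|A| * `|x|).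
Proof.
apply: le_trans (mulmx_norm_le _ _) _.
rewrite [`|x| * _]mulrC; apply: ler_wpM2r; first exact: mulr_ge0.
exact: evc_ge_dim.
Qed.

Lemma ev2_norm_le (A : 'M[R]_(d, d * k)) x : `|ev2 A x| <= evc * (`|A| * `|x|).
Proof.
apply: le_trans (vec_mx_norm_le _) _; apply: le_trans (mulmx_norm_le _ _) _.
rewrite [`|x| * _]mulrC; apply: ler_wpM2r; first exact: mulr_ge0.
exact: evc_ge_dim.
Qed.

Lemma ev_tensor_norm_le (A : 'M[R]_(d, d * k)) Z :
  `|ev_tensor A Z| <= evc * (`|A| * `|Z|).
Proof.
apply: le_trans (ler_norm_sum _ _ _) _.
apply: (@le_trans _ _ (\sum_(i < d) d%:R * (`|A| * `|Z|))).
  apply: ler_sum => i _; apply: le_trans (mulmx_norm_le _ _) _.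
  apply: ler_wpM2l => //; rewrite mulrC; apply: ler_pM => //; last exact: row_norm_le.
  by apply: le_trans (vec_mx_norm_le _) _; exact: row_norm_le.
rewrite -mulr_suml sumr_const card_ord -[_ *+ d]mulr_natr.
apply: ler_wpM2r; first exact: mulr_ge0.
by rewrite /evc -lock; have := ler0n R d; move: (d%:R : R) => x; nra.
Qed.

Lemma ev1Bl (A B : 'M[R]_(d, k)) x : ev1 (A - B) x = ev1 A x - ev1 B x.
Proof. exact: mulmxBr. Qed.

Lemma ev1Br (A : 'M[R]_(d, k)) x y : ev1 A (x - y) = ev1 A x - ev1 A y.
Proof. exact: mulmxBl. Qed.

Lemma ev2Bl (A B : 'M[R]_(d, d * k)) x : ev2 (A - B) x = ev2 A x - ev2 B x.
Proof. by rewrite /ev2 mulmxBr linearB. Qed.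

Lemma ev_tensorBl (A B : 'M[R]_(d, d * k)) Z :
  ev_tensor (A - B) Z = ev_tensor A Z - ev_tensor B Z.
Proof.
rewrite /ev_tensor -sumrB; apply: eq_bigr => i _.
by rewrite raddfB linearB /= mulmxBr.
Qed.

Lemma ev_tensorDr (A : 'M[R]_(d, d * k)) Y Z :
  ev_tensor A (Y + Z) = ev_tensor A Y + ev_tensor A Z.
Proof.
rewrite /ev_tensor -big_split; apply: eq_bigr => i _.
by rewrite raddfD /= mulmxDl.
Qed.

End Evaluation.
Arguments evc : clear implicits.

Section RoughSums.
Context {R : realType} {d k : nat}.
Variables (X : R -> 'rV[R]_d) (XX : R -> R -> 'M[R]_d).

Definition chen s t : Prop := forall w u v, s <= w -> w <= u -> u <= v -> v <= t ->
  XX w v = XX w u + XX u v + tensor (X u - X w) (X v - X u).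

Definition germ (V : R -> 'M[R]_(d, k)) (V' : R -> 'M[R]_(d, d * k)) u v : 'rV[R]_k :=
  ev1 (V u) (X v - X u) + ev_tensor (V' u) (XX u v).

Lemma rough_sumE (V : R -> 'M[R]_(d, k)) (V' : R -> 'M[R]_(d, d * k)) s t P :
  rough_sum X XX V V' s t P = psum (germ V V') s P.
Proof. by rewrite -(psumE _ t). Qed.

Lemma germB (V W : R -> 'M[R]_(d, k)) (V' W' : R -> 'M[R]_(d, d * k)) u v :
  germ (fun r => V r - W r) (fun r => V' r - W' r) u v =
  germ V V' u v - germ W W' u v.
Proof. by rewrite /germ ev1Bl ev_tensorBl opprD addrACA. Qed.

(** Chen's relation supplies the term V'_w (X_{w,u} tensor X_{u,v}), which turns the increment of V
    into its remainder and so raises the exponent of the product with X from 2/p to 3/p. *)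
Lemma germ_defect (V : R -> 'M[R]_(d, k)) (V' : R -> 'M[R]_(d, d * k)) s t w u v : chen s t ->
  s <= w -> w <= u -> u <= v -> v <= t ->
  defect (germ V V') w u v =
  - (ev1 (remainder ev2 X V V' w u) (X v - X u)
     + ev_tensor (V' u - V' w) (XX u v)).
Proof.
move=> ch sw wu uv vt; rewrite /defect /germ (ch _ _ _ sw wu uv vt).
rewrite !ev_tensorDr ev_tensorE /remainder !ev1Bl ev_tensorBl !ev1Br.
set a := ev1 (V w) (X v); set b := ev1 (V w) (X w); set c := ev1 (V w) (X u).
apply/rowP => j; rewrite !mxE; ring.
Qed.

End RoughSums.

Section VbDomination.
Context {R : realType} {E E1 : normedModType R}.

Lemma vb_dom q (A : R -> R -> E1) (B : R -> R -> E) s t M : 0 <= q -> 0 <= M ->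
  (forall u v, s <= u -> u < v -> v <= t -> `|B u v| <= `|A u v|) ->
  vb q A s t M -> vb q B s t M.
Proof.
move=> q0 M0 BA AM; rewrite -[M]mul1r; apply: (vb_scale q0 ler01 M0 _ AM).
by move=> u v su uv vt; rewrite mul1r BA.
Qed.

End VbDomination.

Section RoughEstimate.
Context {R : realType} {d k : nat}.
Variables (X : R -> 'rV[R]_d) (XX : R -> R -> 'M[R]_d).
Variables (V : R -> 'M[R]_(d, k)) (V' : R -> 'M[R]_(d, d * k)).

Notation incr Y := (fun u v : R => Y v - Y u).
Notation RV := (remainder ev2 X V V').
Notation Xi := (germ X XX V V').

(** The doubled norms match the product hypothesis of [young_sewing] for real-valued [a], [b], [c],
    [e]; the factor [evc] is put on the right factors. *)
Lemma germ_defect_le s t w u v : chen X XX s t ->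
  s <= w -> w < u -> u < v -> v <= t ->
  `|defect Xi w u v| <= `| `|RV w u| | * `|evc R d * `|X v - X u| |
     + `| `|V' u - V' w| | * `|evc R d * `|XX u v| |.
Proof.
move=> ch sw wu uv vt; have e0 : 0 <= evc R d := le_trans ler01 evc_ge1.
rewrite (germ_defect V V' ch sw (ltW wu) (ltW uv) vt) normrN !normr_id.
rewrite !(normrM (evc R d)) !normr_id (ger0_norm e0).
apply: le_trans (ler_normD _ _) _; apply: lerD.
- by rewrite mulrCA; exact: ev1_norm_le.
- by rewrite mulrCA; exact: ev_tensor_norm_le.
Qed.

Definition rough_const (p : R) := locked (evc R d * young_const p).

Lemma rough_const_ge0 p : 2 < p -> p < 3 -> 0 <= rough_const p.
Proof.
move=> p2 p3; rewrite /rough_const -lock; apply: mulr_ge0; last exact: young_const_ge0.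
exact: le_trans ler01 evc_ge1.
Qed.

Lemma rough_sum_estimate (p r x v z s t : R) P :
  2 < p -> p < 3 -> chen X XX s t -> 0 <= r -> 0 <= x -> 0 <= v -> 0 <= z ->
  (forall w, s <= w -> w < t -> vb (p / 2) RV s w r) ->
  vb p (incr X) s t x ->
  (forall w, s <= w -> w < t -> vb p (incr V') s w v) ->
  vb (p / 2) XX s t z ->
  s < t -> itv_partition s t P ->
  `|psum Xi s P - Xi s t| <= rough_const p * (r * x + v * z).
Proof.
move=> p2 p3 ch r0 x0 v0 z0 Rr Xx Vv XXz st sP.
have e0 : 0 <= evc R d := le_trans ler01 evc_ge1.
have [p0 p20] : 0 <= p /\ 0 <= p / 2 by split; lra.
apply: le_trans (_ : _ <= young_const p * (r * (evc R d * x) + v * (evc R d * z))) _.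
  apply: (@young_sewing _ _ p Xi (fun w u => `|RV w u|)
    (fun u y => evc R d * `|X y - X u|) (fun w u => `|V' u - V' w|)
    (fun u y => evc R d * `|XX u y|)) => //; rewrite ?mulr_ge0//.
  - by move=> w sw wt; apply: vb_dom (Rr w sw wt) => // *; rewrite normr_id.
  - apply: vb_scale Xx => // *.
    by rewrite normrM normr_id ger0_norm.
  - by move=> w sw wt; apply: vb_dom (Vv w sw wt) => // *; rewrite normr_id.
  - apply: vb_scale XXz => // *.
    by rewrite normrM normr_id ger0_norm.
  - by move=> w u y; exact: germ_defect_le.
by rewrite /rough_const -lock le_eqVlt; apply/orP; left; apply/eqP; ring.
Qed.

End RoughEstimate.
Arguments rough_const : clear implicits.

(** * Convergence of the compensated Riemann sums along fine meshes *)

Section OscillationPartition.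
Context {R : realType} {E : normedModType R}.

(** A mark in (w, u] exempts the pair, so that large jumps cost nothing once their times are marked.
    Real induction in the right end: one-sided limits provide a neighbourhood of small oscillation
    on each side of a point. *)
Lemma oscillation_marks (Y : R -> E) a b e : a <= b -> 0 < e ->
  (forall u, a <= u -> u < b -> Y @ u^'+ --> Y u) ->
  (forall u, a < u -> u <= b -> cvg (Y @ u^'-)) ->
  exists marks : seq R, forall w u, a <= w -> w <= u -> u <= b ->
    (forall y, y \in marks -> w < y -> u < y) -> `|Y u - Y w| <= e.
Proof.
move=> ab e0 Yr Yl; have e20 : 0 < e / 2 by rewrite divr_gt0.
have triangle (x l z : E) : `|x - l| <= e / 2 -> `|z - l| <= e / 2 ->
    `|x - z| <= e.
  move=> xl zl; rewrite -(subrK l x) -addrA; apply: le_trans (ler_normD _ _) _.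
  by rewrite (distrC l); lra.
apply: (@real_induction _ (fun t => exists marks : seq R, forall w u,
  a <= w -> w <= u -> u <= t ->
  (forall y, y \in marks -> w < y -> u < y) -> `|Y u - Y w| <= e) a b ab).
- move=> u v _ uv _ [marks H]; exists marks => x y ax xy yu; apply: H => //.
  exact: le_trans uv.
- exists [::] => w u aw wu ua _.
  have -> : u = w by apply/eqP; rewrite eq_le wu (le_trans ua).
  by rewrite subrr normr0 ltW.
- move=> s as_ sb [marks H].
  have [v sv vP] := (cvg_rightP _ _ _).1 (Yr s as_ sb) _ e20.
  pose c := (s + Num.min v b) / 2.
  have [sc cv cb] : [/\ s < c, c < v & c <= b].
    have := ge_min v v b; have := ge_min b v b; rewrite !lexx orbT /= => mb mv.
    have : s < Num.min v b by rewrite lt_min sv.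
    by rewrite /c; split; lra.
  have near_s u : s <= u -> u <= c -> `|Y u - Y s| <= e / 2.
    rewrite le_eqVlt => /orP[/eqP<- _|su uc]; last exact: vP (le_lt_trans uc cv).
    by rewrite subrr normr0 ltW.
  exists c; split=> //; exists (s :: marks) => w u aw wu uc nomark.
  have [us|su] := leP u s.
    apply: H => // y ym; apply: nomark; by rewrite inE ym orbT.
  have [ws|sw] := ltP w s.
    by have := nomark s (mem_head _ _) ws; rewrite ltNge (ltW su).
  by apply: (triangle _ (Y s)); apply: near_s => //; [exact: ltW|lra].
- move=> t at_ tb IH.
  have [v vt vP] := (cvg_leftP _ _ _).1 (Yl t at_ tb) _ e20.
  pose c := (Num.max v a + t) / 2.
  have [ac vc ct] : [/\ a <= c, v < c & c < t].
    have mv : v <= Num.max v a by rewrite le_max lexx.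
    have ma : a <= Num.max v a by rewrite le_max lexx orbT.
    have : Num.max v a < t by rewrite gt_max vt.
    by rewrite /c; split; lra.
  have [marks H] := IH c ac ct.
  (* Between [c] and [t] the path is close to its left limit at [t]; marking [c] exempts the pairs
     across [c], and marking [t] those that end at [t]. *)
  exists (t :: c :: marks) => w u aw wu ut nomark.
  have [uc|cu] := leP u c.
    by apply: H => // y ym; apply: nomark; rewrite !inE ym !orbT.
  have [wc|cw] := ltP w c.
    by have := nomark c; rewrite !inE eqxx orbT => /(_ isT wc); rewrite ltNge (ltW cu).
  move: ut; rewrite le_eqVlt => /orP[/eqP ut|ut].
    have [wt|tw] := ltP w t.
      by have := nomark t (mem_head _ _) wt; rewrite ut ltxx.
    have -> : w = u by apply/eqP; rewrite eq_le wu ut.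
    by rewrite subrr normr0 ltW.
  by apply: (triangle _ (lim (Y @ t^'-))); apply: vP => //; lra.
Qed.

End OscillationPartition.

Section MeshFilter.
Context {R : realType}.
Implicit Types (s t e : R) (P Q marks : seq R).

Definition fine_mesh e s P : bool := path (fun u v => v - u < e) s P.

Lemma fine_meshP e x0 s P : reflect
  (forall i, (i < size P)%N -> nth x0 (s :: P) i.+1 - nth x0 (s :: P) i < e)
  (fine_mesh e s P).
Proof. exact: pathP. Qed.

Lemma fine_partition_exists e s t : 0 < e -> s <= t ->
  exists2 P, itv_partition s t P & fine_mesh e s P.
Proof.
move=> e0 st; have e20 : 0 < e / 2 by rewrite divr_gt0.
have : t - s <= (Num.truncn ((t - s) / (e / 2))).+1%:R * (e / 2).
  by rewrite -ler_pdivrMr// ltW// truncnS_gt.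
move: (_.+1) => n; elim: n s st => [|n IH] s st.
  rewrite mul0r subr_le0 => ts; exists [::] => //.
  by split=> //=; rewrite eq_le st.
have [ts|lt] := leP (t - s) (e / 2).
  move=> _; exists (segment s t); first exact: segmentP.
  by rewrite /fine_mesh /segment; case: ifP => //= _; rewrite andbT; lra.
rewrite -natr1 mulrDl mul1r => le; have [||P uP fP] := IH (s + e / 2); [lra..|].
exists (s + e / 2 :: P).
  by rewrite -cat1s; apply: itv_partition_cat uP; apply: itv_partition1; lra.
by rewrite /fine_mesh /= -/(fine_mesh e _ P) fP andbT; lra.
Qed.

Global Instance mesh_filter_filter s t : Filter (mesh_filter s t).
Proof.
split.
- by exists 1.
- move=> A B [a a0 aA] [b b0 bB]; exists (Num.min a b) => [|P sP Pab].
    by rewrite lt_min a0.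
  by split; [apply: aA|apply: bB] => // i iP; have := Pab i iP;
    rewrite lt_min => /andP[].
- by move=> A B AB [a a0 aA]; exists a => // P sP Pa; exact/AB/aA.
Qed.

Lemma mesh_filter_proper s t : s <= t -> ProperFilter (mesh_filter s t).
Proof.
move=> st; apply: Build_ProperFilter_ex => A [a a0 aA].
have [P sP /(fine_meshP _ t) fP] := fine_partition_exists a0 st.
by exists P; apply: aA => //; exact: fP.
Qed.

End MeshFilter.

Section Insertion.
Context {R : realType} {E : normedModType R}.
Implicit Types (s t e : R) (P Q marks : seq R) (Xi : R -> R -> E).

Lemma insert_point Xi s t y e c P : itv_partition s t P -> fine_mesh e s P ->
  0 <= c -> s < y -> y <= t ->
  (forall u v, s <= u -> u < y -> y < v -> v <= t -> v - u < e ->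
     `|defect Xi u y v| <= c) ->
  exists Q, [/\ itv_partition s t Q, fine_mesh e s Q, y \in Q,
    {subset P <= Q} & `|psum Xi s P - psum Xi s Q| <= c].
Proof.
move=> sP fP c0 sy yt H.
have [|[P1 [v [P2 [PE]]]]] := @first_failure _ (< y) s P sy.
  by rewrite (partition_last sP) /= ltNge yt.
set w := last s P1 => /= wy; rewrite -leNgt => yv.
have [sP1 wvP2] := partition_prefix (eq_ind _ _ sP _ PE).
have [wv vt vP2] := partition_tail wvP2.
move: yv; rewrite le_eqVlt => /orP[/eqP yv|yv].
  exists P; split=> //; last by rewrite subrr normr0.
  by rewrite PE yv mem_cat mem_head orbT.
move: (fP); rewrite PE /fine_mesh cat_path /= -/w => /and3P[fP1 fwv fvP2].
exists (P1 ++ y :: v :: P2); split.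
- apply: itv_partition_cat sP1 _; rewrite -cat1s.
  apply: itv_partition_cat (itv_partition1 wy) _; rewrite -cat1s.
  exact: itv_partition_cat (itv_partition1 yv) _.
- by rewrite cat_path /= -/w fP1 fvP2 andbT; apply/andP; split; lra.
- by rewrite mem_cat mem_head orbT.
- by move=> x; rewrite !mem_cat !inE => /or3P[->|->|->]; rewrite ?orbT.
- rewrite psum_delete opprB addrC subrK.
  exact: H (itv_partition_le sP1) wy yv vt fwv.
Qed.

Lemma insert_points Xi s t e c marks P : itv_partition s t P -> fine_mesh e s P ->
  0 <= c ->
  (forall y, y \in marks -> s < y /\ y <= t) ->
  (forall y u v, y \in marks -> s <= u -> u < y -> y < v -> v <= t ->
     v - u < e -> `|defect Xi u y v| <= c) ->
  exists Q, [/\ itv_partition s t Q, {subset marks <= Q} &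
    `|psum Xi s P - psum Xi s Q| <= (size marks)%:R * c].
Proof.
move=> sP fP c0.
suff : forall marks, (forall y, y \in marks -> s < y /\ y <= t) ->
  (forall y u v, y \in marks -> s <= u -> u < y -> y < v -> v <= t ->
     v - u < e -> `|defect Xi u y v| <= c) ->
  exists Q, [/\ itv_partition s t Q, fine_mesh e s Q, {subset marks <= Q} &
    `|psum Xi s P - psum Xi s Q| <= (size marks)%:R * c].
  by move=> H m1 m2; have [Q [? ? ? ?]] := H marks m1 m2; exists Q.
move=> {}marks; elim: marks => [|y marks IH] m1 m2.
  by exists P; split=> //; rewrite subrr normr0 mul0r.
have [|z u v zm|Q [sQ fQ mQ PQ]] := IH.
- by move=> z zm; apply: m1; rewrite inE zm orbT.
- by apply: m2; rewrite inE zm orbT.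
have [sy yt] := m1 y (mem_head _ _).
have [|Q' [sQ' fQ' yQ' QQ' psQ]] := @insert_point Xi s t y e c Q sQ fQ c0 sy yt.
  by move=> u v; apply: m2; exact: mem_head.
exists Q'; split=> //.
  by move=> z; rewrite inE => /orP[/eqP->//|/mQ/QQ'].
rewrite -(subrK (psum Xi s Q) (psum Xi s P)) -addrA.
apply: le_trans (ler_normD _ _) _.
by rewrite /= -natr1 mulrDl mul1r; exact: lerD.
Qed.

(** Deleting the unmarked points reduces any two partitions containing the marks to the same one,
    through which their Riemann sums are compared. *)
Lemma marked_filter_eq s t P Q marks :
  itv_partition s t P -> itv_partition s t Q ->
  {subset marks <= P} -> {subset marks <= Q} ->
  [seq x <- P | x \in marks] = [seq x <- Q | x \in marks].
Proof.
move=> [/path_sorted sP _] [/path_sorted sQ _] mP mQ.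
apply: (@irr_sorted_eq _ (fun x y : R => (x < y)%O)).
- by move=> x y z; exact: lt_trans.
- by move=> x; exact: ltxx.
- by apply: sorted_filter sP => x y z; exact: lt_trans.
- by apply: sorted_filter sQ => x y z; exact: lt_trans.
- move=> x; rewrite !mem_filter; case: (boolP (x \in marks)) => //= xm.
  by rewrite mP ?mQ.
Qed.

End Insertion.

Section SmallPower.
Context {R : realType}.

Lemma small_power (eta C tau : R) : 0 < eta -> 0 <= C -> 0 < tau ->
  exists2 e : R, 0 < e & forall x, 0 <= x -> x <= e -> x `^ eta * C <= tau.
Proof.
move=> eta0 C0 tau0; have D0 : 0 < tau / (C + 1) by rewrite divr_gt0// ltr_wpDl.
exists ((tau / (C + 1)) `^ eta^-1); first exact: powR_gt0.
move=> x x0 xe; apply: (@le_trans _ _ (tau / (C + 1) * C)).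
  apply: ler_wpM2r => //.
  have -> : tau / (C + 1) = ((tau / (C + 1)) `^ eta^-1) `^ eta.
    by rewrite -powRrM mulVf ?gt_eqF// powRr1// ltW.
  by apply: ge0_ler_powR => //; rewrite ?nnegrE ?powR_ge0 ?(ltW eta0).
rewrite mulrAC ler_pdivrMr ?ltr_wpDl//; apply: ler_wpM2l; first exact: ltW.
by rewrite lerDl.
Qed.

End SmallPower.

Section RoughIntegralExistence.
Context {R : realType} {d k : nat}.
Variables (X : R -> 'rV[R]_d) (XX : R -> R -> 'M[R]_d).
Variables (V : R -> 'M[R]_(d, k)) (V' : R -> 'M[R]_(d, d * k)).
Variables (p s t r x v z : R).

Notation incr Y := (fun u v : R => Y v - Y u).
Notation RV := (remainder ev2 X V V').
Notation Xi := (germ X XX V V').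

Hypotheses (p2 : 2 < p) (p3 : p < 3) (st : s < t) (ch : chen X XX s t).
Hypotheses (cX : cadlag s t X) (cV : cadlag s t V) (cV' : cadlag s t V').
Hypothesis (cXX : forall u, s <= u -> u < t -> XX u @ u^'+ --> (0 : 'M[R]_d)).
Hypotheses (r0 : 0 < r) (x0 : 0 < x) (v0 : 0 < v) (z0 : 0 < z).
Hypotheses (Rr : vb (p / 2) RV s t r) (Xx : vb p (incr X) s t x).
Hypotheses (Vv : vb p (incr V') s t v) (XXz : vb (p / 2) XX s t z).

Let e0 : 0 <= evc R d. Proof. exact: le_trans ler01 evc_ge1. Qed.
Let p0 : 0 < p. Proof. exact: lt_trans p2. Qed.
Let p20 : 0 < p / 2. Proof. by rewrite divr_gt0. Qed.

Let deriv_bound u : s <= u -> u <= t -> `|V' u| <= `|V' s| + v.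
Proof.
rewrite le_eqVlt => /orP[/eqP<- _|su ut]; first by rewrite lerDl ltW.
have := vb_point p0 (ltW v0) Vv (lexx _) su ut.
by move=> h; rewrite -[V' u](subrKC (V' s)); apply: le_trans (ler_normD _ _) _; rewrite lerD2l.
Qed.

(* Between two consecutive marks V, V' and X oscillate little, although they may
   jump at the marks themselves: the sewing estimate only involves the remainder
   of V and the increments of V' away from the right end of each piece. *)
Lemma fine_oscillation_marks (tau : R) : 0 < tau -> exists marks : seq R,
  [/\ t \in marks, forall y, y \in marks -> s < y /\ y <= t &
  forall P, itv_partition s t P -> {subset marks <= P} ->
    `|psum Xi s P - psum Xi s [seq y <- P | y \in marks]| <= tau].
Proof.
move=> tau0.
have tau20 : 0 < tau / 2 by lra.
have eta1 : 0 < (3 - p) / 4 by have := p3; lra.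
have eta2 : 0 < (3 - p) / 2 by have := p3; lra.
pose C1 := r `^ (1 - (3 - p) / 4) * (evc R d * x) * young_const p.
pose C2 := v `^ (1 - (3 - p) / 2) * (evc R d * z) * young_const p.
have yc := young_const_ge0 p2 p3.
have C10 : 0 <= C1.
  by rewrite /C1; apply: mulr_ge0 yc; rewrite mulr_ge0 ?powR_ge0 ?mulr_ge0 ?(ltW x0).
have C20 : 0 <= C2.
  by rewrite /C2; apply: mulr_ge0 yc; rewrite mulr_ge0 ?powR_ge0 ?mulr_ge0 ?(ltW z0).
have [a1 a10 a1P] := small_power eta1 C10 tau20.
have [a2 a20 a2P] := small_power eta2 C20 tau20.
pose m := `|V' s| + v.
have m0 : 0 <= m by rewrite addr_ge0// ltW.
(* Between marks the remainder of V is at most (1 + evc m) e, hence at most c e. The choice of [e]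
   below makes c e small enough for the first product and e for the second. *)
pose c := 2 + evc R d * m.
have c0 : 0 < c by rewrite ltr_wpDr// mulr_ge0.
pose e := Num.min (a1 / c) a2.
have e_gt0 : 0 < e by rewrite lt_min divr_gt0.
have [MX MXP] := oscillation_marks (ltW st) e_gt0
  (fun u su ut => cX.1 u (introT andP (conj su ut)))
  (fun u su ut => cX.2 u (introT andP (conj su ut))).
have [MV MVP] := oscillation_marks (ltW st) e_gt0
  (fun u su ut => cV.1 u (introT andP (conj su ut)))
  (fun u su ut => cV.2 u (introT andP (conj su ut))).
have [MV' MVP'] := oscillation_marks (ltW st) e_gt0
  (fun u su ut => cV'.1 u (introT andP (conj su ut)))
  (fun u su ut => cV'.2 u (introT andP (conj su ut))).
pose marks := t :: [seq y <- MX ++ MV ++ MV' | (s < y) && (y <= t)].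
exists marks; split; first exact: mem_head.
  move=> y; rewrite inE => /orP[/eqP->//|].
  by rewrite mem_filter => /andP[/andP[]].
move=> P sP mP.
have mono w u : s <= w -> w < u -> u <= t ->
    (forall y, y \in marks -> w < y -> u < y) ->
    forall y, y \in MX ++ MV ++ MV' -> w < y -> u < y.
  move=> sw wu ut H y ym wy; have [yt|ty] := leP y t; last exact: le_lt_trans ty.
  apply: H => //; rewrite inE mem_filter ym yt (le_lt_trans sw wy).
  by rewrite orbT.
apply: le_trans (@young_deletion _ _ p Xi (fun w u => `|RV w u|)
    (fun u y => evc R d * `|X y - X u|) (fun w u => `|V' u - V' w|)
    (fun u y => evc R d * `|XX u y|) (c * e) e r (evc R d * x) v (evc R d * z)
    marks s t P p2 p3 r0 _ v0 _ _ _ _ _ _ _ _ sP mP) _.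
- by rewrite mulr_gt0// (lt_le_trans ltr01 evc_ge1).
- by rewrite mulr_gt0// (lt_le_trans ltr01 evc_ge1).
- exact: mem_head.
- move=> w sw wt; apply: (vb_dom (ltW p20) (ltW r0)) (vb_restrict Rr (lexx _) (ltW wt)) => *.
  by rewrite normr_id.
- apply: vb_scale Xx => //; [exact: ltW|exact: ltW|] => *.
  by rewrite normrM normr_id ger0_norm.
- move=> w sw wt; apply: (vb_dom (ltW p0) (ltW v0)) (vb_restrict Vv (lexx _) (ltW wt)) => *.
  by rewrite normr_id.
- apply: vb_scale XXz => //; [exact: ltW|exact: ltW|] => *.
  by rewrite normrM normr_id ger0_norm.
- move=> w u sw wu ut nomark.
  have {}nomark := mono w u sw wu (ltW ut) nomark.
  have oX : `|X u - X w| <= e.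
    by apply: MXP => //; [exact: ltW|exact: ltW|] => y ym; apply: nomark; rewrite mem_cat ym.
  have oV : `|V u - V w| <= e.
    by apply: MVP => //; [exact: ltW|exact: ltW|] => y ym; apply: nomark; rewrite !mem_cat ym orbT.
  have oV' : `|V' u - V' w| <= e.
    apply: MVP' => //; [exact: ltW|exact: ltW|] => y ym.
    by apply: nomark; rewrite !mem_cat ym !orbT.
  rewrite !normr_id; split=> //; rewrite /remainder.
  apply: le_trans (ler_normB _ _) _; apply: le_trans (lerD oV (ev2_norm_le _ _)) _.
  have Vw := deriv_bound sw (ltW (lt_trans wu ut)).
  have : evc R d * (`|V' w| * `|X u - X w|) <= evc R d * (m * e).
    by apply: ler_wpM2l => //; exact: ler_pM.
  have -> : c * e = 2 * e + evc R d * (m * e) by rewrite /c mulrDl mulrA.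
  by move: (evc R d * (_ * _)) (evc R d * (m * e)) e_gt0 => y1 y2; lra.
- by move=> w u y; exact: germ_defect_le.
have ce : c * e <= a1.
  by rewrite mulrC -ler_pdivlMr// ge_min lexx.
have ea2 : e <= a2 by rewrite ge_min lexx orbT.
have := a1P _ (mulr_ge0 (ltW c0) (ltW e_gt0)) ce.
have := a2P _ (ltW e_gt0) ea2.
by rewrite /C1 /C2 !mulrA mulrDl; lra.
Qed.

(* A mark y inside an interval [u, w] of small mesh costs little to insert, as X
   and XX y are right-continuous at y; the jump at y of the left factor is only
   bounded. *)
Lemma insertion_error (marks : seq R) (tau : R) : 0 < tau ->
  (forall y, y \in marks -> s < y /\ y <= t) ->
  exists2 e : R, 0 < e & forall y u w, y \in marks -> s <= u -> u < y -> y < w ->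
    w <= t -> w - u < e -> `|defect Xi u y w| <= tau.
Proof.
move=> tau0.
pose c := evc R d * (r + v) + 1.
have c0 : 0 < c by rewrite ltr_wpDl// mulr_ge0// addr_ge0// ltW.
have kap0 : 0 < tau / c by rewrite divr_gt0.
elim: marks => [|y marks IH] ym; first by exists 1.
have [|e1 e10 e1P] := IH; first by move=> w wm; apply: ym; rewrite inE wm orbT.
have [sy yt] := ym _ (mem_head _ _).
suff [e2 e20 e2P] : exists2 e : R, 0 < e & forall u w, s <= u -> u < y -> y < w ->
    w <= t -> w - u < e -> `|defect Xi u y w| <= tau.
  exists (Num.min e1 e2) => [|y' u w]; first by rewrite lt_min e10.
  rewrite inE lt_min => /orP[/eqP->|y'm] su uy yw wt /andP[we1 we2].
    exact: e2P.
  exact: (e1P y').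
move: yt; rewrite le_eqVlt => /orP[/eqP yt|yt].
  by exists 1 => // u w _ _ yw wt; move: yw; rewrite yt ltNge wt.
have [a ya aP] := (cvg_rightP _ _ _).1 (cX.1 y (introT andP (conj (ltW sy) yt))) _ kap0.
have [b yb bP] := (cvg_rightP _ _ _).1 (cXX (ltW sy) yt) _ kap0.
exists (Num.min (a - y) (b - y)) => [|u w su uy yw wt].
  by rewrite lt_min !subr_gt0 ya.
rewrite lt_min => /andP[wa wb].
have Xa := aP w yw ltac:(lra).
have := bP w yw ltac:(lra); rewrite subr0 => XXb.
apply: le_trans (germ_defect_le V V' ch su uy yw wt) _.
rewrite !normr_id !(normrM (evc R d)) !normr_id (ger0_norm e0).
have Ru := vb_point p20 (ltW r0) Rr su uy (ltW yt).
have Vu := vb_point p0 (ltW v0) Vv su uy (ltW yt).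
apply: (@le_trans _ _ (r * (evc R d * (tau / c)) + v * (evc R d * (tau / c)))).
  by apply: lerD; (apply: ler_pM => //; [exact: mulr_ge0|exact: ler_wpM2l]).
rewrite -mulrDl mulrA [(r + v) * _]mulrC mulrA ler_pdivrMr// [_ * tau]mulrC.
by apply: ler_wpM2l; [exact: ltW | rewrite /c lerDl].
Qed.

(** Each sum is moved to the sum over the marks alone: inserting the marks costs at most tau/4, each
    of them being charged tau/4 divided by their number plus one, and deleting all other points
    costs at most tau/4. *)
Lemma germ_mesh_cauchy (tau : R) : 0 < tau -> exists2 e : R, 0 < e &
  forall P Q, itv_partition s t P -> itv_partition s t Q ->
    fine_mesh e s P -> fine_mesh e s Q -> `|psum Xi s P - psum Xi s Q| <= tau.
Proof.
move=> tau0; have t4 : 0 < tau / 4 by lra.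
have [marks [tm mst mP]] := fine_oscillation_marks t4.
pose n : R := (size marks)%:R + 1.
have n0 : 0 < n by rewrite ltr_wpDl.
have tn0 : 0 < tau / 4 / n by rewrite divr_gt0.
have [e e_gt0 eP] := insertion_error tn0 mst; exists e => //.
have key P : itv_partition s t P -> fine_mesh e s P -> exists2 P',
    itv_partition s t P' /\ {subset marks <= P'} &
    `|psum Xi s P - psum Xi s [seq y <- P' | y \in marks]| <= tau / 2.
  move=> sP fP; have [P' [sP' mP' PP']] := insert_points sP fP (ltW tn0) mst eP.
  exists P' => //; rewrite -(subrK (psum Xi s P') (psum Xi s P)) -addrA.
  apply: le_trans (ler_normD _ _) _.
  have := mP P' sP' mP'; suff : (size marks)%:R * (tau / 4 / n) <= tau / 4.
    by move: PP'; lra.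
  rewrite mulrA ler_pdivrMr// mulrC; apply: ler_wpM2l; first lra.
  by rewrite /n lerDl.
move=> P Q sP sQ fP fQ.
have [P' [sP' mP'] hP] := key P sP fP; have [Q' [sQ' mQ'] hQ] := key Q sQ fQ.
rewrite (marked_filter_eq sP' sQ' mP' mQ') in hP.
rewrite -(subrK (psum Xi s [seq y <- Q' | y \in marks]) (psum Xi s P)) -addrA.
by apply: le_trans (ler_normD _ _) _; rewrite (distrC _ (psum Xi s Q)); lra.
Qed.

Lemma rough_integral_exists : exists I, is_rough_integral X XX V V' s t I.
Proof.
have FF := mesh_filter_proper (ltW st).
apply/cvg_ex/cauchy_cvgP/cauchy_exP => e e_gt0.
have [a a0 aP] := germ_mesh_cauchy (divr_gt0 e_gt0 (@ltr0Sn _ 1)).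
have [P sP fP] := fine_partition_exists a0 (ltW st).
exists (rough_sum X XX V V' s t P); exists a => // Q sQ /(fine_meshP _ t) fQ.
rewrite -ball_normE /= !rough_sumE.
by apply: le_lt_trans (aP P Q sP sQ fP fQ) _; lra.
Qed.

End RoughIntegralExistence.

(** * Norms, growth and Lipschitz conditions as variation bounds *)

Section ExtendedReals.
Context {R : realType}.

Lemma ereal_between (x : \bar R) (M : R) : (0 <= x)%E -> (x <= M%:E)%E ->
  exists2 r, x = r%:E & 0 <= r <= M.
Proof.
by case: x => [r| |] //; rewrite !lee_fin => r0 rM; exists r => //; rewrite r0.
Qed.

Lemma pvar2_ge0 {E : normedModType R} q (A : R -> R -> E) s t :
  (0 <= pvar2 q A s t)%E.
Proof. exact: poweR_ge0. Qed.

(** The bridge from the extended-real norms to [vb]. For s <= t there is at least one partition, so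
    the supremum is nonnegative and the power q^-1 can be undone. *)
Lemma pvar2_le {E : normedModType R} q (A : R -> R -> E) s t M :
  0 < q -> s <= t -> 0 <= M ->
  (pvar2 q A s t <= M%:E)%E <-> vb q A s t M.
Proof.
move=> q0 st M0; have qV0 : 0 <= q^-1 by rewrite invr_ge0 ltW.
rewrite /pvar2; set S := [set _ | _ in _].
have SE P : variation2_sum q A s t P = psum (fun u v => `|A u v| `^ q) s P.
  exact: psumE.
have S0 : (0 <= ereal_sup S)%E.
  apply: (@le_trans _ _ (variation2_sum q A s t (segment s t))%:E).
    by rewrite lee_fin SE; apply: psum_ge0 => u v; exact: powR_ge0.
  by apply: ereal_sup_ubound; exists (segment s t) => //; exact: segmentP.
split=> [SM P sP|AM].
- rewrite -lee_fin.
  apply: (@le_trans _ _ (ereal_sup S)).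
    by apply: ereal_sup_ubound; exists P => //; rewrite SE.
  have -> : ereal_sup S = poweR (poweR (ereal_sup S) q^-1) q.
    by rewrite -poweRrM mulVf ?gt_eqF// poweRe1.
  rewrite -poweR_EFin; apply: gt0_ler_poweR => //; first exact: ltW.
  + by rewrite in_itv /= poweR_ge0 leey.
  + by rewrite in_itv /= lee_fin M0 leey.
- have -> : M%:E = poweR (M `^ q)%:E q^-1.
    by rewrite poweR_EFin -powRrM mulfV ?gt_eqF// powRr1.
  apply: gt0_ler_poweR => //.
  + by rewrite in_itv /= S0 leey.
  + by rewrite in_itv /= lee_fin powR_ge0 leey.
  + by apply: ub_ereal_sup => _ [P sP <-]; rewrite lee_fin SE; exact: AM.
Qed.

Lemma pvar2_fin {E : normedModType R} q (A : R -> R -> E) s t :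
  0 < q -> s <= t -> (pvar2 q A s t < +oo)%E ->
  exists2 M, 0 <= M & vb q A s t M.
Proof.
move=> q0 st; have := pvar2_ge0 q A s t; move E1: (pvar2 q A s t) => x.
case: x E1 => [M| |] // E1 M0 _; exists M; first by rewrite -lee_fin.
by apply/pvar2_le => //; rewrite ?E1 -?lee_fin.
Qed.

Lemma pvar2_lty {E : normedModType R} q (A : R -> R -> E) s t M :
  0 < q -> s <= t -> 0 <= M -> vb q A s t M -> (pvar2 q A s t < +oo)%E.
Proof.
by move=> q0 st M0 /(pvar2_le _ q0 st M0)/le_lt_trans; apply; rewrite ltry.
Qed.

End ExtendedReals.

Section ControlledNorms.
Context {R : realType} {d : nat} {E L : normedModType R}.
Variables (ev : L -> 'rV[R]_d -> E) (X : R -> 'rV[R]_d).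

Notation incr Y := (fun u v : R => Y v - Y u).

Lemma cnorm_le (p : R) Y Y' s t (K : R) : 2 < p -> s <= t ->
  (cnorm ev p X Y Y' s t <= K%:E)%E ->
  [/\ 0 <= K, `|Y' s| <= K, vb p (incr Y') s t K &
      vb (p / 2) (remainder ev X Y Y') s t K].
Proof.
move=> p2 st; rewrite /cnorm; have [p0 p20] : 0 < p /\ 0 < p / 2 by split; lra.
have a0 : (0 <= `|Y' s|%:E)%E by rewrite lee_fin.
have b0 : (0 <= pvar p Y' s t)%E by exact: pvar2_ge0.
have c0 := pvar2_ge0 (p / 2) (remainder ev X Y Y') s t.
move=> sK; have K0 : 0 <= K by rewrite -lee_fin (le_trans _ sK)// !adde_ge0.
split=> //.
- by rewrite -lee_fin; apply: le_trans sK; rewrite -addeA leeDl// adde_ge0.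
- apply/pvar2_le => //; apply: le_trans sK; rewrite addeAC leeDr// adde_ge0//.
- by apply/pvar2_le => //; apply: le_trans sK; rewrite leeDr// adde_ge0.
Qed.

Lemma le_cnorm (p : R) Y Y' s t (a b c : R) : 2 < p -> s <= t ->
  0 <= b -> 0 <= c -> `|Y' s| <= a -> vb p (incr Y') s t b ->
  vb (p / 2) (remainder ev X Y Y') s t c ->
  (cnorm ev p X Y Y' s t <= (a + b + c)%:E)%E.
Proof.
move=> p2 st b0 c0 Ya Yb Yc; have [p0 p20] : 0 < p /\ 0 < p / 2 by split; lra.
rewrite !EFinD; apply: leeD; last exact/pvar2_le.
by apply: leeD; [rewrite lee_fin | exact/pvar2_le].
Qed.

Lemma cdist_le (p : R) Y Y' Z Z' s t (K : R) : 2 < p -> s <= t ->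
  (cdist ev p X Y Y' Z Z' s t <= K%:E)%E ->
  [/\ 0 <= K, `|Y' s - Z' s| <= K, vb p (incr (fun u => Y' u - Z' u)) s t K &
      vb (p / 2) (fun u v => remainder ev X Y Y' u v - remainder ev X Z Z' u v) s t K].
Proof.
move=> p2 st; rewrite /cdist; have [p0 p20] : 0 < p /\ 0 < p / 2 by split; lra.
have a0 : (0 <= `|Y' s - Z' s|%:E)%E by rewrite lee_fin.
have b0 : (0 <= pvar p (fun u => Y' u - Z' u)%R s t)%E by exact: pvar2_ge0.
have c0 := pvar2_ge0 (p / 2)
  (fun u v => remainder ev X Y Y' u v - remainder ev X Z Z' u v) s t.
move=> sK; have K0 : 0 <= K by rewrite -lee_fin (le_trans _ sK)// !adde_ge0.
split=> //.
- by rewrite -lee_fin; apply: le_trans sK; rewrite -addeA leeDl// adde_ge0.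
- apply/pvar2_le => //; apply: le_trans sK; rewrite addeAC leeDr// adde_ge0//.
- by apply/pvar2_le => //; apply: le_trans sK; rewrite leeDr// adde_ge0.
Qed.

Lemma le_cdist (p : R) Y Y' Z Z' s t (a b c : R) : 2 < p -> s <= t ->
  0 <= b -> 0 <= c -> `|Y' s - Z' s| <= a ->
  vb p (incr (fun u => Y' u - Z' u)) s t b ->
  vb (p / 2) (fun u v => remainder ev X Y Y' u v - remainder ev X Z Z' u v) s t c ->
  (cdist ev p X Y Y' Z Z' s t <= (a + b + c)%:E)%E.
Proof.
move=> p2 st b0 c0 Ya Yb Yc; have [p0 p20] : 0 < p /\ 0 < p / 2 by split; lra.
rewrite !EFinD; apply: leeD; last exact/pvar2_le.
by apply: leeD; [rewrite lee_fin | exact/pvar2_le].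
Qed.

End ControlledNorms.

Section Conditions.
Context {R : realType} {d k : nat}.
Variables (p T : R) (X : R -> 'rV[R]_d).
Variables
  (F : (R -> 'rV[R]_k) -> R -> 'M[R]_(d, k))
  (F' : (R -> 'rV[R]_k) -> (R -> 'M[R]_(d, k)) -> R -> 'M[R]_(d, d * k)).
Notation incr Y := (fun u v : R => Y v - Y u).

Lemma growth_bounds (C a0 a1 x r s t : R) Y Y' : 2 < p -> 0 <= C ->
  growth_conditions p T X F F' C -> controlled ev1 p X T Y Y' ->
  0 <= s -> s < t -> t <= T -> 0 <= a1 -> 0 <= x -> 0 <= r ->
  `|Y' s| <= a0 -> vb p (incr Y') s t a1 -> vb p (incr X) s t x ->
  vb (p / 2) (remainder ev1 X Y Y') s t r ->
  let G := C * (1 + (a0 + a1 + r)) ^+ 2 * (1 + x) ^+ 2 in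
  [/\ `|F Y t| <= C, vb p (incr (F Y)) s t (C * (1 + (a0 + a1) * x + r)),
      `|F' Y Y' s| <= G, vb p (incr (F' Y Y')) s t G &
      vb (p / 2) (remainder ev2 X (F Y) (F' Y Y')) s t G].
Proof.
move=> p2 C0 growth cY s0 st tT a10 x0 r0 Ya0 Ya1 Xx Yr G.
have [p0 p20] : 0 < p /\ 0 < p / 2 by split; lra.
have [h1 _ h3 h4] := growth _ _ cY s t s0 st tT; have sT := ltW st.
have a00 : 0 <= a0 by exact: le_trans Ya0.
have [a1' a1E /andP[a1'0 a1'le]] := ereal_between (pvar2_ge0 p (incr Y') s t)
  ((pvar2_le _ p0 sT a10).2 Ya1).
have [x' xE /andP[x'0 x'le]] := ereal_between (pvar2_ge0 p (incr X) s t)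
  ((pvar2_le _ p0 sT x0).2 Xx).
have [r' rE /andP[r'0 r'le]] := ereal_between
  (pvar2_ge0 (p / 2) (remainder ev1 X Y Y') s t) ((pvar2_le _ p20 sT r0).2 Yr).
have b3 : 0 <= C * (1 + (a0 + a1) * x + r).
  by rewrite mulr_ge0// !addr_ge0// mulr_ge0// addr_ge0.
have g3 : vb p (incr (F Y)) s t (C * (1 + (a0 + a1) * x + r)).
  apply/pvar2_le => //; apply: le_trans h3 _.
  rewrite /pvar a1E xE rE -!EFinD -!EFinM lee_fin.
  apply: ler_wpM2l => //; apply: lerD => //; rewrite lerD2l.
  by apply: ler_pM; rewrite ?addr_ge0// lerD.
have g4 : (cnorm ev2 p X (F Y) (F' Y Y') s t <= G%:E)%E.
  apply: le_trans h4 _.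
  rewrite /cnorm /pvar a1E xE rE -!EFinD -!EFin_expe -!EFinM lee_fin.
  have k0 : 0 <= 1 + (`|Y' s| + a1' + r') by rewrite !addr_ge0.
  apply: ler_pM; rewrite ?mulr_ge0 ?exprn_ge0 ?addr_ge0//.
    apply: ler_wpM2l => //; apply: lerXn2r; rewrite ?nnegrE ?addr_ge0//.
    by rewrite lerD2l !lerD.
  by apply: lerXn2r; rewrite ?nnegrE ?addr_ge0// lerD2l.
by have [_ ? ? ?] := cnorm_le p2 sT g4.
Qed.

(** The last conclusion leaves the bound [y] on the p-variation of Y - Z free, as it is derived
    afterwards from the derivatives and remainders by [path_vb]. *)
Lemma lipschitz_bounds (K C a b0 b1 c s t : R) Y Y' Z Z' : 2 < p -> 0 <= C ->
  lipschitz_conditions p T X F F' K C ->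
  controlled ev1 p X T Y Y' -> controlled ev1 p X T Z Z' ->
  0 <= s -> s < t -> t <= T ->
  (cnorm ev1 p X Y Y' s t <= K%:E)%E -> (cnorm ev1 p X Z Z' s t <= K%:E)%E ->
  0 <= b1 -> 0 <= c -> `|Y s - Z s| <= a -> `|Y' s - Z' s| <= b0 ->
  vb p (incr (fun u => Y' u - Z' u)) s t b1 ->
  vb (p / 2) (fun u v => remainder ev1 X Y Y' u v - remainder ev1 X Z Z' u v) s t c ->
  let G := C * (a + (b0 + b1 + c)) in
  [/\ `|F' Y Y' s - F' Z Z' s| <= G,
      vb p (incr (fun u => F' Y Y' u - F' Z Z' u)) s t G,
      vb (p / 2) (fun u v => remainder ev2 X (F Y) (F' Y Y') u v
                  - remainder ev2 X (F Z) (F' Z Z') u v) s t G &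
      forall y, 0 <= y -> vb p (incr (fun u => Y u - Z u)) s t y ->
        vb p (incr (fun u => F Y u - F Z u)) s t (C * (a + y))].
Proof.
move=> p2 C0 lip cY cZ s0 st tT nY nZ b10 c0 Ya Yb0 Yb1 Yc G.
have [p0 p20] : 0 < p /\ 0 < p / 2 by split; lra.
have [h1 h2] := lip _ _ _ _ cY cZ s t s0 st tT nY nZ; have sT := ltW st.
have a0 : 0 <= a by exact: le_trans Ya.
have g2 : (cdist ev2 p X (F Y) (F' Y Y') (F Z) (F' Z Z') s t <= G%:E)%E.
  apply: le_trans h2 _; rewrite /G EFinM; apply: lee_wpmul2l; first by rewrite lee_fin.
  rewrite EFinD; apply: leeD; first by rewrite lee_fin.
  exact: le_cdist.
have [_ ? ? ?] := cdist_le p2 sT g2; split=> // y y0 Yy.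
apply/pvar2_le => //; first by rewrite mulr_ge0// addr_ge0.
apply: le_trans h1 _; rewrite EFinM; apply: lee_wpmul2l; first by rewrite lee_fin.
by rewrite EFinD; apply: leeD; [rewrite lee_fin | exact/pvar2_le].
Qed.

End Conditions.

(** * Integrals of controlled paths *)

Section IntegralIncrements.
Context {R : realType} {d k : nat}.
Variables (X : R -> 'rV[R]_d) (XX : R -> R -> 'M[R]_d).

Lemma is_rough_integralP (V : R -> 'M[R]_(d, k)) (V' : R -> 'M[R]_(d, d * k))
    s t I : is_rough_integral X XX V V' s t I -> forall e : R, 0 < e ->
  exists2 a : R, 0 < a & forall P, itv_partition s t P -> fine_mesh a s P ->
    `|psum (germ X XX V V') s P - I| <= e.
Proof.
move=> /cvgrPdist_le H e e0; have [a a0 aP] := H e e0; exists a => // P sP fP.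
by rewrite distrC -(rough_sumE _ _ _ _ _ t); apply: aP => //; exact/(fine_meshP _ t).
Qed.

Lemma is_rough_integralB (V W : R -> 'M[R]_(d, k))
    (V' W' : R -> 'M[R]_(d, d * k)) s t I J :
  is_rough_integral X XX V V' s t I -> is_rough_integral X XX W W' s t J ->
  is_rough_integral X XX (fun u => V u - W u) (fun u => V' u - W' u) s t (I - J).
Proof.
move=> VI WJ; rewrite /is_rough_integral.
have -> : rough_sum X XX (fun u => V u - W u) (fun u => V' u - W' u) s t =
    (fun P => rough_sum X XX V V' s t P - rough_sum X XX W W' s t P).
  apply/funext => P; rewrite !rough_sumE; elim: P s {VI WJ} => [|u P IH] s /=.
    by rewrite subr0.
  by rewrite germB IH addrACA -opprD.
exact: cvgB.
Qed.

Lemma is_rough_integral_refl (V : R -> 'M[R]_(d, k))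
    (V' : R -> 'M[R]_(d, d * k)) s I :
  is_rough_integral X XX V V' s s I -> I = 0.
Proof.
move=> VI; apply/eqP; rewrite -normr_le0; apply/ler_addgt0Pr => e e0.
have [a a0 aP] := is_rough_integralP VI e0.
have := aP [::] (conj isT (eqxx s)) isT.
by rewrite /= sub0r normrN add0r.
Qed.

(** Concatenating fine partitions of [s, u] and [u, v] transfers any estimate of the sums over
    [u, v] to the increment of the integral. *)
Lemma integral_increment (V : R -> 'M[R]_(d, k)) (V' : R -> 'M[R]_(d, d * k))
    s u v I J c B : s <= u -> u <= v ->
  is_rough_integral X XX V V' s u I -> is_rough_integral X XX V V' s v J ->
  (forall P, itv_partition u v P -> `|psum (germ X XX V V') u P - c| <= B) ->
  `|J - I - c| <= B.
Proof.
move=> su uv VI VJ H; apply/ler_addgt0Pr => e e0.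
have e20 : 0 < e / 2 by rewrite divr_gt0.
have [a a0 aP] := is_rough_integralP VI e20.
have [b b0 bP] := is_rough_integralP VJ e20.
have m0 : 0 < Num.min a b by rewrite lt_min a0.
have [P sP fP] := fine_partition_exists m0 su.
have [Q uQ fQ] := fine_partition_exists m0 uv.
have fle c' x Z : Num.min a b <= c' -> fine_mesh (Num.min a b) x Z -> fine_mesh c' x Z.
  by move=> mc; apply: sub_path => y z /lt_le_trans; apply.
have hI : `|psum (germ X XX V V') s P - I| <= e / 2.
  by apply: aP => //; apply: fle fP; rewrite ge_min lexx.
have hJ := bP _ (itv_partition_cat sP uQ).
have {}hJ : `|psum (germ X XX V V') s (P ++ Q) - J| <= e / 2.
  apply: hJ; rewrite /fine_mesh cat_path (partition_last sP).
  by apply/andP; split; apply: fle; rewrite ?ge_min ?lexx ?orbT.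
rewrite psum_cat (partition_last sP) in hJ.
have := H Q uQ; set p := psum _ s P in hI hJ *; set q := psum _ u Q in hJ * => hq.
have -> : J - I - c = (p - I) + (q - c) - (p + q - J).
  by apply/rowP => j; rewrite !mxE; ring.
apply: le_trans (ler_normB _ _) _.
have := ler_normD (p - I) (q - c); lra.
Qed.

End IntegralIncrements.

Section IntegralEstimates.
Context {R : realType} {d k : nat}.
Variables (X : R -> 'rV[R]_d) (XX : R -> R -> 'M[R]_d).
Variables (V : R -> 'M[R]_(d, k)) (V' : R -> 'M[R]_(d, d * k)).
Variables (I : R -> 'rV[R]_k).

Notation incr Y := (fun u v : R => Y v - Y u).
Notation RV := (remainder ev2 X V V').
Notation RI := (remainder ev1 X I V).

Lemma integral_remainder_point (p T r x w z m u v : R) :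
  2 < p -> p < 3 -> chen X XX 0 T ->
  (forall t, 0 <= t -> t <= T -> is_rough_integral X XX V V' 0 t (I t)) ->
  0 <= u -> u < v -> v <= T ->
  0 <= r -> 0 <= x -> 0 <= w -> 0 <= z ->
  (forall y, u <= y -> y < v -> vb (p / 2) RV u y r) ->
  vb p (incr X) u v x ->
  (forall y, u <= y -> y < v -> vb p (incr V') u y w) ->
  vb (p / 2) XX u v z -> `|V' u| <= m ->
  `|RI u v| <= rough_const R d p * (r * x + w * z) + evc R d * (m * z).
Proof.
move=> p2 p3 ch VI u0 uv vT r0 x0 w0 z0 Rr Xx Vw XXz Vm.
have uT := le_trans (ltW uv) vT; have v0 := le_trans u0 (ltW uv).
have p20 : 0 < p / 2 by lra.
have e0 : 0 <= evc R d := le_trans ler01 evc_ge1.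
have ch' : chen X XX u v.
  move=> a b c ua ab bc cv; apply: ch => //; [exact: le_trans ua|exact: le_trans vT].
have h := integral_increment u0 (ltW uv) (VI _ u0 uT) (VI _ v0 vT)
  (fun P uP => rough_sum_estimate p2 p3 ch' r0 x0 w0 z0 Rr Xx Vw XXz uv uP).
have XXuv := vb_point p20 z0 XXz (lexx _) uv (lexx _).
have -> : RI u v = (I v - I u - germ X XX V V' u v) + ev_tensor (V' u) (XX u v).
  by rewrite /remainder /germ opprD !addrA subrK.
apply: le_trans (ler_normD _ _) _; apply: lerD => //.
apply: le_trans (ev_tensor_norm_le _ _) _; apply: ler_wpM2l => //.
exact: ler_pM.
Qed.

(** The pointwise bound cannot be summed with [r] and [z] fixed. On each [u, v] they are replaced by
    the optimal bounds [rho u v] and [zeta u v], whose powers p/2 are superadditive, whereas [x],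
    [w] and [m] stay global. *)
Lemma integral_remainder_vb (p T r x w z m s t : R) :
  2 < p -> p < 3 -> chen X XX 0 T ->
  (forall t, 0 <= t -> t <= T -> is_rough_integral X XX V V' 0 t (I t)) ->
  0 <= s -> t <= T ->
  0 <= r -> 0 <= x -> 0 <= w -> 0 <= z -> 0 <= m ->
  vb (p / 2) RV s t r -> vb p (incr X) s t x ->
  vb p (incr V') s t w -> vb (p / 2) XX s t z ->
  (forall u, s <= u -> u <= t -> `|V' u| <= m) ->
  vb (p / 2) RI s t
    (2 * (rough_const R d p * (r * x + w * z) + evc R d * (m * z))).
Proof.
move=> p2 p3 ch VI s0 tT r0 x0 w0 z0 m0 Rr Xx Vw XXz Vm.
have p20 : 0 < p / 2 by lra.
have p1 : 1 <= p / 2 by lra.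
have e0 : 0 <= evc R d := le_trans ler01 evc_ge1.
have C0 : 0 <= rough_const R d p by exact: rough_const_ge0.
have [rho [rho0 rhoP rho_le rho_sum]] := vb_control p20 r0 Rr.
have [zeta [zeta0 zetaP zeta_le zeta_sum]] := vb_control p20 z0 XXz.
have rho_vb : vb (p / 2) rho s t r.
  move=> P sP; apply: le_trans (rho_sum P sP).
  by apply: ler_psum sP _ => u v *; rewrite ger0_norm.
have zeta_vb : vb (p / 2) zeta s t z.
  move=> P sP; apply: le_trans (zeta_sum P sP).
  by apply: ler_psum sP _ => u v *; rewrite ger0_norm.
set C := rough_const R d p in C0 *.
have c20 : 0 <= C * w + evc R d * m by rewrite addr_ge0// mulr_ge0.
have -> : C * (r * x + w * z) + evc R d * (m * z) =
    C * x * r + (C * w + evc R d * m) * z by ring.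
apply: (vbD (A := fun u v => C * x * rho u v)
  (B := fun u v => (C * w + evc R d * m) * zeta u v)) => //.
- by rewrite mulr_ge0// mulr_ge0.
- by rewrite mulr_ge0.
- move=> u v su uv vt; rewrite !ger0_norm ?mulr_ge0//.
  have h := integral_remainder_point p2 p3 ch VI (le_trans s0 su) uv
    (le_trans vt tT) (rho0 u v) x0 w0 (zeta0 u v).
  apply: le_trans (h m _ _ _ _ _) _.
  + move=> y uy yv; apply: vb_restrict (rhoP _ _ su vt) (lexx _) (ltW yv).
  + exact: vb_restrict Xx su vt.
  + by move=> y uy yv; apply: vb_restrict Vw su _; exact: le_trans (ltW yv) vt.
  + exact: zetaP.
  + by apply: Vm => //; exact: le_trans (ltW uv) vt.
  by rewrite -/C le_eqVlt; apply/orP; left; apply/eqP; ring.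
- apply: vb_scale rho_vb => //; [exact: ltW|by rewrite mulr_ge0|].
  by move=> u v *; rewrite normrM ger0_norm// mulr_ge0.
- apply: vb_scale zeta_vb => //; first exact: ltW.
  by move=> u v *; rewrite normrM ger0_norm.
Qed.

End IntegralEstimates.

(** * Controlled paths and the Picard image *)

Section ControlledPaths.
Context {R : realType} {d k : nat}.
Notation incr Y := (fun u v : R => Y v - Y u).

Lemma cvg_ev1 {S : Type} (G : set_system S) {FG : Filter G}
    (f : S -> 'M[R]_(d, k)) (g : S -> 'rV[R]_d) a b :
  f @ G --> a -> g @ G --> b -> (fun x => ev1 (f x) (g x)) @ G --> ev1 a b.
Proof.
move=> /cvgrPdist_le fa /cvgrPdist_le gb; apply/cvgrPdist_le => e e0.
have c0 : 0 <= evc R d := le_trans ler01 evc_ge1.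
pose M := evc R d * (1 + `|a| + `|b|) + 1.
have M0 : 0 < M by rewrite ltr_wpDl// mulr_ge0// !addr_ge0.
pose h := Num.min 1 (e / M).
have h0 : 0 < h by rewrite lt_min ltr01 divr_gt0.
have h1 : h <= 1 by rewrite ge_min lexx.
have hM : h * M <= e by rewrite -ler_pdivlMr// ge_min lexx orbT.
near=> x.
have fx : `|a - f x| <= h by near: x; exact: fa.
have gx : `|b - g x| <= h by near: x; exact: gb.
have -> : ev1 a b - ev1 (f x) (g x) =
    ev1 a (b - g x) + ev1 (a - f x) b - ev1 (a - f x) (b - g x).
  by rewrite !ev1Bl !ev1Br; apply/rowP => j; rewrite !mxE; ring.
apply: le_trans (ler_normB _ _) _; apply: le_trans (lerD (ler_normD _ _) (lexx _)) _.
apply: le_trans (lerD (lerD (ev1_norm_le _ _) (ev1_norm_le _ _)) (ev1_norm_le _ _)) _.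
apply: le_trans hM; rewrite -!mulrDr.
apply: (@le_trans _ _ (evc R d * (`|a| * h + h * `|b| + h * 1))).
  apply: ler_wpM2l => //; apply: lerD; last by apply: ler_pM => //; exact: le_trans h1.
  by apply: lerD; [exact: ler_wpM2l | exact: ler_wpM2r].
have -> : `|a| * h + h * `|b| + h * 1 = h * (1 + `|a| + `|b|) by ring.
by rewrite mulrCA /M; apply: ler_wpM2l; [exact: ltW | rewrite lerDl].
Unshelve. all: by end_near. Qed.

Lemma rough_path_facts (p T : R) (X : R -> 'rV[R]_d) XX :
  2 < p -> 0 < T -> rough_path p T X XX ->
  [/\ cadlag 0 T X, chen X XX 0 T,
      forall u, 0 <= u -> u < T -> XX u @ u^'+ --> (0 : 'M[R]_d),
      exists2 x, 0 <= x & vb p (incr X) 0 T x &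
      exists2 z, 0 <= z & vb (p / 2) XX 0 T z].
Proof.
move=> p2 T0 [[cX vX] [_ cXX vXX] ch].
have [p0 p20] : 0 < p /\ 0 < p / 2 by split; lra.
split=> //.
(* Chen's relation at three equal points gives XX_{u,u} = 0, so that right continuity reads as
   convergence to 0. *)
- move=> u u0 uT; have XX0 : XX u u = 0.
    have := ch u u u u0 (lexx _) (lexx _) (ltW uT).
    rewrite subrr /tensor mulmx0 addr0 => /eqP.
    by rewrite -subr_eq0 opprD addrA subrr sub0r oppr_eq0 => /eqP.
  have := (cXX u _).1 u; rewrite XX0; apply; last by rewrite lexx.
  by rewrite u0 ltW.
- by apply: pvar2_fin vX => //; exact: ltW.
- by apply: pvar2_fin vXX => //; exact: ltW.
Qed.

Lemma controlled_facts {E L : normedModType R} (ev : L -> 'rV[R]_d -> E)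
    (p T : R) (X : R -> 'rV[R]_d) Y Y' :
  2 < p -> 0 < T -> controlled ev p X T Y Y' ->
  [/\ cadlag 0 T Y, cadlag 0 T Y',
      exists2 m, 0 <= m & vb p (incr Y') 0 T m &
      exists2 r, 0 <= r & vb (p / 2) (remainder ev X Y Y') 0 T r].
Proof.
move=> p2 T0 [[cY _] [cY' vY'] [_ _ vR]].
have [p0 p20] : 0 < p /\ 0 < p / 2 by split; lra.
split=> //.
- by apply: pvar2_fin vY' => //; exact: ltW.
- by apply: pvar2_fin vR => //; exact: ltW.
Qed.

(** An increment of Y is Y'X plus the remainder. Its left end is before [t], hence the bound on Y'
    over [s, t) only; the p/2-variation of the remainder is weakened to p-variation. *)
Lemma path_vb (p s t : R) (X : R -> 'rV[R]_d) (Y : R -> 'rV[R]_k)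
    (Y' : R -> 'M[R]_(d, k)) m r x : 2 < p -> 0 <= m -> 0 <= r -> 0 <= x ->
  (forall u, s <= u -> u < t -> `|Y' u| <= m) -> vb p (incr X) s t x ->
  vb (p / 2) (remainder ev1 X Y Y') s t r ->
  vb p (incr Y) s t (2 * (evc R d * m * x + r)).
Proof.
move=> p2 m0 r0 x0 Ym Xx Rr.
have c0 : 0 <= evc R d := le_trans ler01 evc_ge1.
have cm0 : 0 <= evc R d * m by exact: mulr_ge0.
apply: (vbD (A := fun u v => ev1 (Y' u) (X v - X u)) (B := remainder ev1 X Y Y')).
- lra.
- exact: mulr_ge0.
- by [].
- move=> u v su uv vt; rewrite -[X in `|X| <= _](subrKC (ev1 (Y' u) (X v - X u))).
  exact: ler_normD.
- apply: (vb_scale _ cm0 x0 _ Xx); first lra.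
  move=> u v su uv vt; apply: le_trans (ev1_norm_le _ _) _.
  rewrite -mulrA; apply: ler_wpM2l => //; apply: ler_wpM2r => //.
  by apply: Ym => //; exact: lt_le_trans vt.
- by apply: vb_exponent Rr => //; lra.
Qed.

Lemma deriv_le (p T m : R) {L : normedModType R} (Y' : R -> L) : 0 < p -> 0 <= m ->
  vb p (incr Y') 0 T m -> forall u, 0 <= u -> u <= T -> `|Y' u| <= `|Y' 0| + m.
Proof.
move=> p0 m0 Ym u; rewrite le_eqVlt => /orP[/eqP<- _|u0 uT]; first by rewrite lerDl.
rewrite -[Y' u](subrKC (Y' 0)); apply: le_trans (ler_normD _ _) _.
by rewrite lerD2l; exact: (vb_point p0 m0 Ym (lexx _) u0 uT).
Qed.

(** Left limits of Y and Y' follow from their finite variation, and those of the remainder from the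
    continuity of [ev1]; besides the bounds, right continuity is what has to be checked. *)
Lemma controlled_intro (p T m r : R) (X : R -> 'rV[R]_d) (Y : R -> 'rV[R]_k)
    (Y' : R -> 'M[R]_(d, k)) :
  2 < p -> 0 < T -> cadlag 0 T X -> (exists2 x, 0 <= x & vb p (incr X) 0 T x) ->
  (forall u, 0 <= u -> u < T -> Y @ u^'+ --> Y u) ->
  (forall u, 0 <= u -> u < T -> Y' @ u^'+ --> Y' u) ->
  0 <= m -> 0 <= r ->
  vb p (incr Y') 0 T m -> vb (p / 2) (remainder ev1 X Y Y') 0 T r ->
  controlled ev1 p X T Y Y'.
Proof.
move=> p2 T0 cX [x x0 Xx] rY rY' m0 r0 Y'm Rr.
have [p0 p20] : 0 < p /\ 0 < p / 2 by split; lra.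
have c0 : 0 <= evc R d := le_trans ler01 evc_ge1.
pose m1 := `|Y' 0| + m.
have m10 : 0 <= m1 by rewrite addr_ge0.
have Y'm1 u : 0 <= u -> u < T -> `|Y' u| <= m1.
  by move=> u0 /ltW; exact: (deriv_le p0 m0 Y'm).
have Yy := path_vb p2 m10 r0 x0 Y'm1 Xx Rr.
have y0 : 0 <= 2 * (evc R d * m1 * x + r) by rewrite mulr_ge0// addr_ge0// !mulr_ge0.
have lY u : 0 < u -> u <= T -> cvg (Y @ u^'-).
  by move=> u0 uT; exact: vb_left_limit p0 u0 (vb_restrict Yy (lexx _) uT).
have lY' u : 0 < u -> u <= T -> cvg (Y' @ u^'-).
  by move=> u0 uT; exact: vb_left_limit p0 u0 (vb_restrict Y'm (lexx _) uT).
have lX u : 0 < u -> u <= T -> cvg (X @ u^'-).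
  by move=> u0 uT; apply: cX.2; rewrite u0.
have rX u : 0 <= u -> u < T -> X @ u^'+ --> X u.
  by move=> u0 uT; apply: cX.1; rewrite u0.
have cY : cadlag 0 T Y.
  by split=> u /andP[u0 uT]; [exact: rY | exact: lY].
have cY' : cadlag 0 T Y'.
  by split=> u /andP[u0 uT]; [exact: rY' | exact: lY'].
split.
- by split=> //; exact: (pvar2_lty p0 (ltW T0) y0).
- by split=> //; exact: (pvar2_lty p0 (ltW T0) m0).
split; last exact: (pvar2_lty p20 (ltW T0) r0).
- move=> t /andP[t0 tT]; split=> u /andP[u0 ut].
  + apply: cvgB; first by apply: cvgB; [exact: cvg_cst | apply: rY => //; exact: lt_le_trans tT].
    apply: cvg_ev1; first by apply: rY' => //; exact: lt_le_trans tT.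
    by apply: cvgB; [exact: cvg_cst | apply: rX => //; exact: lt_le_trans tT].
  + have uT := le_trans ut tT.
    have /cvg_ex[a Ya] := lY u u0 uT; have /cvg_ex[b Yb] := lY' u u0 uT.
    have /cvg_ex[c Xc] := lX u u0 uT.
    apply/cvg_ex; exists (Y t - a - ev1 b (X t - c)).
    by apply: cvgB; [apply: cvgB => //; exact: cvg_cst|apply: cvg_ev1 => //;
      apply: cvgB => //; exact: cvg_cst].
- move=> s /andP[s0 sT]; split=> u /andP[su uT].
  + have u0 := le_trans s0 su.
    apply: cvgB; first by apply: cvgB; [exact: rY|exact: cvg_cst].
    by apply: cvg_ev1; [exact: cvg_cst|apply: cvgB; [exact: rX|exact: cvg_cst]].
  + have u0 := le_lt_trans s0 su.
    have /cvg_ex[a Ya] := lY u u0 uT; have /cvg_ex[c Xc] := lX u u0 uT.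
    apply/cvg_ex; exists (a - Y s - ev1 (Y' s) (c - X s)).
    by apply: cvgB; [apply: cvgB => //; exact: cvg_cst|apply: cvg_ev1;
      [exact: cvg_cst|apply: cvgB => //; exact: cvg_cst]].
Qed.

End ControlledPaths.

Section IntegralPath.
Context {R : realType} {d k : nat}.
Notation incr Y := (fun u v : R => Y v - Y u).

Lemma is_rough_integral_refl0 (X : R -> 'rV[R]_d) XX (V : R -> 'M[R]_(d, k))
    (V' : R -> 'M[R]_(d, d * k)) s : is_rough_integral X XX V V' s s 0.
Proof.
apply/cvgrPdist_le => e e0; exists 1 => // P /itv_partitionxx -> _.
by rewrite /= rough_sumE /= subrr normr0 ltW.
Qed.

Lemma cadlag_restrict {E : normedModType R} (Y : R -> E) s t u v :
  cadlag s t Y -> s <= u -> v <= t -> cadlag u v Y.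
Proof.
move=> [rY lY] su vt; split=> x /andP[ux xv].
- by apply: rY; rewrite (le_trans su ux) (lt_le_trans xv).
- by apply: lY; rewrite (le_lt_trans su ux) (le_trans xv).
Qed.

Lemma rough_integral_path (p T : R) (X : R -> 'rV[R]_d) XX
    (V : R -> 'M[R]_(d, k)) (V' : R -> 'M[R]_(d, d * k)) :
  2 < p -> p < 3 -> 0 < T -> rough_path p T X XX -> controlled ev2 p X T V V' ->
  exists I : R -> 'rV[R]_k,
    forall t, 0 <= t -> t <= T -> is_rough_integral X XX V V' 0 t (I t).
Proof.
move=> p2 p3 T0 /(rough_path_facts p2 T0)[cX ch rXX [x x0 Xx] [z z0 XXz]].
move=> /(controlled_facts p2 T0)[cV cV' [m m0 V'm] [r r0 Rr]].
have [p0 p20] : 0 <= p /\ 0 <= p / 2 by split; lra.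
(* [rough_integral_exists] asks for positive bounds, hence the increase by 1. *)
have pos (b : R) : 0 <= b -> 0 < b + 1 by move=> ?; rewrite ltr_wpDl.
have le1 (b : R) : b <= b + 1 by rewrite lerDl.
suff /choice[I IP] : forall t, exists I : 'rV[R]_k,
    0 <= t -> t <= T -> is_rough_integral X XX V V' 0 t I by exists I.
move=> t; have [t0|t0|<-] := ltgtP 0 t; last by exists 0 => _ _; exact: is_rough_integral_refl0.
  have [tT|Tt] := leP t T; last by exists 0.
  have [I HI] := rough_integral_exists p2 p3 t0
    (fun w u v w0 wu uv vt => ch w u v w0 wu uv (le_trans vt tT))
    (cadlag_restrict cX (lexx _) tT) (cadlag_restrict cV (lexx _) tT)
    (cadlag_restrict cV' (lexx _) tT)
    (fun u u0 ut => rXX u u0 (lt_le_trans ut tT))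
    (pos _ r0) (pos _ x0) (pos _ m0) (pos _ z0)
    (vb_restrict (vb_le p20 r0 (le1 _) Rr) (lexx _) tT)
    (vb_restrict (vb_le p0 x0 (le1 _) Xx) (lexx _) tT)
    (vb_restrict (vb_le p0 m0 (le1 _) V'm) (lexx _) tT)
    (vb_restrict (vb_le p20 z0 (le1 _) XXz) (lexx _) tT).
  by exists I.
by exists 0.
Qed.

(** By [vb_right_small] the variations of X and XX on a short [u, v] are small, and each term of the
    estimate of the increment contains one of them; [M] collects the other factors. *)
Lemma integral_right_cvg (p T r x w z m : R) (X : R -> 'rV[R]_d) XX
    (V : R -> 'M[R]_(d, k)) (V' : R -> 'M[R]_(d, d * k)) (I : R -> 'rV[R]_k) u :
  2 < p -> p < 3 -> chen X XX 0 T ->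
  (forall t, 0 <= t -> t <= T -> is_rough_integral X XX V V' 0 t (I t)) ->
  0 <= u -> u < T -> 0 <= r -> 0 <= w -> 0 <= m ->
  X @ u^'+ --> X u -> XX u @ u^'+ --> (0 : 'M[R]_d) ->
  vb (p / 2) (remainder ev2 X V V') 0 T r -> vb p (incr X) 0 T x ->
  vb p (incr V') 0 T w -> vb (p / 2) XX 0 T z -> `|V' u| <= m ->
  I @ u^'+ --> I u.
Proof.
move=> p2 p3 ch VI u0 uT r0 w0 m0 rX rXX Rr Xx V'w XXz Vm.
have [p0 p20] : 0 < p /\ 0 < p / 2 by split; lra.
have c0 : 0 <= evc R d := le_trans ler01 evc_ge1.
have C0 : 0 <= rough_const R d p by exact: rough_const_ge0.
apply/cvg_rightP => e e0.
pose M := rough_const R d p * (r + w) + evc R d * m + evc R d * `|V u| + 1.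
have M0 : 0 < M by rewrite ltr_wpDl// !addr_ge0// mulr_ge0// addr_ge0.
have h0 : 0 < e / M by rewrite divr_gt0.
have rX0 : incr X u @ u^'+ --> (0 : 'rV[R]_d).
  by rewrite -(subrr (X u)); apply: cvgB => //; exact: cvg_cst.
have [a [ua aT Xa]] := vb_right_small p0 uT h0 (vb_restrict Xx u0 (lexx _)) rX0.
have [b [ub bT XXb]] := vb_right_small p20 uT h0 (vb_restrict XXz u0 (lexx _)) rXX.
exists (Num.min a b); first by rewrite lt_min ua.
move=> v uv; rewrite lt_min => /andP[va vb].
have vT : v <= T by exact: le_trans (ltW va) aT.
have hR := integral_remainder_point p2 p3 ch VI u0 uv vT r0 (ltW h0) w0 (ltW h0)
  (fun y uy yv => vb_restrict Rr u0 (ltW (lt_le_trans yv vT)))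
  (vb_restrict Xa (lexx _) (ltW va))
  (fun y uy yv => vb_restrict V'w u0 (ltW (lt_le_trans yv vT)))
  (vb_restrict XXb (lexx _) (ltW vb)) Vm.
have hX := vb_point p0 (ltW h0) Xa (lexx _) uv (ltW va).
rewrite -[I v - I u](subrK (ev1 (V u) (X v - X u))).
apply: le_trans (ler_normD _ _) _; apply: le_trans (lerD hR (ev1_norm_le _ _)) _.
have : evc R d * (`|V u| * `|X v - X u|) <= evc R d * (`|V u| * (e / M)).
  by apply: ler_wpM2l => //; exact: ler_wpM2l.
have : e / M * M = e by rewrite divfK// gt_eqF.
rewrite {2}/M; move: (e / M) h0 => h h0 hM h1; rewrite -[leRHS]hM.
move: (rough_const _ _ _) C0 (evc _ _) c0 h1 => C C0 c c0 h1 {hR hM}.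
by apply: le_trans (lerD (lexx _) h1) _; nra.
Qed.

Lemma picard_controlled (p T : R) (X : R -> 'rV[R]_d) XX
    (V : R -> 'M[R]_(d, k)) (V' : R -> 'M[R]_(d, d * k)) (I y : R -> 'rV[R]_k)
    (y' : R -> 'M[R]_(d, k)) :
  2 < p -> p < 3 -> 0 < T -> rough_path p T X XX -> controlled ev1 p X T y y' ->
  controlled ev2 p X T V V' ->
  (forall t, 0 <= t -> t <= T -> is_rough_integral X XX V V' 0 t (I t)) ->
  controlled ev1 p X T (fun t => y t + I t) (fun t => y' t + V t).
Proof.
move=> p2 p3 T0 /(rough_path_facts p2 T0)[cX ch rXX [x x0 Xx] [z z0 XXz]].
move=> /(controlled_facts p2 T0)[cy cy' [my my0 y'm] [ry ry0 Ry]].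
move=> cVV.
have [p0 p20] : 0 < p /\ 0 < p / 2 by split; lra.
have [v v0 Vv] : exists2 v, 0 <= v & vb p (incr V) 0 T v.
  by have [[_ vV] _ _] := cVV; exact: pvar2_fin p0 (ltW T0) vV.
move: cVV => /(controlled_facts p2 T0)[cV cV' [m m0 V'm] [r r0 Rr]] VI.
have [p1 p21] : 1 <= p /\ 1 <= p / 2 by split; lra.
pose m1 := `|V' 0| + m.
have m10 : 0 <= m1 by rewrite addr_ge0.
have V'm1 := deriv_le p0 m0 V'm.
have c0 : 0 <= evc R d := le_trans ler01 evc_ge1.
have C0 : 0 <= rough_const R d p by exact: rough_const_ge0.
have RI := integral_remainder_vb p2 p3 ch VI (lexx _) (lexx _) r0 x0 m0 z0 m10
  Rr Xx V'm XXz V'm1.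
set b := 2 * _ in RI.
have b0 : 0 <= b by rewrite /b !(mulr_ge0, addr_ge0).
have rX u : 0 <= u -> u < T -> X @ u^'+ --> X u.
  by move=> u0 uT; apply: cX.1; rewrite u0.
apply: (@controlled_intro _ _ _ p T (2 * (my + v)) (2 * (ry + b))) => //.
- by exists x.
- move=> u u0 uT; apply: cvgD; first by apply: cy.1; rewrite u0.
  exact: (integral_right_cvg p2 p3 ch VI u0 uT r0 m0 m10 (rX u u0 uT)
    (rXX u u0 uT) Rr Xx V'm XXz (V'm1 u u0 (ltW uT))).
- by move=> u u0 uT; apply: cvgD; [apply: cy'.1|apply: cV.1]; rewrite u0.
- by rewrite mulr_ge0// addr_ge0.
- by rewrite mulr_ge0// addr_ge0.
- apply: (vbD p1 my0 v0 _ y'm Vv) => u w *.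
  by rewrite opprD addrACA; exact: ler_normD.
- apply: (vbD p21 ry0 b0 _ Ry RI) => u w *.
  apply: le_trans (ler_normD _ _); rewrite le_eqVlt; apply/orP; left; apply/eqP.
  congr (`| _ |); rewrite /remainder /ev1 mulmxDr.
  by apply/rowP => j; rewrite !mxE; ring.
Qed.

End IntegralPath.

(** * A ball that is invariant under the Picard map *)

Section Budget.
Context {R : realType} {E1 E2 : normedModType R}.
Variables (q1 q2 eps : R) (A1 : R -> R -> E1) (A2 : R -> R -> E2).
Hypotheses (q10 : 0 < q1) (q20 : 0 < q2) (eps0 : 0 < eps).

Definition good u v : Prop := vb q1 A1 u v eps /\ vb q2 A2 u v eps.

(* Nothing is required of the jump at [v]. *)
Definition halfgood u v : Prop := forall w, u <= w -> w < v -> good u w.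

Definition quantum : R := Num.min (eps `^ q1) (eps `^ q2).

(* An interval that is not good uses up at least [quantum] of the variation, so
   that [budget n s t] leaves room for fewer than [n] of them in [s, t]. *)
Definition budget (n : nat) s t : Prop := exists M1 M2,
  [/\ 0 <= M1 /\ 0 <= M2, vb q1 A1 s t M1, vb q2 A2 s t M2 &
      M1 `^ q1 + M2 `^ q2 < n%:R * quantum].

Lemma good_restrict s t u v : good s t -> s <= u -> v <= t -> good u v.
Proof.
move=> [g1 g2] su vt; split; first exact: vb_restrict g1 su vt.
exact: vb_restrict g2 su vt.
Qed.

Lemma quantum_gt0 : 0 < quantum.
Proof. by rewrite lt_min !powR_gt0. Qed.

Lemma budget0 s t : ~ budget 0 s t.
Proof.
move=> [M1 [M2 [_ _ _]]]; rewrite mul0r ltNge => /negP; apply.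
by rewrite addr_ge0// powR_ge0.
Qed.

(** The sum over a partition of [s, u] is subtracted from M^q; the witness is the q-th root of what
    is left for [u, t]. *)
Lemma vb_consume {E : normedModType R} q (A : R -> R -> E) s u t M P :
  0 < q -> u <= t -> vb q A s t M -> itv_partition s u P ->
  exists M', [/\ 0 <= M', vb q A u t M' &
    M' `^ q = M `^ q - psum (fun x y => `|A x y| `^ q) s P].
Proof.
move=> q0 ut AM sP; set S := psum _ _ _.
have H Q : itv_partition u t Q ->
    psum (fun x y => `|A x y| `^ q) u Q <= M `^ q - S.
  move=> uQ; have := AM _ (itv_partition_cat sP uQ).
  by rewrite psum_cat (partition_last sP) -/S lerBrDl.
have S0 : 0 <= M `^ q - S.
  apply: le_trans (H _ (segmentP ut)).
  by apply: psum_ge0 => ? ?; exact: powR_ge0.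
have SK : ((M `^ q - S) `^ q^-1) `^ q = M `^ q - S.
  by rewrite -powRrM mulVf ?powRr1// gt_eqF.
exists ((M `^ q - S) `^ q^-1); split=> //; first exact: powR_ge0.
by move=> Q uQ; rewrite SK; exact: H.
Qed.

Lemma not_vb {E : normedModType R} q (A : R -> R -> E) s t M : ~ vb q A s t M ->
  exists2 P, itv_partition s t P & M `^ q < psum (fun x y => `|A x y| `^ q) s P.
Proof.
move=> nvb; apply: contrapT => H; apply: nvb => P sP.
by rewrite leNgt; apply/negP => lt; apply: H; exists P.
Qed.

Lemma budget_step n s u t : budget n s t -> ~ good s u -> s <= u -> u <= t ->
  exists2 n', n = n'.+1 & budget n' u t.
Proof.
case: n => [/budget0//|n] [M1 [M2 [[M10 M20] b1 b2 lt]]] ng su ut; exists n => //.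
rewrite -natr1 mulrDl mul1r in lt.
have [g1|g1] := pselect (vb q1 A1 s u eps).
  have /not_vb[P sP eP] : ~ vb q2 A2 s u eps by move=> g2; apply: ng.
  have [M' [M'0 bM' M'E]] := vb_consume q20 ut b2 sP.
  exists M1, M'; split=> //; first exact: vb_restrict b1 su (lexx _).
  have : quantum <= eps `^ q2 by rewrite ge_min lexx orbT.
  by rewrite M'E; move: lt eP; lra.
have [P sP eP] := not_vb g1.
have [M' [M'0 bM' M'E]] := vb_consume q10 ut b1 sP.
exists M', M2; split=> //; first exact: vb_restrict b2 su (lexx _).
have : quantum <= eps `^ q1 by rewrite ge_min lexx.
by rewrite M'E; move: lt eP; lra.
Qed.

(** The partition is cut at its first point v for which [s, v] is not good: the part before costs at
    most [M], the interval ending at v at most [B], and the rest runs on a budget reduced by one. *)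
Lemma sum_local_global (f : R -> R -> R) (M B s0 t0 : R) :
  (forall u v P, s0 <= u -> v <= t0 -> good u v -> itv_partition u v P ->
     psum f u P <= M) ->
  0 <= M -> 0 <= B ->
  (forall u v, s0 <= u -> u < v -> v <= t0 -> f u v <= B) ->
  forall n s t P, s0 <= s -> t <= t0 -> budget n s t -> itv_partition s t P ->
    psum f s P <= n%:R * (M + B).
Proof.
move=> fM M0 B0 fB; elim=> [s t P _ _ /budget0//|n IH] s t P ss tt bst sP.
have Gs : `[< good s s >] by apply/asboolP; split; exact: vb_refl.
have [/asboolP|[P1 [v [P2 [PE /asboolP Pg /asboolPn Pv]]]]] :=
  @first_failure _ (fun x => `[< good s x >]) s P Gs.
  rewrite (partition_last sP) => g; apply: le_trans (fM _ _ _ ss tt g sP) _.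
  rewrite -natr1 mulrDl mul1r; apply: le_trans (_ : M <= M + B) _; first by rewrite lerDl.
  by rewrite lerDr mulr_ge0// addr_ge0.
rewrite PE in sP *; have [sP1 vP2] := partition_prefix sP.
have [lv vt vP2'] := partition_tail vP2.
have sl := itv_partition_le sP1; have lt := le_trans (ltW lv) vt.
have [n' [<-] bn] := budget_step bst Pv (le_trans sl (ltW lv)) vt.
rewrite psum_cat /= -natr1 mulrDl mul1r.
have h1 := fM _ _ _ ss (le_trans lt tt) Pg sP1.
have h2 := fB _ _ (le_trans ss sl) lv (le_trans vt tt).
have h3 := IH _ _ _ (le_trans ss (le_trans sl (ltW lv))) tt bn vP2'.
lra.
Qed.

(* [m] is the furthest point that good intervals reach from [s]; a jump at [m] is
   covered by [halfgood s m], and every interval from [s] beyond [m] is bad. *)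
Lemma path_local_global {E : normedModType R} (Y : R -> E) (D s0 t0 : R) :
  0 <= D ->
  (forall u, s0 <= u -> u < t0 -> Y @ u^'+ --> Y u) ->
  (forall u v, s0 <= u -> u < v -> v <= t0 -> halfgood u v -> `|Y v - Y u| <= D) ->
  forall n s t, s0 <= s -> s <= t -> t <= t0 -> budget n s t ->
    `|Y t - Y s| <= n%:R * D.
Proof.
move=> D0 rY YD; elim=> [s t _ _ _ /budget0//|n IH] s t ss st tt bst.
rewrite -natr1 mulrDl mul1r.
pose S := [set v | s <= v <= t /\ good s v].
have Ss : S s by split; [rewrite lexx | split; exact: vb_refl].
have Sub : has_ubound S by exists t => v [/andP[]].
set m := sup S.
have sm : s <= m by exact: ub_le_sup.
have mt : m <= t by apply: sup_le_ub; [exists s | move=> v [/andP[]]].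
have hg : halfgood s m.
  move=> w sw wm; have [|v [_ gv] wv] := sup_gt _ wm; first by exists s.
  exact: good_restrict gv (lexx _) (ltW wv).
have Ym : `|Y m - Y s| <= D.
  move: sm; rewrite le_eqVlt => /orP[/eqP<-|sm]; first by rewrite subrr normr0.
  by apply: YD => //; exact: le_trans tt.
suff Yt : `|Y t - Y m| <= n%:R * D.
  rewrite -(subrK (Y m) (Y t)) -addrA; apply: le_trans (ler_normD _ _) _.
  exact: lerD.
move: mt; rewrite le_eqVlt => /orP[/eqP->|mt]; first by rewrite subrr normr0 mulr_ge0.
(* The interval [s, m] may itself be good, so the budget is charged on [s, u] with u slightly beyond
   m; right continuity of Y bounds the passage from m to u by e. *)
apply/ler_addgt0Pr => e e0.
have [v mv vP] := (cvg_rightP _ _ _).1 (rY m (le_trans ss sm) (lt_le_trans mt tt)) _ e0.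
pose u := (m + Num.min v t) / 2.
have [mu uv ut] : [/\ m < u, u < v & u <= t].
  have := ge_min v v t; have := ge_min t v t; rewrite !lexx orbT /= => h1 h2.
  have : m < Num.min v t by rewrite lt_min mv.
  by rewrite /u; split; lra.
have su : s <= u by rewrite (le_trans sm)// ltW.
have ng : ~ good s u.
  move=> g; have : u <= m by apply: ub_le_sup => //; split=> //; rewrite su.
  by rewrite leNgt mu.
have [n' [<-] bn] := budget_step bst ng su ut.
rewrite -(subrK (Y u) (Y t)) -addrA; apply: le_trans (ler_normD _ _) _.
by apply: lerD; [exact: IH (le_trans ss su) ut tt bn | exact: vP].
Qed.

End Budget.

Section InvariantBall.
Context {R : realType} {d k : nat}.
Notation incr Y := (fun u v : R => Y v - Y u).
Variables (p T : R) (X : R -> 'rV[R]_d) (XX : R -> R -> 'M[R]_d).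
Variables (y : R -> 'rV[R]_k) (y' : R -> 'M[R]_(d, k)).
Variables
  (F : (R -> 'rV[R]_k) -> R -> 'M[R]_(d, k))
  (F' : (R -> 'rV[R]_k) -> (R -> 'M[R]_(d, k)) -> R -> 'M[R]_(d, d * k)).

Definition goodX (eps : R) : R -> R -> Prop := good p (p / 2) eps (incr X) XX.
Definition halfgoodX (eps : R) : R -> R -> Prop :=
  halfgood p (p / 2) eps (incr X) XX.

(** [M1] and [M2] apply where the rough path varies little up to and including the right end. A
    half-good interval may end with a large jump of X, across which the remainder has the separate
    bound [B0]. *)
Definition in_ball (eps A M1 M2 B0 : R) (Y : R -> 'rV[R]_k) (Y' : R -> 'M[R]_(d, k)) : Prop :=
  [/\ controlled ev1 p X T Y Y',
      forall t, 0 <= t -> t <= T -> `|Y' t| <= A,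
      forall u v, 0 <= u -> v <= T -> goodX eps u v ->
        vb p (incr Y') u v M2 /\ vb (p / 2) (remainder ev1 X Y Y') u v M1 &
      forall u v, 0 <= u -> u < v -> v <= T -> halfgoodX eps u v ->
        `|remainder ev1 X Y Y' u v| <= B0].

(** The growth conditions bound F(Y) at positive times, and right continuity extends the bound to
    time 0. The number [b] stands for a majorant of [CF] fixed before the data. *)
Lemma functional_bound (CF b : R) Y Y' : 0 < T -> CF <= b ->
  growth_conditions p T X F F' CF -> nonanticipative p T X F F' ->
  controlled ev1 p X T Y Y' ->
  forall t, 0 <= t -> t <= T -> `|F Y t| <= b.
Proof.
move=> T0 Cb growth nonant cY.
have pos t : 0 < t -> t <= T -> `|F Y t| <= b.
  move=> t0 tT; have [h _ _ _] := growth _ _ cY 0 t (lexx _) t0 tT.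
  exact: le_trans h Cb.
move=> t; rewrite le_eqVlt => /orP[/eqP<- _|]; last exact: pos.
have [[[[rF _] _] _ _] _] := nonant _ _ cY.
apply/ler_addgt0Pr => e e0.
have [|v v0 vP] := (cvg_rightP _ _ _).1 (rF 0 _) _ e0; first by rewrite lexx T0.
pose u := Num.min v T / 2.
have [u0 uv uT] : [/\ 0 < u, u < v & u <= T].
  have := ge_min v v T; have := ge_min T v T; rewrite !lexx orbT /= => h1 h2.
  have : 0 < Num.min v T by rewrite lt_min v0.
  by rewrite /u; split; lra.
rewrite -[F Y 0](subKr (F Y u)); apply: le_trans (ler_normB _ _) _.
by apply: lerD; [exact: pos | exact: vP].
Qed.

Lemma remainderD (Y I : R -> 'rV[R]_k) (Y' V : R -> 'M[R]_(d, k)) u v :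
  remainder ev1 X (fun t => Y t + I t) (fun t => Y' t + V t) u v =
  remainder ev1 X Y Y' u v + remainder ev1 X I V u v.
Proof.
by rewrite /remainder /ev1 mulmxDr; apply/rowP => j; rewrite !mxE; ring.
Qed.

Lemma ball_data (eps A M1 M2 B0 a : R) :
  2 < p -> controlled ev1 p X T y y' ->
  (forall t, 0 <= t -> t <= T -> `|y' t| <= a) ->
  vb p (incr y') 0 T a -> vb (p / 2) (remainder ev1 X y y') 0 T a ->
  0 <= a -> a <= A -> a <= M1 -> a <= M2 -> a <= B0 ->
  in_ball eps A M1 M2 B0 y y'.
Proof.
move=> p2 cy ya y'a Ra a0 aA aM1 aM2 aB0.
have [p0 p20] : 0 < p /\ 0 < p / 2 by split; lra.
split=> //.
- by move=> t t0 tT; exact: le_trans (ya t t0 tT) aA.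
- move=> u v u0 vT _; split.
    exact: vb_restrict (vb_le (ltW p0) a0 aM2 y'a) u0 vT.
  exact: vb_restrict (vb_le (ltW p20) a0 aM1 Ra) u0 vT.
- move=> u v u0 uv vT _; apply: le_trans aB0.
  exact: vb_point p20 a0 Ra u0 uv vT.
Qed.

Lemma ball_functional (eps A M1 M2 B0 b CF G u v : R) Y Y' :
  2 < p -> 0 < CF -> CF <= b -> growth_conditions p T X F F' CF ->
  0 <= A -> 0 <= M1 -> 0 <= M2 ->
  0 < eps -> eps <= 1 ->
  4 * b * (1 + (A + M2 + M1)) ^+ 2 <= G ->
  in_ball eps A M1 M2 B0 Y Y' ->
  0 <= u -> u < v -> v <= T -> goodX eps u v ->
  [/\ vb p (incr (F Y)) u v (b * (1 + (A + M2) * eps + M1)),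
      `|F' Y Y' u| <= G, vb p (incr (F' Y Y')) u v G &
      vb (p / 2) (remainder ev2 X (F Y) (F' Y Y')) u v G].
Proof.
move=> p2 C0 Cb growth A0 M10 M20 eps0 eps1 bG [cY YA Ygood _] u0 uv vT guv.
have [p0 p20] : 0 < p /\ 0 < p / 2 by split; lra.
have [g1 g2] := Ygood u v u0 vT guv; have [gX gXX] := guv.
have uT := le_trans (ltW uv) vT.
have [_ h1 h2 h3 h4] := growth_bounds p2 (ltW C0) growth cY u0 uv vT M20 (ltW eps0)
  M10 (YA u u0 uT) g1 gX g2.
set G' := CF * _ * _ in h2 h3 h4.
have K0 : 0 <= 1 + (A + M2 + M1) by rewrite !addr_ge0.
have G'0 : 0 <= G' by exact: le_trans h2.
have G'G : G' <= G.
  apply: le_trans bG; rewrite /G'.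
  (* The source of the factor 4 in the condition on [G]. *)
  have h5 : (1 + eps) ^+ 2 <= 4.
    have -> : (4 : R) = (1 + 1) ^+ 2 by ring.
    by apply: lerXn2r; rewrite ?nnegrE ?addr_ge0 ?(ltW eps0)// lerD2l.
  have h6 : 0 <= (1 + (A + M2 + M1)) ^+ 2 by exact: exprn_ge0.
  move: ((1 + (A + M2 + M1)) ^+ 2) ((1 + eps) ^+ 2) h5 h6 => Q e2 h5 h6.
  apply: (@le_trans _ _ (CF * Q * 4)).
    by apply: ler_wpM2l => //; rewrite mulr_ge0// ltW.
  rewrite mulrC mulrA; apply: ler_wpM2r => //.
  by rewrite ler_pM2l.
have y0 : 0 <= 1 + (A + M2) * eps + M1.
  by rewrite !addr_ge0// mulr_ge0 ?addr_ge0// ltW.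
split.
- apply: (vb_le (ltW p0) _ _ h1); first by rewrite mulr_ge0// ltW.
  exact: ler_wpM2r.
- exact: le_trans h2 G'G.
- exact: vb_le (ltW p0) G'0 G'G h3.
- exact: vb_le (ltW p20) G'0 G'G h4.
Qed.

(* The bound [M1] on the remainder is improved by the factor [eps] of the sewing
   estimate, whereas [M2] has to be chosen after [M1], as the growth condition
   bounds F(Y) by the remainder of Y without a small factor.  A jump at the end of
   a half-good interval is harmless, as the integral only sees F(Y) before it. *)
Lemma ball_step (eps A M1 M2 B0 a b c CF G : R) Y Y' (I : R -> 'rV[R]_k) :
  2 < p -> p < 3 -> 0 < T -> rough_path p T X XX ->
  controlled ev1 p X T y y' -> nonanticipative p T X F F' ->
  0 < CF -> CF <= b -> growth_conditions p T X F F' CF ->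
  (forall t, 0 <= t -> t <= T -> `|y' t| <= a) ->
  vb p (incr y') 0 T a -> vb (p / 2) (remainder ev1 X y y') 0 T a ->
  vb p (incr X) 0 T c -> vb (p / 2) XX 0 T c -> 0 <= c ->
  0 <= a -> a + b <= A -> 2 * (a + 1) <= M1 -> 2 * (a + b * (2 + M1)) <= M2 ->
  4 * b * (1 + (A + M2 + M1)) ^+ 2 <= G ->
  0 < eps -> eps <= 1 -> (A + M2) * eps <= 1 ->
  4 * G * (rough_const R d p + evc R d) * eps <= 1 ->
  a + (2 * rough_const R d p + evc R d) * (G * c) <= B0 ->
  in_ball eps A M1 M2 B0 Y Y' ->
  (forall t, 0 <= t -> t <= T ->
     is_rough_integral X XX (F Y) (F' Y Y') 0 t (I t)) ->
  in_ball eps A M1 M2 B0 (fun t => y t + I t) (fun t => y' t + F Y t).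
Proof.
move=> p2 p3 T0 rpX cy nonant C0 Cb growth ya y'a Ra Xc XXc c0 a0 abA aM1 aM2 GE.
move=> eps0 eps1 epsA epsG GB0 ballY VI.
have [p0 p20] : 0 < p /\ 0 < p / 2 by split; lra.
have [p1 p21] : 1 <= p /\ 1 <= p / 2 by split; lra.
have b0 := lt_le_trans C0 Cb.
have A0 : 0 <= A by apply: le_trans abA; rewrite addr_ge0// ltW.
have M10 : 0 <= M1 by apply: le_trans aM1; rewrite mulr_ge0// addr_ge0.
have M20 : 0 <= M2.
  by apply: le_trans aM2; rewrite mulr_ge0// addr_ge0// mulr_ge0 ?addr_ge0// ltW.
have G0 : 0 <= G.
  by apply: le_trans GE; rewrite mulr_ge0 ?exprn_ge0 ?addr_ge0// mulr_ge0// ltW.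
have C1 : 0 <= rough_const R d p by exact: rough_const_ge0.
have ev0 : 0 <= evc R d := le_trans ler01 evc_ge1.
have [cY _ _ _] := ballY; have [cF _] := nonant _ _ cY.
have [cX ch rXX _ _] := rough_path_facts p2 T0 rpX.
have Fb := functional_bound T0 Cb growth nonant cY.
have FG u v := ball_functional p2 C0 Cb growth A0 M10 M20 eps0 eps1 GE ballY (u:=u) (v:=v).
split.
- exact: picard_controlled rpX cy cF VI.
- move=> t t0 tT; apply: le_trans (ler_normD _ _) _; apply: le_trans abA.
  by apply: lerD; [exact: ya | exact: Fb].
- move=> u v u0 vT guv; have [uv|vu] := ltP u v; last by split; exact: vb_refl.
  have [h1 h2 h3 h4] := FG u v u0 uv vT guv; have [gX gXX] := guv.
  have FM u' : u <= u' -> u' <= v -> `|F' Y Y' u'| <= 2 * G.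
    move=> uu' u'v; have -> : 2 * G = G + G by ring.
    move: uu'; rewrite le_eqVlt => /orP[/eqP<-|uu']; first by rewrite (le_trans h2)// lerDl.
    rewrite -[F' Y Y' u'](subrKC (F' Y Y' u)); apply: le_trans (ler_normD _ _) _.
    by apply: lerD => //; exact: vb_point p0 G0 h3 (lexx _) uu' u'v.
  split.
  + apply: (vb_le (ltW p0) _ aM2).
      by rewrite mulr_ge0// addr_ge0// mulr_ge0 ?addr_ge0// ltW.
    apply: (vbD p1 a0 _ _ (vb_restrict y'a u0 vT)).
    * by rewrite mulr_ge0 ?addr_ge0// ltW.
    * by move=> w x *; rewrite opprD addrACA; exact: ler_normD.
    apply: (vb_le (ltW p0) _ _ h1).
      by rewrite mulr_ge0 ?(ltW b0)// !addr_ge0// mulr_ge0 ?addr_ge0// ltW.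
    by apply: ler_wpM2l; [exact: ltW | rewrite lerD2r -[2]/(1 + 1) lerD2l].
  + have h5 := integral_remainder_vb p2 p3 ch VI u0 vT G0 (ltW eps0) G0 (ltW eps0)
      (mulr_ge0 (ler0n R 2) G0) h4 gX h3 gXX FM.
    set r := 2 * _ in h5.
    have r1 : r <= 1.
      apply: le_trans epsG; rewrite /r le_eqVlt; apply/orP; left; apply/eqP; ring.
    have r0 : 0 <= r.
      by rewrite /r !(mulr_ge0, addr_ge0)// ltW.
    apply: (vb_le (ltW p20) _ aM1); first by rewrite mulr_ge0// addr_ge0.
    apply: (vbD p21 a0 ler01 _ (vb_restrict Ra u0 vT) (vb_le (ltW p20) r0 r1 h5)).
    by move=> w x *; rewrite remainderD; exact: ler_normD.
- move=> u v u0 uv vT hg; rewrite remainderD; apply: le_trans (ler_normD _ _) _.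
  apply: le_trans GB0; apply: lerD; first exact: vb_point p20 a0 Ra u0 uv vT.
  have h u' : u <= u' -> u' < v -> [/\ `|F' Y Y' u| <= G, vb p (incr (F' Y Y')) u u' G &
      vb (p / 2) (remainder ev2 X (F Y) (F' Y Y')) u u' G].
    (* A midpoint, as [u, u'] may be degenerate whereas the growth conditions ask for a proper
       interval. *)
    move=> uu' u'v; pose w := (u' + v) / 2.
    have [uw wv u'w] : [/\ u < w, w < v & u' <= w] by rewrite /w; split; lra.
    have [_ h2 h3 h4] := FG u w u0 uw (le_trans (ltW wv) vT) (hg w (ltW uw) wv).
    by split=> //; [exact: vb_restrict h3 (lexx _) u'w|exact: vb_restrict h4 (lexx _) u'w].
  have [hG _ _] := h u (lexx _) uv.
  (* X and XX may jump at v, so that only their global bound [c] is available on the closed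
     interval; hence [c] in the condition on [B0]. *)
  have := integral_remainder_point p2 p3 ch VI u0 uv vT G0 c0 G0 c0
    (fun w uw wv => let: And3 _ _ e := h w uw wv in e) (vb_restrict Xc u0 vT)
    (fun w uw wv => let: And3 _ e _ := h w uw wv in e) (vb_restrict XXc u0 vT) hG.
  move=> /le_trans; apply; rewrite le_eqVlt; apply/orP; left; apply/eqP; ring.
Qed.

(** The good pieces contribute [M2] and [M1], and the intervals between them the crude bounds
    [2 * A] for Y' and [D] for the remainder. In [D], the first term bounds an increment of Y by
    [path_local_global], the second the product Y'X. *)
Lemma ball_bounds (eps A M1 M2 B0 c : R) n Y Y' :
  2 < p -> 0 < T -> rough_path p T X XX ->
  vb p (incr X) 0 T c -> vb (p / 2) XX 0 T c -> 0 <= c ->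
  0 < eps -> 0 <= A -> 0 <= M1 -> 0 <= M2 -> 0 <= B0 ->
  c `^ p + c `^ (p / 2) < n%:R * quantum p (p / 2) eps ->
  in_ball eps A M1 M2 B0 Y Y' ->
  let D := n%:R * (B0 + evc R d * (A * c)) + evc R d * (A * c) in
  vb p (incr Y') 0 T ((n%:R * (M2 `^ p + (2 * A) `^ p)) `^ p^-1) /\
  vb (p / 2) (remainder ev1 X Y Y') 0 T
    ((n%:R * (M1 `^ (p / 2) + D `^ (p / 2))) `^ (p / 2)^-1).
Proof.
move=> p2 T0 rpX Xc XXc c0 eps0 A0 M10 M20 B00 nE [cY YA Ygood Yhalf] D.
have [p0 p20] : 0 < p /\ 0 < p / 2 by split; lra.
have ev0 : 0 <= evc R d := le_trans ler01 evc_ge1.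
have eAc0 : 0 <= evc R d * (A * c) by rewrite !mulr_ge0.
have D1 : 0 <= B0 + evc R d * (A * c) by rewrite addr_ge0.
have D0 : 0 <= D by rewrite /D addr_ge0// mulr_ge0.
have bud : budget p (p / 2) eps (incr X) XX n 0 T by exists c, c; split.
have [[rY lY] _ _ _] := controlled_facts p2 T0 cY.
have powK q z : 0 < q -> 0 <= z -> (z `^ q^-1) `^ q = z.
  by move=> q0 z0; rewrite -powRrM mulVf ?powRr1// gt_eqF.
have YX u v : 0 <= u -> u < v -> v <= T -> `|ev1 (Y' u) (X v - X u)| <= evc R d * (A * c).
  move=> u0 uv vT; apply: le_trans (ev1_norm_le _ _) _; apply: ler_wpM2l => //.
  apply: ler_pM => //; first by apply: YA => //; exact: le_trans (ltW uv) vT.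
  exact: vb_point p0 c0 Xc u0 uv vT.
have Yincr u v : 0 <= u -> u < v -> v <= T -> `|Y v - Y u| <= n%:R * (B0 + evc R d * (A * c)).
  move=> u0 uv vT.
  have bud' : budget p (p / 2) eps (incr X) XX n u v.
    exists c, c; split=> //; [exact: vb_restrict Xc u0 vT|exact: vb_restrict XXc u0 vT].
  apply: (path_local_global p0 p20 D1 _ _ u0 (ltW uv) vT bud').
  + by move=> w w0 wT; apply: rY; rewrite w0.
  + move=> w x w0 wx xT hg; rewrite -(subrK (ev1 (Y' w) (X x - X w)) (Y x - Y w)).
    apply: le_trans (ler_normD _ _) _; apply: lerD; last exact: YX.
    exact: Yhalf.
split=> P sP.
- rewrite powK ?mulr_ge0 ?addr_ge0 ?powR_ge0//.
  apply: (sum_local_global p0 p20 _ _ _ _ (lexx 0) (lexx T) bud sP); rewrite ?powR_ge0//.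
  + by move=> u v Q u0 vT guv uQ; have [g _] := Ygood u v u0 vT guv; exact: g.
  + move=> u v u0 uv vT; apply: ge0_ler_powR; rewrite ?nnegrE ?mulr_ge0 ?(ltW p0)//.
    apply: le_trans (ler_normB _ _) _; have -> : 2 * A = A + A by ring.
    by apply: lerD; apply: YA => //; [exact: le_trans (ltW uv)|exact: le_trans (ltW uv) vT].
- rewrite powK ?mulr_ge0 ?addr_ge0 ?powR_ge0//.
  apply: (sum_local_global p0 p20 _ _ _ _ (lexx 0) (lexx T) bud sP); rewrite ?powR_ge0//.
  + by move=> u v Q u0 vT guv uQ; have [_ g] := Ygood u v u0 vT guv; exact: g.
  + move=> u v u0 uv vT; apply: ge0_ler_powR; rewrite ?nnegrE ?(ltW p20)//.
    apply: le_trans (ler_normB _ _) _.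
    by apply: lerD; [exact: Yincr | exact: YX].
Qed.

End InvariantBall.

(** * Contraction *)

Section Picard.
Context {R : realType} {d k : nat}.
Notation incr Y := (fun u v : R => Y v - Y u).
Variables (p T : R) (X : R -> 'rV[R]_d) (XX : R -> R -> 'M[R]_d).
Variables (y : R -> 'rV[R]_k) (y' : R -> 'M[R]_(d, k)).
Variables
  (F : (R -> 'rV[R]_k) -> R -> 'M[R]_(d, k))
  (F' : (R -> 'rV[R]_k) -> (R -> 'M[R]_(d, k)) -> R -> 'M[R]_(d, d * k)).

(** A relation, since the integral is only specified as a limit; solutions are the controlled pairs
    related to themselves ([solution_picard]). *)
Definition picard (Y : R -> 'rV[R]_k) (Y' : R -> 'M[R]_(d, k))
    (U : R -> 'rV[R]_k) (U' : R -> 'M[R]_(d, k)) : Prop :=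
  forall t, 0 <= t -> t <= T -> U' t = y' t + F Y t /\
    exists2 I, is_rough_integral X XX (F Y) (F' Y Y') 0 t I & U t = y t + I.

Definition rdiff (Y : R -> 'rV[R]_k) (Y' : R -> 'M[R]_(d, k))
    (Z : R -> 'rV[R]_k) (Z' : R -> 'M[R]_(d, k)) (u v : R) :=
  remainder ev1 X Y Y' u v - remainder ev1 X Z Z' u v.

Lemma rdiffE (Y Z : R -> 'rV[R]_k) (Y' Z' : R -> 'M[R]_(d, k)) u v :
  rdiff Y Y' Z Z' u v =
  remainder ev1 X (fun t => Y t - Z t) (fun t => Y' t - Z' t) u v.
Proof.
by rewrite /rdiff /remainder ev1Bl; apply/rowP => j; rewrite !mxE; ring.
Qed.

Lemma remainder2B (V W : R -> 'M[R]_(d, k)) (V' W' : R -> 'M[R]_(d, d * k)) u v :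
  remainder ev2 X V V' u v - remainder ev2 X W W' u v =
  remainder ev2 X (fun t => V t - W t) (fun t => V' t - W' t) u v.
Proof.
by rewrite /remainder ev2Bl; apply/matrixP => i j; rewrite !mxE; ring.
Qed.

Lemma picard_diff_integral Y Y' U U' Z Z' W W' :
  picard Y Y' U U' -> picard Z Z' W W' ->
  forall t, 0 <= t -> t <= T ->
    is_rough_integral X XX (fun u => F Y u - F Z u)
      (fun u => F' Y Y' u - F' Z Z' u) 0 t (U t - W t).
Proof.
move=> PY PZ t t0 tT; have [_ [I HI ->]] := PY t t0 tT.
have [_ [J HJ ->]] := PZ t t0 tT.
have -> : y t + I - (y t + J) = I - J by apply/rowP => j; rewrite !mxE; ring.
exact: is_rough_integralB.
Qed.

Lemma picard_diff_remainder Y Y' U U' Z Z' W W' u v :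
  picard Y Y' U U' -> picard Z Z' W W' -> 0 <= u -> u <= T ->
  rdiff U U' W W' u v =
  remainder ev1 X (fun t => U t - W t) (fun t => F Y t - F Z t) u v.
Proof.
move=> PY PZ u0 uT; have [U'E _] := PY u u0 uT; have [W'E _] := PZ u u0 uT.
rewrite rdiffE /remainder U'E W'E; congr (_ - ev1 _ _).
by apply/matrixP => i j; rewrite !mxE; ring.
Qed.

Lemma picard_diff_deriv Y Y' U U' Z Z' W W' t :
  picard Y Y' U U' -> picard Z Z' W W' -> 0 <= t -> t <= T ->
  U' t - W' t = F Y t - F Z t.
Proof.
move=> PY PZ t0 tT; have [-> _] := PY t t0 tT; have [-> _] := PZ t t0 tT.
by apply/matrixP => i j; rewrite !mxE; ring.
Qed.

(* The derivatives get the weight [8 * L], since no small factor multiplies the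
   remainder of Y - Z in the Lipschitz bound for F(Y) - F(Z). *)
Lemma picard_contraction (K L e D del s w : R) Y Y' U U' Z Z' W W' :
  2 < p -> p < 3 -> chen X XX 0 T -> 1 <= L ->
  lipschitz_conditions p T X F F' K L ->
  controlled ev1 p X T Y Y' -> controlled ev1 p X T Z Z' ->
  picard Y Y' U U' -> picard Z Z' W W' ->
  0 <= s -> s < w -> w <= T ->
  (cnorm ev1 p X Y Y' s w <= K%:E)%E -> (cnorm ev1 p X Z Z' s w <= K%:E)%E ->
  0 < del -> 8 * L * evc R d * del <= 1 ->
  8 * (rough_const R d p + evc R d) * L * (8 * L + 1) * del <= 1 ->
  vb p (incr X) s w del -> vb (p / 2) XX s w del ->
  0 <= e -> 0 <= D -> `|Y s - Z s| <= e -> `|Y' s - Z' s| <= e ->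
  vb p (incr (fun u => Y' u - Z' u)) s w (8 * L * D) ->
  vb (p / 2) (rdiff Y Y' Z Z') s w D ->
  vb p (incr (fun u => U' u - W' u)) s w (8 * L * (D / 2 + e)) /\
  vb (p / 2) (rdiff U U' W W') s w (D / 2 + e).
Proof.
move=> p2 p3 ch L1 lip cY cZ PY PZ s0 sw wT nY nZ del0 dL dC Xd XXd e0 D0.
move=> Ys Y's Y'D RD.
have [p0 p20] : 0 < p /\ 0 < p / 2 by split; lra.
have ev0 : 0 <= evc R d := le_trans ler01 evc_ge1.
have C0 : 0 <= rough_const R d p by exact: rough_const_ge0.
have L0 : 0 <= L by lra.
have LD0 : 0 <= 8 * L * D by rewrite !mulr_ge0.
have sT := le_trans (ltW sw) wT.
have [g1 g2 g3 g4] := lipschitz_bounds p2 L0 lip cY cZ s0 sw wT nY nZ LD0 D0 Ys Y's Y'D RD.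
set H := L * (e + (e + 8 * L * D + D)) in g1 g2 g3.
have H0 : 0 <= H by rewrite /H !(mulr_ge0, addr_ge0).
have dYm u : s <= u -> u < w -> `|Y' u - Z' u| <= e + 8 * L * D.
  rewrite le_eqVlt => /orP[/eqP<- _|su uw]; first by rewrite (le_trans Y's)// lerDl.
  have := vb_point p0 LD0 Y'D (lexx _) su (ltW uw) => h.
  rewrite -[Y' u - Z' u](subrKC (Y' s - Z' s)).
  by apply: le_trans (ler_normD _ _) _; exact: lerD.
have dY : vb p (incr (fun u => Y u - Z u)) s w
    (2 * (evc R d * (e + 8 * L * D) * del + D)).
  apply: (path_vb p2 _ D0 (ltW del0) dYm Xd); first by rewrite addr_ge0.
  by apply: vb_eq RD => u v *; exact: rdiffE.
have dF := g4 _ _ dY.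
split.
- apply: (@vb_eq _ _ _ (incr (fun u => F Y u - F Z u))).
    move=> u v su uv vw; have u0 := le_trans s0 su.
    have vT := le_trans vw wT.
    rewrite (picard_diff_deriv PY PZ (le_trans u0 (ltW uv)) vT).
    by rewrite (picard_diff_deriv PY PZ u0 (le_trans (ltW uv) vT)).
  apply: vb_le (dF _); first exact: ltW.
  + by rewrite !(mulr_ge0, addr_ge0)// ltW.
  (* For small [del] this is at most (L + 1/4) e + 2 L D + 2 L D. The remainder and the damped
     derivative use up equal shares of 8 L (D/2). *)
  + have -> : L * (e + 2 * (evc R d * (e + 8 * L * D) * del + D)) =
      L * e + (8 * L * evc R d * del) * ((e + 8 * L * D) / 4) + 2 * (L * D) by field.
    have h1 : 0 <= (e + 8 * L * D) / 4 by rewrite divr_ge0 ?addr_ge0.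
    have h2 := ler_wpM2r h1 dL; rewrite mul1r in h2.
    apply: le_trans (lerD (lerD (lexx _) h2) (lexx _)) _.
    have h3 : e <= L * e by rewrite ler_peMl.
    have h4 : 0 <= L * e by exact: mulr_ge0.
    have h5 : 0 <= L * D by exact: mulr_ge0.
    by rewrite !mulrDr !mulrDl -!mulrA; lra.
  + by rewrite mulr_ge0// addr_ge0// !(mulr_ge0, addr_ge0)// ltW.
- apply: (@vb_eq _ _ _ (remainder ev1 X (fun t => U t - W t) (fun t => F Y t - F Z t))).
    move=> u v su uv vw; apply/esym/(picard_diff_remainder _ PY PZ).
      exact: le_trans su.
    exact: le_trans (ltW uv) (le_trans vw wT).
  have g1' u : s <= u -> u <= w -> `|F' Y Y' u - F' Z Z' u| <= 2 * H.
    have -> : 2 * H = H + H by ring.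
    rewrite le_eqVlt => /orP[/eqP<- _|su uw]; first by rewrite (le_trans g1)// lerDl.
    have := vb_point p0 H0 g2 (lexx _) su uw => h.
    rewrite -[F' Y Y' u - _](subrKC (F' Y Y' s - F' Z Z' s)).
    by apply: le_trans (ler_normD _ _) _; exact: lerD.
  have g3' : vb (p / 2) (remainder ev2 X (fun t => F Y t - F Z t)
      (fun t => F' Y Y' t - F' Z Z' t)) s w H.
    by apply: vb_eq g3 => u v *; exact: remainder2B.
  have h := integral_remainder_vb p2 p3 ch (picard_diff_integral PY PZ) s0 wT
    H0 (ltW del0) H0 (ltW del0) (mulr_ge0 (ler0n R 2) H0) g3' Xd g2 XXd g1'.
  apply: vb_le h; first exact: ltW.
    by rewrite !(mulr_ge0, addr_ge0)// ltW.
  set C := rough_const _ _ _ in C0 dC *; set c := evc R d in ev0 dC *.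
  have -> : 2 * (C * (H * del + H * del) + c * (2 * H * del)) =
    4 * (C + c) * L * del * (2 * e + (8 * L + 1) * D) by rewrite /H; ring.
  (* The smallness condition becomes 2 q (8 L + 1) <= 1, which yields both q (8 L + 1) D <= D/2 and
     2 q e <= e. *)
  set q := 4 * (C + c) * L * del.
  have q0 : 0 <= q by rewrite /q !(mulr_ge0, addr_ge0)// ltW.
  have {}dC : 2 * q * (8 * L + 1) <= 1.
    by apply: le_trans dC; rewrite /q le_eqVlt; apply/orP; left; apply/eqP; ring.
  move: q q0 dC => q q0 dC.
  have qL0 : 0 <= q * L by exact: mulr_ge0.
  have q1 : 2 * q <= 1 by lra.
  have h1 := ler_wpM2r D0 dC; have h2 := ler_wpM2r e0 q1.
  lra.
Qed.

End Picard.

(** * Comparison of two Picard sequences on the whole interval *)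

Section InitialValue.
Context {R : realType} {d k : nat}.
Variables (p T : R) (X : R -> 'rV[R]_d).
Variables
  (F : (R -> 'rV[R]_k) -> R -> 'M[R]_(d, k))
  (F' : (R -> 'rV[R]_k) -> (R -> 'M[R]_(d, k)) -> R -> 'M[R]_(d, d * k)).

Lemma functional_at0 (Y Z : R -> 'rV[R]_k) (Y' Z' : R -> 'M[R]_(d, k)) :
  0 < T -> on_interval T F F' -> nonanticipative p T X F F' ->
  controlled ev1 p X T Y Y' -> controlled ev1 p X T Z Z' ->
  Y 0 = Z 0 -> F Y 0 = F Z 0.
Proof.
move=> T0 onint nonant cY cZ YZ0.
have T00 : (0 : R) <= 0 <= T by apply/andP; split=> //; exact: ltW.
have [_ /(_ _ T00)[-> _]] := nonant _ _ cY.
have [_ /(_ _ T00)[-> _]] := nonant _ _ cZ.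
(* The stopped paths equal the common initial value on [0, T] but may differ at negative times,
   hence the appeal to [on_interval]. *)
have agree t : 0 <= t <= T -> stopped 0 Y t = stopped 0 Z t.
  by move=> /andP[t0 _]; rewrite /stopped min_r.
by have [-> _] := onint _ _ _ _ agree (fun (t : R) _ => erefl (Y' t)) _ T00.
Qed.

End InitialValue.

(* Equal sequences Y = Z give the convergence of the Picard iteration, constant
   sequences give the uniqueness of the solution. *)
Section PicardSequences.
Context {R : realType} {d k : nat}.
Notation incr Y := (fun u v : R => Y v - Y u).
Variables (p T : R) (X : R -> 'rV[R]_d) (XX : R -> R -> 'M[R]_d).
Variables (y : R -> 'rV[R]_k) (y' : R -> 'M[R]_(d, k)).
Variables
  (F : (R -> 'rV[R]_k) -> R -> 'M[R]_(d, k))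
  (F' : (R -> 'rV[R]_k) -> (R -> 'M[R]_(d, k)) -> R -> 'M[R]_(d, d * k)).
Variables (Y Z : nat -> R -> 'rV[R]_k) (Y' Z' : nat -> R -> 'M[R]_(d, k)).
Variables (K L c : R).
Hypotheses (p2 : 2 < p) (p3 : p < 3) (T0 : 0 < T) (rpX : rough_path p T X XX).
Hypotheses (c0 : 0 <= c) (Xc : vb p (incr X) 0 T c) (XXc : vb (p / 2) XX 0 T c).
Hypotheses (K0 : 0 <= K) (L1 : 1 <= L) (lip : lipschitz_conditions p T X F F' K L).
Hypotheses (onint : on_interval T F F') (nonant : nonanticipative p T X F F').
Hypotheses (cY : forall n, controlled ev1 p X T (Y n) (Y' n))
  (cZ : forall n, controlled ev1 p X T (Z n) (Z' n)).
Hypotheses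
  (nY : forall n s t, 0 <= s -> s < t -> t <= T ->
     (cnorm ev1 p X (Y n) (Y' n) s t <= K%:E)%E)
  (nZ : forall n s t, 0 <= s -> s < t -> t <= T ->
     (cnorm ev1 p X (Z n) (Z' n) s t <= K%:E)%E).
Hypotheses
  (pY : forall n, picard T X XX y y' F F' (Y n) (Y' n) (Y n.+1) (Y' n.+1))
  (pZ : forall n, picard T X XX y y' F F' (Z n) (Z' n) (Z n.+1) (Z' n.+1)).
Hypothesis YZ0 : forall n m, Y n 0 = Z m 0.

(** The independent indices make this a Cauchy property when Y = Z. Values at time 0 are left out,
    as they agree by [YZ0] and [deriv_at0]. *)
Definition close_upto (e : R) N t : Prop := forall n m, (N <= n)%N -> (N <= m)%N ->
  vb p (incr (fun u => Y' n u - Z' m u)) 0 t e /\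
  vb (p / 2) (rdiff X (Y n) (Y' n) (Z m) (Z' m)) 0 t e.

(** Initial derivatives agree after one Picard step, when they are y'(0) plus a function of the
    initial value; this is the origin of the index [N.+1] below. *)
Lemma deriv_at0 n m : Y' n.+1 0 - Z' m.+1 0 = 0.
Proof.
have [-> _] := pY n (lexx 0) (ltW T0); have [-> _] := pZ m (lexx 0) (ltW T0).
by rewrite (functional_at0 T0 onint nonant (cY n) (cZ m) (YZ0 n m)) subrr.
Qed.

Lemma close_deriv e N t n m u : 0 <= e -> close_upto e N.+1 t ->
  (N < n)%N -> (N < m)%N -> 0 <= u -> u <= t -> `|Y' n u - Z' m u| <= e.
Proof.
move=> e0 cl; case: n => // n; case: m => // m Nn Nm.
rewrite le_eqVlt => /orP[/eqP<- _|u0 ut]; first by rewrite deriv_at0 normr0.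
have [h _] := cl n.+1 m.+1 Nn Nm.
have := vb_point (lt_trans (ltr0n R 2) p2) e0 h (lexx _) u0 ut.
by rewrite deriv_at0 subr0.
Qed.

Lemma close_path e N t n m : 0 <= e -> t <= T -> close_upto e N.+1 t ->
  (N < n)%N -> (N < m)%N ->
  vb p (incr (fun u => Y n u - Z m u)) 0 t (2 * (evc R d * e * c + e)).
Proof.
move=> e0 tT cl Nn Nm; have [_ h] := cl n m Nn Nm.
apply: (path_vb p2 e0 e0 c0 _ (vb_restrict Xc (lexx _) tT)).
  by move=> u u0 ut; exact: (close_deriv e0 cl Nn Nm u0 (ltW ut)).
by apply: vb_eq h => u v *; exact: rdiffE.
Qed.

(** The differences start from the crude bound 4 K and are halved at each step, up to an error [e2]
    for the differences at time s. The bounds are uniform in w < v, hence so is the number of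
    iterations. *)
Lemma local_contraction (del s v : R) : 0 < del ->
  8 * L * evc R d * del <= 1 ->
  8 * (rough_const R d p + evc R d) * L * (8 * L + 1) * del <= 1 ->
  0 <= s -> s < v -> v <= T ->
  (forall w, s <= w -> w < v -> vb p (incr X) s w del /\ vb (p / 2) XX s w del) ->
  (forall e, 0 < e -> exists N, close_upto e N s) ->
  forall e, 0 < e -> exists N, forall w n m, s <= w -> w < v ->
    (N <= n)%N -> (N <= m)%N ->
    vb p (incr (fun u => Y' n u - Z' m u)) s w e /\
    vb (p / 2) (rdiff X (Y n) (Y' n) (Z m) (Z' m)) s w e.
Proof.
move=> del0 dL dC s0 sv vT small Ps e e0.
have ev0 : 0 <= evc R d := le_trans ler01 evc_ge1.
have [p0 p20] : 0 < p /\ 0 < p / 2 by have := p2; split; lra.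
have [p1 p21] : 1 <= p /\ 1 <= p / 2 by have := p2; split; lra.
have L0 : 0 < L by exact: lt_le_trans L1.
have [_ ch _ _ _] := rough_path_facts p2 T0 rpX.
(* The loss in passing from close derivatives and remainders to close paths, as in [close_path]. *)
pose kap := 2 * (evc R d * c + 1).
have kap1 : 1 <= kap.
  have := mulr_ge0 ev0 c0; rewrite /kap; lra.
have kap0 : 0 < kap by exact: lt_le_trans kap1.
pose e2 := e / (32 * L).
have e20 : 0 < e2 by rewrite divr_gt0// mulr_gt0.
have [N HN] := Ps (e2 / kap) (divr_gt0 e20 kap0).
have e10 : 0 <= e2 / kap by rewrite divr_ge0 ?ltW.
have e1e2 : e2 / kap <= e2 by rewrite ler_pdivrMr// ler_peMr// ltW.
have {}HN : close_upto (e2 / kap) N.+1 s.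
  by move=> n m Nn Nm; apply: HN; exact: ltnW.
have sT : s <= T := ltW (lt_le_trans sv vT).
have init' n m : (N < n)%N -> (N < m)%N -> `|Y' n s - Z' m s| <= e2.
  by move=> Nn Nm; apply: le_trans e1e2; exact: (close_deriv e10 HN Nn Nm).
have init n m : (N < n)%N -> (N < m)%N -> `|Y n s - Z m s| <= e2.
  move=> Nn Nm; have /orP[/eqP s00|s_gt0] : (0 == s) || (0 < s) by rewrite -le_eqVlt.
    by rewrite -s00 (YZ0 n m) subrr normr0 ltW.
  have h := close_path e10 sT HN Nn Nm.
  have h0 : 0 <= 2 * (evc R d * (e2 / kap) * c + e2 / kap).
    by apply: mulr_ge0 => //; apply: addr_ge0 => //; apply: mulr_ge0 => //; exact: mulr_ge0.
  have := vb_point p0 h0 h (lexx _) s_gt0 (lexx _); rewrite (YZ0 n m) subrr subr0.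
  move=> /le_trans; apply; rewrite le_eqVlt; apply/orP; left; apply/eqP.
  have : kap * (e2 / kap) = e2 by rewrite mulrC divfK// gt_eqF.
  by rewrite {1}/kap; move: (e2 / kap) => q <-; ring.
(* The solution of D_{j+1} = D_j / 2 + e2 that starts above 4 K. Its limit 2 e2, weighted by 8 L, is
   e/2 by the choice of [e2]. *)
pose D j := 4 * K / 2 ^+ j + 2 * e2.
have D_ge0 j : 0 <= D j.
  apply: addr_ge0; last by rewrite mulr_ge0// ltW.
  by apply: divr_ge0; [exact: mulr_ge0 | exact: exprn_ge0].
have claim j n m w : (N < n)%N -> (N < m)%N -> s < w -> w < v ->
    vb p (incr (fun u => Y' (n + j)%N u - Z' (m + j)%N u)) s w (8 * L * D j) /\
    vb (p / 2) (rdiff X (Y (n + j)) (Y' (n + j)) (Z (m + j)) (Z' (m + j))) s w (D j).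
  move=> Nn Nm sw wv; have wT := le_trans (ltW wv) vT.
  elim: j => [|j [IH1 IH2]].
    rewrite !addn0 /D expr0 divr1.
    have [_ _ Y1 Y2] := cnorm_le p2 (ltW sw) (nY n s0 sw wT).
    have [_ _ Z1 Z2] := cnorm_le p2 (ltW sw) (nZ m s0 sw wT).
    have K4 : 2 * (K + K) = 4 * K by ring.
    have K40 : 0 <= 4 * K by rewrite mulr_ge0.
    have KD : 4 * K <= 4 * K + 2 * e2 by rewrite lerDl mulr_ge0// ltW.
    have KD8 : 4 * K <= 8 * L * (4 * K + 2 * e2).
      apply: (le_trans KD); apply: ler_peMl; first exact: le_trans KD.
      by have := L1; lra.
    split.
    - apply: (vb_le (ltW p0) K40 KD8); rewrite -K4.
      apply: (vbD p1 K0 K0 _ Y1 Z1) => a b *.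
      have -> : Y' n b - Z' m b - (Y' n a - Z' m a) = (Y' n b - Y' n a) - (Z' m b - Z' m a).
        by apply/matrixP => ? ?; rewrite !mxE; ring.
      exact: ler_normB.
    - apply: (vb_le (ltW p20) K40 KD); rewrite -K4.
      by apply: (vbD p21 K0 K0 _ Y2 Z2) => a b *; exact: ler_normB.
  have [Xd XXd] := small w (ltW sw) wv.
  have D_eq : D j / 2 + e2 = D j.+1.
    by rewrite /D exprS; field; rewrite expf_neq0.
  rewrite !addnS -D_eq.
  apply: (picard_contraction p2 p3 ch L1 lip (cY _) (cZ _) (pY _) (pZ _) s0 sw wT
    (nY _ s0 sw wT) (nZ _ s0 sw wT) del0 dL dC Xd XXd (ltW e20) (D_ge0 j) _ _ IH1 IH2).
  - by apply: init; apply: (leq_trans _ (leq_addr _ _)).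
  - by apply: init'; apply: (leq_trans _ (leq_addr _ _)).
(* Then 2^j >= 64 L K / e, which brings the transient part 32 L K / 2^j below e/2. *)
pose j := (Num.truncn (64 * L * K / e)).+1.
have jD : 8 * L * D j <= e.
  have h1 : 64 * L * K / e <= 2 ^+ j.
    apply: le_trans (ltW (truncnS_gt _)) _.
    by rewrite -natrX ler_nat ltnW// ltn_expl.
  have h2 : 0 < 2 ^+ j :> R by exact: exprn_gt0.
  have h3 : 64 * L * K / 2 ^+ j <= e.
    by move: h1; rewrite !ler_pdivrMr// [_ ^+ _ * e]mulrC.
  have -> : 8 * L * D j = (64 * L * K / 2 ^+ j) / 2 + e / 2.
    rewrite /D /e2; move: (2 ^+ j : R) h2 => q q0.
    by field; rewrite !gt_eqF.
  lra.
exists (N.+1 + j)%N => w n m sw wv Nn Nm.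
move: sw; rewrite le_eqVlt => /orP[/eqP<-|sw]; first by split; exact: vb_refl.
have -> : n = (n - j + j)%N by rewrite subnK// (leq_trans _ Nn)// leq_addl.
have -> : m = (m - j + j)%N by rewrite subnK// (leq_trans _ Nm)// leq_addl.
have [||h1 h2] := @claim j (n - j)%N (m - j)%N w _ _ sw wv.
- by rewrite leq_subRL ?(leq_trans _ Nn)// ?leq_addl// addnC.
- by rewrite leq_subRL ?(leq_trans _ Nm)// ?leq_addl// addnC.
have De : D j <= e.
  by apply: le_trans jD; apply: ler_peMl => //; have := L1; lra.
split; first by apply: vb_le h1 => //; rewrite ?mulr_ge0 ?(ltW p0) ?(ltW L0).
exact: vb_le (ltW p20) (D_ge0 j) De h2.
Qed.

Lemma close_restrict e N t u : u <= t -> close_upto e N t -> close_upto e N u.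
Proof.
move=> ut cl n m Nn Nm; have [h1 h2] := cl n m Nn Nm.
by split; [exact: vb_restrict h1 (lexx _) ut | exact: vb_restrict h2 (lexx _) ut].
Qed.

(** For x < s < z the remainders satisfy R_{x,z} = R_{x,s} + R_{s,z} + (Y'_s - Y'_x) X_{s,z}; the
    last term accounts for [evc R d * c], and 4 counts the two pieces and the two differences across
    s. *)
Lemma close_glue e N s v : 0 <= e -> 0 <= s -> v <= T ->
  close_upto e N.+1 s ->
  (forall w n m, s <= w -> w < v -> (N < n)%N -> (N < m)%N ->
    vb p (incr (fun u => Y' n u - Z' m u)) s w e /\
    vb (p / 2) (rdiff X (Y n) (Y' n) (Z m) (Z' m)) s w e) ->
  forall w, s <= w -> w < v -> close_upto ((4 + evc R d * c) * e) N.+1 w.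
Proof.
move=> e0 s0 vT cl loc w sw wv n m Nn Nm.
have ev0 : 0 <= evc R d := le_trans ler01 evc_ge1.
have [p0 p20] : 0 < p /\ 0 < p / 2 by have := p2; split; lra.
have [p1 p21] : 1 <= p /\ 1 <= p / 2 by have := p2; split; lra.
have [h1 h2] := cl n m Nn Nm; have [l1 l2] := loc w n m sw wv Nn Nm.
have sT : s <= T by apply: le_trans sw _; exact: le_trans (ltW wv) vT.
have wT : w <= T := le_trans (ltW wv) vT.
have ce0 : 0 <= evc R d * c * e by rewrite !mulr_ge0.
have cl_deriv u : 0 <= u -> u <= s -> `|Y' n u - Z' m u| <= e.
  exact: (close_deriv e0 cl Nn Nm).
split.
- apply: (@vb_le _ _ _ _ _ _ (e + e + 2 * e)).
  + exact: ltW.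
  + by rewrite !(addr_ge0, mulr_ge0).
  + by move: ce0; rewrite mulrDl; lra.
  apply: (vb_glue p1 e0 e0 _ s0 sw h1 l1); first by rewrite mulr_ge0.
  move=> x z x0 xs sz zw.
  have hz := vb_point p0 e0 l1 (lexx _) sz zw.
  have hx := vb_point p0 e0 h1 x0 xs (lexx _).
  have -> : Y' n z - Z' m z - (Y' n x - Z' m x) =
      (Y' n z - Z' m z - (Y' n s - Z' m s)) + (Y' n s - Z' m s - (Y' n x - Z' m x)).
    by apply/matrixP => ? ?; rewrite !mxE; ring.
  by apply: le_trans (ler_normD _ _) _; lra.
- apply: (@vb_le _ _ _ _ _ _ (e + e + (2 * e + evc R d * c * e))).
  + exact: ltW.
  + by rewrite !(addr_ge0, mulr_ge0).
  + by rewrite mulrDl; lra.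
  apply: (vb_glue p21 e0 e0 _ s0 sw h2 l2); first by rewrite addr_ge0// mulr_ge0.
  move=> x z x0 xs sz zw.
  have hz := vb_point p20 e0 l2 (lexx _) sz zw.
  have hx := vb_point p20 e0 h2 x0 xs (lexx _).
  have hs := vb_point p0 e0 h1 x0 xs (lexx _).
  have hX := vb_point p0 c0 Xc s0 sz (le_trans zw wT).
  have -> : rdiff X (Y n) (Y' n) (Z m) (Z' m) x z =
      rdiff X (Y n) (Y' n) (Z m) (Z' m) x s + rdiff X (Y n) (Y' n) (Z m) (Z' m) s z +
      ev1 ((Y' n s - Z' m s) - (Y' n x - Z' m x)) (X z - X s).
    by rewrite !rdiffE /remainder !ev1Br !ev1Bl; apply/rowP => ?; rewrite !mxE; ring.
  apply: le_trans (ler_normD _ _) _.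
  have h3 := ler_normD (rdiff X (Y n) (Y' n) (Z m) (Z' m) x s)
    (rdiff X (Y n) (Y' n) (Z m) (Z' m) s z).
  have h4 : `|ev1 ((Y' n s - Z' m s) - (Y' n x - Z' m x)) (X z - X s)| <= evc R d * c * e.
    apply: le_trans (ev1_norm_le _ _) _; rewrite -mulrA; apply: ler_wpM2l => //.
    by rewrite mulrC; exact: ler_pM.
  by move: h3 h4 hx hz; lra.
Qed.

(* The jump at [v] of an iterate depends on the previous iterate before [v] only,
   whence the shift of the index. *)
Lemma close_endpoint e N v : 0 <= e -> 0 < v -> v <= T ->
  (forall w, 0 <= w -> w < v -> close_upto e N.+1 w) ->
  close_upto (2 * L * (evc R d * c + 1 + 4 * (rough_const R d p + evc R d) * c * L) * e)
    N.+3 v.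
Proof.
move=> e0 v0 vT cl.
have ev0 : 0 <= evc R d := le_trans ler01 evc_ge1.
have [p0 p20] : 0 < p /\ 0 < p / 2 by have := p2; split; lra.
have [p1 p21] : 1 <= p /\ 1 <= p / 2 by have := p2; split; lra.
have L0 : 0 <= L by exact: le_trans L1.
have C0 : 0 <= rough_const R d p by exact: rough_const_ge0.
have [_ ch _ _ _] := rough_path_facts p2 T0 rpX.
pose e5 := 4 * (rough_const R d p + evc R d) * c * L * e.
have e50 : 0 <= e5 by rewrite /e5 !(mulr_ge0, addr_ge0).
have cl_deriv n m u : (N < n)%N -> (N < m)%N -> 0 <= u -> u < v ->
    `|Y' n u - Z' m u| <= e.
  by move=> Nn Nm u0 uv; exact: (close_deriv e0 (cl u u0 uv) Nn Nm u0 (lexx _)).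
have remv n m : (N < n)%N -> (N < m)%N ->
    vb (p / 2) (rdiff X (Y n.+1) (Y' n.+1) (Z m.+1) (Z' m.+1)) 0 v (e + e5).
  move=> Nn Nm; apply: vb_close => //.
    by move=> w w0 wv; have [_ h] := cl w w0 wv n.+1 m.+1 (ltnW Nn) (ltnW Nm).
  move=> u u0 uv; have uT := le_trans (ltW uv) vT.
  rewrite (picard_diff_remainder _ (pY n) (pZ m))//.
  pose G := 2 * L * e; have G0 : 0 <= G by rewrite !mulr_ge0.
  have g w : 0 < w -> w < v -> [/\ `|F' (Y n) (Y' n) 0 - F' (Z m) (Z' m) 0| <= G,
      vb p (incr (fun u => F' (Y n) (Y' n) u - F' (Z m) (Z' m) u)) 0 w G &
      vb (p / 2) (remainder ev2 X (fun t => F (Y n) t - F (Z m) t)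
        (fun t => F' (Y n) (Y' n) t - F' (Z m) (Z' m) t)) 0 w G].
    move=> w0 wv; have wT := le_trans (ltW wv) vT.
    have [h1 h2] := cl w (ltW w0) wv n m Nn Nm.
    have i0 : `|Y n 0 - Z m 0| <= 0 by rewrite (YZ0 n m) subrr normr0.
    have i1 : `|Y' n 0 - Z' m 0| <= 0.
      case: (n) Nn => // n' _; case: (m) Nm => // m' _.
      by rewrite deriv_at0 normr0.
    have [a1 a2 a3 _] := lipschitz_bounds p2 L0 lip (cY n) (cZ m) (lexx _) w0 wT
      (nY n (lexx _) w0 wT) (nZ m (lexx _) w0 wT) e0 e0 i0 i1 h1 h2.
    have GE : L * (0 + (0 + e + e)) <= G by rewrite /G; lra.
    have g0 : 0 <= L * (0 + (0 + e + e)).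
      by apply: mulr_ge0 => //; rewrite !add0r addr_ge0.
    split; [exact: le_trans a1 GE | exact: vb_le (ltW p0) g0 GE a2 |].
    apply: (vb_le (ltW p20) g0 GE); apply: vb_eq a3 => x z *.
    exact: remainder2B.
  have half w : u <= w -> w < v -> w <= (w + v) / 2 /\ 0 < (w + v) / 2 < v.
    move=> uw wv; have w0 := le_trans u0 uw.
    by split; [|apply/andP; split]; move: w0 wv v0; lra.
  have h3 w : u <= w -> w < v -> vb (p / 2) (remainder ev2 X (fun t => F (Y n) t - F (Z m) t)
        (fun t => F' (Y n) (Y' n) t - F' (Z m) (Z' m) t)) u w G.
    move=> uw wv; have [ww /andP[a b]] := half w uw wv; have [_ _ h] := g _ a b.
    exact: vb_restrict h u0 ww.
  have h2 w : u <= w -> w < v ->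
      vb p (incr (fun u => F' (Y n) (Y' n) u - F' (Z m) (Z' m) u)) u w G.
    move=> uw wv; have [ww /andP[a b]] := half w uw wv; have [_ h _] := g _ a b.
    exact: vb_restrict h u0 ww.
  have h1 : `|F' (Y n) (Y' n) u - F' (Z m) (Z' m) u| <= 2 * G.
    have [ww /andP[a b]] := half u (lexx _) uv; have [i h _] := g _ a b.
    have -> : 2 * G = G + G by ring.
    move: u0 ww {h2 h3 half uT uv}; rewrite le_eqVlt => /orP[/eqP<- _|u0 ww].
      by rewrite (le_trans i)// lerDl.
    have hu := vb_point p0 G0 h (lexx _) u0 ww.
    rewrite -[X in `|X|](subrKC (F' (Y n) (Y' n) 0 - F' (Z m) (Z' m) 0)).
    by apply: le_trans (ler_normD _ _) _; exact: lerD.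
  have := integral_remainder_point p2 p3 ch (picard_diff_integral (pY n) (pZ m))
    u0 uv vT G0 c0 G0 c0 h3 (vb_restrict Xc u0 vT) h2 (vb_restrict XXc u0 vT) h1.
  move=> /le_trans; apply; rewrite /e5 /G le_eqVlt; apply/orP; left; apply/eqP; ring.
pose e7 := 2 * (evc R d * e * c + (e + e5)).
have e60 : 0 <= e + e5 by rewrite addr_ge0.
have e70 : 0 <= e7 by rewrite /e7 !(mulr_ge0, addr_ge0).
have e7L : 2 * L * (evc R d * c + 1 + 4 * (rough_const R d p + evc R d) * c * L) * e
    = L * e7 by rewrite /e7 /e5; ring.
have e6_le : e + e5 <= L * e7.
  apply: (@le_trans _ _ e7); last exact: ler_peMl.
  have : 0 <= evc R d * e * c by apply: mulr_ge0 => //; exact: mulr_ge0.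
  by rewrite /e7; move: (evc R d * e * c) (e + e5) e60 => q1 q2 q20; lra.
rewrite e7L => n m; case: n => // n; case: m => // m Nn Nm.
have Nn' : (N < n)%N by exact: ltnW.
have Nm' : (N < m)%N by exact: ltnW.
split; last exact: vb_le (ltW p20) e60 e6_le (remv n m Nn' Nm').
(* The derivatives are F of the previous iterates, whose remainders up to v are themselves
   controlled by [remv] one index later; hence [N.+3]. *)
case: n Nn {Nn'} => // n; rewrite !ltnS => Nn.
case: m Nm {Nm'} => // m; rewrite !ltnS => Nm.
have dY : vb p (incr (fun u => Y n.+1 u - Z m.+1 u)) 0 v e7.
  apply: (path_vb p2 e0 e60 c0 _ (vb_restrict Xc (lexx _) vT)).
    by move=> u u0 uv; exact: (cl_deriv n.+1 m.+1 u (leqW Nn) (leqW Nm)).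
  by apply: vb_eq (remv n m Nn Nm) => u w *; exact: rdiffE.
apply: (@vb_eq _ _ _ (incr (fun u => F (Y n.+1) u - F (Z m.+1) u))).
  move=> u w u0 uw wv; have w0 := le_trans u0 (ltW uw); have wT := le_trans wv vT.
  rewrite (picard_diff_deriv (pY n.+1) (pZ m.+1) w0 wT).
  by rewrite (picard_diff_deriv (pY n.+1) (pZ m.+1) u0 (le_trans (ltW uw) wT)).
have [_ _ y1 y2] := cnorm_le p2 (ltW v0) (nY n.+1 (lexx _) v0 vT).
have [_ _ z1 z2] := cnorm_le p2 (ltW v0) (nZ m.+1 (lexx _) v0 vT).
have KK : 0 <= 2 * (K + K) by rewrite mulr_ge0// addr_ge0.
have i0 : `|Y n.+1 0 - Z m.+1 0| <= 0 by rewrite (YZ0 n.+1 m.+1) subrr normr0.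
have i1 : `|Y' n.+1 0 - Z' m.+1 0| <= 0 by rewrite deriv_at0 normr0.
(* A crude bound suffices here, as the p-variation of F(Y) - F(Z) is estimated through that of Y -
   Z. *)
have yz : vb p (incr (fun u => Y' n.+1 u - Z' m.+1 u)) 0 v (2 * (K + K)).
  apply: (vbD p1 K0 K0 _ y1 z1) => a b *.
  have -> : Y' n.+1 b - Z' m.+1 b - (Y' n.+1 a - Z' m.+1 a) =
      (Y' n.+1 b - Y' n.+1 a) - (Z' m.+1 b - Z' m.+1 a).
    by apply/matrixP => ? ?; rewrite !mxE; ring.
  exact: ler_normB.
have [_ _ _ h] := lipschitz_bounds p2 L0 lip (cY n.+1) (cZ m.+1) (lexx _) v0 vT
  (nY n.+1 (lexx _) v0 vT) (nZ m.+1 (lexx _) v0 vT) KK (addr_ge0 e0 e50) i0 i1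
  yz (remv n m Nn Nm).
by rewrite -(add0r e7); exact: h.
Qed.

Lemma sequences_close_step (del s v : R) : 0 < del ->
  8 * L * evc R d * del <= 1 ->
  8 * (rough_const R d p + evc R d) * L * (8 * L + 1) * del <= 1 ->
  0 <= s -> s < v -> v <= T ->
  (forall w, s <= w -> w < v -> vb p (incr X) s w del /\ vb (p / 2) XX s w del) ->
  (forall e, 0 < e -> exists N, close_upto e N s) ->
  forall e, 0 < e -> exists N, close_upto e N v.
Proof.
move=> del0 dL dC s0 sv vT small Ps e e0.
have ev0 : 0 <= evc R d := le_trans ler01 evc_ge1.
have C0 : 0 <= rough_const R d p by exact: rough_const_ge0.
have L0 : 0 < L by exact: lt_le_trans L1.
have [k1 k1E] : exists k1, k1 = 4 + evc R d * c by eexists.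
have k10 : 0 < k1 by rewrite k1E ltr_wpDr// mulr_ge0.
have [k2 k2E] : exists k2, k2 = 2 * L *
  (evc R d * c + 1 + 4 * (rough_const R d p + evc R d) * c * L) by eexists.
have k20 : 0 < k2.
  rewrite k2E; apply: mulr_gt0; first exact: mulr_gt0.
  apply: ltr_wpDr; first by rewrite !(mulr_ge0, addr_ge0)// ltW.
  by rewrite ltr_wpDl// mulr_ge0.
have e30 : 0 < e / (k2 * k1) by rewrite divr_gt0// mulr_gt0.
have [N1 HN1] := local_contraction del0 dL dC s0 sv vT small Ps e30.
have [N0 HN0] := Ps _ e30.
pose N := maxn N0 N1.
have clN : close_upto (e / (k2 * k1)) N.+1 s.
  by move=> n m Nn Nm; apply: HN0; apply: leq_trans (leq_maxl N0 N1) _; exact: ltnW.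
have locN w n m : s <= w -> w < v -> (N < n)%N -> (N < m)%N ->
    vb p (incr (fun u => Y' n u - Z' m u)) s w (e / (k2 * k1)) /\
    vb (p / 2) (rdiff X (Y n) (Y' n) (Z m) (Z' m)) s w (e / (k2 * k1)).
  by move=> sw wv Nn Nm; apply: HN1 => //; apply: leq_trans (leq_maxr N0 N1) _; exact: ltnW.
have glue := close_glue (ltW e30) s0 vT clN locN.
have v0 : 0 < v by exact: le_lt_trans sv.
have k1e0 : 0 <= (4 + evc R d * c) * (e / (k2 * k1)).
  by rewrite -k1E mulr_ge0// ltW.
have cl w : 0 <= w -> w < v -> close_upto ((4 + evc R d * c) * (e / (k2 * k1))) N.+1 w.
  move=> w0 wv; have [sw|ws] := leP s w; first exact: glue.
  exact: close_restrict (ltW ws) (glue s (lexx _) sv).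
exists N.+3; have := close_endpoint k1e0 v0 vT cl.
rewrite -k1E -k2E (_ : k2 * (k1 * (e / (k2 * k1))) = e)//.
by field; rewrite !gt_eqF.
Qed.

Lemma sequences_close e : 0 < e -> exists N, close_upto e N T.
Proof.
have ev0 : 0 <= evc R d := le_trans ler01 evc_ge1.
have [p0 p20] : 0 < p /\ 0 < p / 2 by have := p2; split; lra.
have C0 : 0 <= rough_const R d p by exact: rough_const_ge0.
have L0 : 0 <= L by exact: le_trans L1.
have [cX _ rXX _ _] := rough_path_facts p2 T0 rpX.
have [a [a0 aE]] : exists a, 0 <= a /\ a = 8 * L * evc R d.
  by eexists; split; last reflexivity; rewrite !mulr_ge0.
have [b [b0 bE]] : exists b, 0 <= b /\
    b = 8 * (rough_const R d p + evc R d) * L * (8 * L + 1).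
  by eexists; split; last reflexivity; rewrite !(mulr_ge0, addr_ge0).
have ab0 : 0 < a + b + 1 by rewrite ltr_wpDl// addr_ge0.
pose del := (a + b + 1)^-1.
have del0 : 0 < del by rewrite invr_gt0.
have dL : 8 * L * evc R d * del <= 1 by rewrite -aE ler_pdivrMr// mul1r -addrA lerDl addr_ge0.
have dC : 8 * (rough_const R d p + evc R d) * L * (8 * L + 1) * del <= 1.
  by rewrite -bE ler_pdivrMr// mul1r; lra.
have step := sequences_close_step del0 dL dC.
suff : forall e, 0 < e -> exists N, close_upto e N T by apply.
apply: (@real_induction _ (fun t => forall e, 0 < e -> exists N, close_upto e N t) 0 T (ltW T0)).
- move=> u v _ uv _ Pv e' e'0; have [N HN] := Pv e' e'0.
  by exists N; exact: close_restrict uv HN.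
- by move=> e' e'0; exists 0%N => n m _ _; split; exact: vb_refl.
- move=> s s0 sT Ps.
  have rX0 : incr X s @ s^'+ --> (0 : 'rV[R]_d).
    rewrite -(subrr (X s)); apply: cvgB; last exact: cvg_cst.
    by apply: cX.1; rewrite s0.
  have [v1 [sv1 v1T Xv1]] := vb_right_small p0 sT del0 (vb_restrict Xc s0 (lexx _)) rX0.
  have [v2 [sv2 v2T XXv2]] := vb_right_small p20 sT del0
    (vb_restrict XXc s0 (lexx _)) (rXX s s0 sT).
  have smin : s < Num.min v1 v2 by rewrite lt_min sv1.
  have minT : Num.min v1 v2 <= T by rewrite ge_min v1T.
  exists (Num.min v1 v2); split=> //.
  apply: (step s _ s0 smin minT) => // w sw; rewrite lt_min => /andP[w1 w2].
  by split; [exact: vb_restrict Xv1 (lexx _) (ltW w1)|exact: vb_restrict XXv2 (lexx _) (ltW w2)].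
(* X may jump at t: its variation is small on [u, w] for all w < t, as [step] asks, and the
   conclusion of [step] includes the endpoint t. *)
- move=> t t0 tT IH.
  have [u1 [u10 u1t Xu1]] := vb_left_small t0 del0 (vb_restrict Xc (lexx _) tT).
  have [u2 [u20 u2t XXu2]] := vb_left_small t0 del0 (vb_restrict XXc (lexx _) tT).
  have max0 : 0 <= Num.max u1 u2 by rewrite le_max u10.
  have maxt : Num.max u1 u2 < t by rewrite gt_max u1t.
  apply: (step _ t max0 maxt tT) => [w|]; last exact: IH.
  rewrite ge_max => /andP[w1 w2] wt; split.
    by apply: vb_restrict (Xu1 w w1 wt) _ (lexx _); rewrite le_max lexx.
  by apply: vb_restrict (XXu2 w w2 wt) _ (lexx _); rewrite le_max lexx orbT.
Qed.

End PicardSequences.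

(** * Existence, uniqueness and the a priori bound *)

Section LimitLemmas.
Context {R : realType} {m n : nat}.
Implicit Types (u : nat -> 'M[R]_(m, n)) (l x : 'M[R]_(m, n)).

Lemma cauchy_seq_cvg u :
  (forall e : R, 0 < e -> exists N, forall i j, (N < i)%N -> (N < j)%N ->
     `|u i - u j| <= e) -> cvg (u @ \oo).
Proof.
move=> H; apply/cauchy_cvgP/cauchy_exP => e e0.
have [N HN] := H (e / 2) (divr_gt0 e0 (@ltr0Sn _ 1)).
exists (u N.+1); exists N.+1 => // i /= Ni; rewrite -ball_normE /=.
by apply: le_lt_trans (HN _ _ (leqnn _) Ni) _; lra.
Qed.

Lemma cvg_dist_le u l x (e : R) N : u @ \oo --> l ->
  (forall i, (N < i)%N -> `|x - u i| <= e) -> `|x - l| <= e.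
Proof.
move=> /cvgrPdist_le ul H; apply/ler_addgt0Pr => h h0.
have [M _ HM] := ul h h0.
have h1 := HM (maxn N.+1 M) (leq_maxr _ _); have h2 := H (maxn N.+1 M) (leq_maxl _ _).
rewrite -(subrK (u (maxn N.+1 M)) x) -addrA.
by apply: le_trans (ler_normD _ _) _; rewrite (distrC _ l); exact: lerD.
Qed.

End LimitLemmas.

Section UniformLimit.
Context {R : realType} {E : normedModType R}.

Lemma uniform_right_cvg (Y : nat -> R -> E) (Z : R -> E) (T u : R) :
  (forall e, 0 < e -> exists N, forall i, (N < i)%N -> forall t, 0 <= t -> t <= T ->
     `|Y i t - Z t| <= e) ->
  0 <= u -> u < T -> (forall i, Y i @ u^'+ --> Y i u) -> Z @ u^'+ --> Z u.
Proof.
move=> unif u0 uT rY; apply/cvg_rightP => e e0; have e30 : 0 < e / 3 by lra.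
have [N HN] := unif _ e30.
have [v uv vP] := (cvg_rightP _ _ _).1 (rY N.+1) _ e30.
exists (Num.min v T); first by rewrite lt_min uv.
move=> w uw; rewrite lt_min => /andP[wv wT].
have h1 := HN _ (leqnn _) w (le_trans u0 (ltW uw)) (ltW wT).
have h2 := HN _ (leqnn _) u u0 (ltW uT).
have h3 := vP w uw wv.
have -> : Z w - Z u = (Y N.+1 u - Z u) + (Y N.+1 w - Y N.+1 u) - (Y N.+1 w - Z w).
  by rewrite [(_ - Z u) + _]addrC addrA subrK opprB [RHS]addrC addrA subrK.
apply: le_trans (ler_normB _ _) _; have := ler_normD (Y N.+1 u - Z u) (Y N.+1 w - Y N.+1 u).
lra.
Qed.

End UniformLimit.

Section PicardLimit.
Context {R : realType} {d k : nat}.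
Notation incr Y := (fun u v : R => Y v - Y u).
Variables (p T : R) (X : R -> 'rV[R]_d) (XX : R -> R -> 'M[R]_d).
Variables (y : R -> 'rV[R]_k) (y' : R -> 'M[R]_(d, k)).
Variables
  (F : (R -> 'rV[R]_k) -> R -> 'M[R]_(d, k))
  (F' : (R -> 'rV[R]_k) -> (R -> 'M[R]_(d, k)) -> R -> 'M[R]_(d, d * k)).
Variables (Y : nat -> R -> 'rV[R]_k) (Y' : nat -> R -> 'M[R]_(d, k)).
Variables (A B1 B2 L c : R).
Hypotheses (p2 : 2 < p) (p3 : p < 3) (T0 : 0 < T) (rpX : rough_path p T X XX).
Hypotheses (c0 : 0 <= c) (Xc : vb p (incr X) 0 T c) (XXc : vb (p / 2) XX 0 T c).
Hypotheses (A0 : 0 <= A) (B10 : 0 <= B1) (B20 : 0 <= B2).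
Hypotheses (L1 : 1 <= L)
  (lip : lipschitz_conditions p T X F F' (A + B1 + B2) L).
Hypotheses (onint : on_interval T F F') (nonant : nonanticipative p T X F F').
Hypotheses (cY : forall n, controlled ev1 p X T (Y n) (Y' n)).
Hypotheses (Y'A : forall n t, 0 <= t -> t <= T -> `|Y' n t| <= A)
  (Y'B : forall n, vb p (incr (Y' n)) 0 T B1)
  (RB : forall n, vb (p / 2) (remainder ev1 X (Y n) (Y' n)) 0 T B2).
Hypotheses
  (pY : forall n, picard T X XX y y' F F' (Y n) (Y' n) (Y n.+1) (Y' n.+1)).
Hypothesis Y0 : forall n, Y n 0 = y 0.

Lemma cnorm_sub (Z : R -> 'rV[R]_k) (Z' : R -> 'M[R]_(d, k)) s t :
  (forall t, 0 <= t -> t <= T -> `|Z' t| <= A) ->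
  vb p (incr Z') 0 T B1 -> vb (p / 2) (remainder ev1 X Z Z') 0 T B2 ->
  0 <= s -> s < t -> t <= T -> (cnorm ev1 p X Z Z' s t <= (A + B1 + B2)%:E)%E.
Proof.
move=> ZA ZB RZ s0 st tT; apply: le_cnorm => //; first exact: ltW.
- exact: ZA s0 (le_trans (ltW st) tT).
- exact: vb_restrict ZB s0 tT.
- exact: vb_restrict RZ s0 tT.
Qed.

(** The uniform bounds pass to the limit, so the Lipschitz conditions apply to the limit together
    with the iterates. They make the Picard images of the iterates converge to the image of the
    limit, which is thereby a fixed point. *)
Lemma picard_limit : exists (Z : R -> 'rV[R]_k) (Z' : R -> 'M[R]_(d, k)),
  [/\ controlled ev1 p X T Z Z', picard T X XX y y' F F' Z Z' Z Z',
      `|Z' 0| <= A, vb p (incr Z') 0 T B1 &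
      vb (p / 2) (remainder ev1 X Z Z') 0 T B2].
Proof.
have ev0 : 0 <= evc R d := le_trans ler01 evc_ge1.
have C0 : 0 <= rough_const R d p by exact: rough_const_ge0.
have [p0 p20] : 0 < p /\ 0 < p / 2 by have := p2; split; lra.
have L0 : 0 <= L by exact: le_trans L1.
have [cX ch rXX _ _] := rough_path_facts p2 T0 rpX.
have K0 : 0 <= A + B1 + B2 by rewrite !addr_ge0.
have nY n s t : 0 <= s -> s < t -> t <= T ->
    (cnorm ev1 p X (Y n) (Y' n) s t <= (A + B1 + B2)%:E)%E.
  exact: cnorm_sub (Y'A n) (Y'B n) (RB n).
have YY0 n m : Y n 0 = Y m 0 by rewrite !Y0.
have YZclose := sequences_close p2 p3 T0 rpX c0 Xc XXc K0 L1 lip onint nonant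
  cY cY nY nY pY pY YY0.
have cauchy' e : 0 < e -> exists N, forall t, 0 <= t -> t <= T -> forall i j,
    (N < i)%N -> (N < j)%N -> `|Y' i t - Y' j t| <= e.
  move=> e0; have [N HN] := YZclose e e0; exists N => t t0 tT i j Ni Nj.
  have HN' : close_upto p X Y Y Y' Y' e N.+1 T.
    by move=> a b Na Nb; apply: HN; exact: ltnW.
  exact: (close_deriv p2 T0 onint nonant cY cY pY pY YY0 (ltW e0) HN' Ni Nj t0 tT).
have kap0 : 0 < 2 * (evc R d * c + 1) by rewrite mulr_gt0// ltr_wpDl// mulr_ge0.
have cauchy e : 0 < e -> exists N, forall t, 0 <= t -> t <= T -> forall i j,
    (N < i)%N -> (N < j)%N -> `|Y i t - Y j t| <= e.
  move=> e0; pose e1 := e / (2 * (evc R d * c + 1)).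
  have e10 : 0 < e1 by rewrite divr_gt0.
  have [N HN] := YZclose e1 e10; exists N => t t0 tT i j Ni Nj.
  have HN' : close_upto p X Y Y Y' Y' e1 N.+1 T.
    by move=> a b Na Nb; apply: HN; exact: ltnW.
  have := close_path p2 T0 c0 Xc onint nonant cY cY pY pY YY0 (ltW e10) (lexx T) HN' Ni Nj.
  have -> : 2 * (evc R d * e1 * c + e1) = e.
    have : 2 * (evc R d * c + 1) * e1 = e by rewrite mulrC divfK// gt_eqF.
    by move: (e1) => q <-; ring.
  move=> h; move: t0; rewrite le_eqVlt => /orP[/eqP<-|t0].
    by rewrite !Y0 subrr normr0 ltW.
  by have := vb_point p0 (ltW e0) h (lexx _) t0 tT; rewrite !Y0 subrr subr0.
pose Z t := lim ((fun n => Y n t) @ \oo).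
pose Z' t := lim ((fun n => Y' n t) @ \oo).
have cvgZ t : 0 <= t -> t <= T -> (fun n => Y n t) @ \oo --> Z t.
  move=> t0 tT; apply: cauchy_seq_cvg => e e0; have [N HN] := cauchy e e0.
  by exists N => i j; exact: HN.
have cvgZ' t : 0 <= t -> t <= T -> (fun n => Y' n t) @ \oo --> Z' t.
  move=> t0 tT; apply: cauchy_seq_cvg => e e0; have [N HN] := cauchy' e e0.
  by exists N => i j; exact: HN.
have unif e : 0 < e -> exists N, forall i, (N < i)%N -> forall t, 0 <= t -> t <= T ->
    `|Y i t - Z t| <= e.
  move=> e0; have [N HN] := cauchy e e0; exists N => i Ni t t0 tT.
  by apply: (cvg_dist_le (cvgZ t t0 tT) (N := N)) => j; exact: HN.
have unif' e : 0 < e -> exists N, forall i, (N < i)%N -> forall t, 0 <= t -> t <= T ->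
    `|Y' i t - Z' t| <= e.
  move=> e0; have [N HN] := cauchy' e e0; exists N => i Ni t t0 tT.
  by apply: (cvg_dist_le (cvgZ' t t0 tT) (N := N)) => j; exact: HN.
have cvgR u v : 0 <= u -> u < v -> v <= T ->
    (fun n => remainder ev1 X (Y n) (Y' n) u v) @ \oo --> remainder ev1 X Z Z' u v.
  move=> u0 uv vT; have v0 := le_trans u0 (ltW uv); have uT := le_trans (ltW uv) vT.
  by apply: cvgB; [apply: cvgB; exact: cvgZ | apply: cvg_ev1; [exact: cvgZ'|exact: cvg_cst]].
have cvgI u v : 0 <= u -> u < v -> v <= T ->
    (fun n => Y' n v - Y' n u) @ \oo --> Z' v - Z' u.
  move=> u0 uv vT; have v0 := le_trans u0 (ltW uv); have uT := le_trans (ltW uv) vT.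
  by apply: cvgB; exact: cvgZ'.
have Z'B : vb p (incr Z') 0 T B1.
  by apply: (vb_lim p0 cvgI); exists 0%N.
have RZ : vb (p / 2) (remainder ev1 X Z Z') 0 T B2.
  by apply: (vb_lim p20 cvgR); exists 0%N.
have Z'A t : 0 <= t -> t <= T -> `|Z' t| <= A.
  move=> t0 tT; rewrite -normrN -sub0r.
  by apply: (cvg_dist_le (cvgZ' t t0 tT) (N := 0%N)) => i _; rewrite sub0r normrN Y'A.
have cZ : controlled ev1 p X T Z Z'.
  apply: (controlled_intro p2 T0 cX _ _ _ B10 B20 Z'B RZ); first by exists c.
  - move=> u u0 uT; apply: (uniform_right_cvg unif u0 uT) => i.
    by have [[[rY _] _] _ _] := cY i; apply: rY; rewrite u0.
  - move=> u u0 uT; apply: (uniform_right_cvg unif' u0 uT) => i.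
    by have [_ [[rY _] _] _] := cY i; apply: rY; rewrite u0.
have nZ s t : 0 <= s -> s < t -> t <= T ->
    (cnorm ev1 p X Z Z' s t <= (A + B1 + B2)%:E)%E.
  exact: cnorm_sub Z'A Z'B RZ.
have Z0 : Z 0 = y 0.
  have := cvgZ 0 (lexx _) (ltW T0); under eq_fun do rewrite Y0.
  by move=> /(@cvg_lim _ (@norm_hausdorff _ _)) <-; rewrite lim_cst.
(* Sending only the second index to infinity turns the Cauchy estimate into convergence in
   variation, which is what the Lipschitz conditions take as input. *)
have conv e : 0 < e -> exists N, forall n, (N < n)%N ->
    vb p (incr (fun u => Y' n u - Z' u)) 0 T e /\
    vb (p / 2) (rdiff X (Y n) (Y' n) Z Z') 0 T e.
  move=> e0; have [N HN] := YZclose e e0; exists N => n Nn.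
  have Nn' := ltnW Nn; split.
  - apply: (@vb_lim _ _ _ (fun j => incr (fun u => Y' n u - Y' j u)) _ _ _ _ p0).
      move=> u v u0 uv vT; have v0 := le_trans u0 (ltW uv); have uT := le_trans (ltW uv) vT.
      by apply: cvgB; (apply: cvgB; [exact: cvg_cst|exact: cvgZ']).
    by exists N => // j /= Nj; have [h _] := HN n j Nn' Nj.
  - apply: (@vb_lim _ _ _ (fun j => rdiff X (Y n) (Y' n) (Y j) (Y' j)) _ _ _ _ p20).
      by move=> u v u0 uv vT; apply: cvgB; [exact: cvg_cst|exact: cvgR].
    by exists N => // j /= Nj; have [_ h] := HN n j Nn' Nj.
have [cFZ _] := nonant cZ.
have [I HI] := rough_integral_path p2 p3 T0 rpX cFZ.
have pZ : picard T X XX y y' F F' Z Z' (fun t => y t + I t) (fun t => y' t + F Z t).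
  by move=> t t0 tT; split=> //; exists (I t) => //; exact: HI.
have I0 : I 0 = 0 := is_rough_integral_refl (HI 0 (lexx _) (ltW T0)).
have F0 n : F (Y n) 0 = F Z 0.
  by apply: (functional_at0 T0 onint nonant (cY n) cZ); rewrite Y0 Z0.
(* The factors of [e1] in the estimates for the derivative and for the path, added up. *)
have [kap kapE] : exists kap, kap = L * (2 * (evc R d * c + 1)) +
  (2 * rough_const R d p + evc R d) * c * (3 * L) + 1 by eexists.
have q1 : 0 <= L * (2 * (evc R d * c + 1)) by rewrite !(mulr_ge0, addr_ge0).
have q2 : 0 <= (2 * rough_const R d p + evc R d) * c * (3 * L).
  by rewrite !(mulr_ge0, addr_ge0).
have kap_gt0 : 0 < kap by rewrite kapE ltr_wpDl// addr_ge0.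
have key e : 0 < e -> exists N, forall n, (N < n)%N -> forall t, 0 < t -> t <= T ->
    `|Y' n.+1 t - (y' t + F Z t)| <= e /\ `|Y n.+1 t - (y t + I t)| <= e.
  move=> e0; have [e1 [e10 kap_e1]] : exists e1, 0 < e1 /\ kap * e1 = e.
    by exists (e / kap); rewrite divr_gt0// mulrC divfK// gt_eqF.
  have [N1 HN1] := conv e1 e10; have [N2 HN2] := unif' e1 e10.
  exists (maxn N1 N2) => n; rewrite gtn_max => /andP[Nn1 Nn2] t t0 tT.
  have [h1 h2] := HN1 n Nn1; have h3 := HN2 n Nn2.
  have a0 : `|Y n 0 - Z 0| <= 0 by rewrite Y0 Z0 subrr normr0.
  have [g1 g2 g3 g4] := lipschitz_bounds p2 L0 lip (cY n) cZ (lexx _) T0 (lexx _)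
    (nY n 0 T (lexx _) T0 (lexx _)) (nZ 0 T (lexx _) T0 (lexx _)) (ltW e10) (ltW e10)
    a0 (h3 0 (lexx _) (ltW T0)) h1 h2.
  pose yb := 2 * (evc R d * e1 * c + e1).
  have yb0 : 0 <= yb by rewrite !(mulr_ge0, addr_ge0)// ltW.
  have dY : vb p (incr (fun u => Y n u - Z u)) 0 T yb.
    apply: (path_vb p2 (ltW e10) (ltW e10) c0 (fun u u0 uT => h3 u u0 (ltW uT)) Xc).
    by apply: vb_eq h2 => u v *; exact: rdiffE.
  have dF := g4 _ yb0 dY.
  have Lyb0 : 0 <= L * (0 + yb) by rewrite add0r mulr_ge0.
  set G := L * (0 + (e1 + e1 + e1)) in g1 g2 g3.
  have G0 : 0 <= G by rewrite mulr_ge0// add0r !addr_ge0// ltW.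
  split.
  - have [-> _] := pY n (ltW t0) tT.
    have -> : y' t + F (Y n) t - (y' t + F Z t) =
        (F (Y n) t - F Z t) - (F (Y n) 0 - F Z 0).
      by rewrite F0 subrr subr0; apply/matrixP => i j; rewrite !mxE; ring.
    apply: le_trans (vb_point p0 Lyb0 dF (lexx _) t0 tT) _.
    have -> : L * (0 + yb) = L * (2 * (evc R d * c + 1)) * e1 by rewrite /yb; ring.
    rewrite -[leRHS]kap_e1; apply: ler_wpM2r; first exact: ltW.
    by rewrite kapE; move: q1 q2; lra.
  - have g3' : vb (p / 2) (remainder ev2 X (fun t => F (Y n) t - F Z t)
        (fun t => F' (Y n) (Y' n) t - F' Z Z' t)) 0 T G.
      by apply: vb_eq g3 => u v *; exact: remainder2B.
    have := integral_remainder_point p2 p3 ch (picard_diff_integral (pY n) pZ)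
      (lexx _) t0 tT G0 c0 G0 c0 (fun w _ wt => vb_restrict g3' (lexx _) (ltW (lt_le_trans wt tT)))
      (vb_restrict Xc (lexx _) tT)
      (fun w _ wt => vb_restrict g2 (lexx _) (ltW (lt_le_trans wt tT)))
      (vb_restrict XXc (lexx _) tT) g1.
    have -> : remainder ev1 X (fun t => Y n.+1 t - (y t + I t))
        (fun t => F (Y n) t - F Z t) 0 t = Y n.+1 t - (y t + I t).
      rewrite /remainder F0 subrr /ev1 mulmx0 subr0 Y0 I0 addr0 subrr subr0.
      by [].
    move=> /le_trans; apply; rewrite -kap_e1.
    have -> : rough_const R d p * (G * c + G * c) + evc R d * (G * c) =
        (2 * rough_const R d p + evc R d) * c * (3 * L) * e1 by rewrite /G; ring.
    apply: ler_wpM2r; first exact: ltW.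
    by rewrite kapE; move: q1 q2; lra.
have ZE t : 0 <= t -> t <= T -> Z' t = y' t + F Z t /\ Z t = y t + I t.
  rewrite le_eqVlt => /orP[/eqP<- _|t0 tT].
    split; last by rewrite I0 addr0.
    apply/eqP; rewrite -subr_eq0 -normr_le0; apply/ler_addgt0Pr => e e0.
    have [N HN] := unif' e e0; have := HN N.+1 (leqnn _) 0 (lexx _) (ltW T0).
    by have [-> _] := pY N (lexx _) (ltW T0); rewrite F0 distrC add0r.
  split; apply/eqP; rewrite -subr_eq0 -normr_le0; apply/ler_addgt0Pr => e e0.
  - have e20 : 0 < e / 2 by lra.
    have [N1 HN1] := unif' _ e20; have [N2 HN2] := key _ e20.
    have h1 := HN1 (maxn N1 N2).+2 (leq_trans (leq_maxl _ _) (leqnSn _)) t (ltW t0) tT.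
    have [h2 _] := HN2 (maxn N1 N2).+1 (leq_maxr _ _) t t0 tT.
    rewrite add0r -(subrK (Y' (maxn N1 N2).+2 t) (Z' t)) -addrA.
    by apply: le_trans (ler_normD _ _) _; rewrite (distrC (Z' t)); lra.
  - have e20 : 0 < e / 2 by lra.
    have [N1 HN1] := unif _ e20; have [N2 HN2] := key _ e20.
    have h1 := HN1 (maxn N1 N2).+2 (leq_trans (leq_maxl _ _) (leqnSn _)) t (ltW t0) tT.
    have [_ h2] := HN2 (maxn N1 N2).+1 (leq_maxr _ _) t t0 tT.
    rewrite add0r -(subrK (Y (maxn N1 N2).+2 t) (Z t)) -addrA.
    by apply: le_trans (ler_normD _ _) _; rewrite (distrC (Z t)); lra.
exists Z, Z'; split=> //; last exact: Z'A (lexx _) (ltW T0).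
move=> t t0 tT; have [h1 h2] := ZE t t0 tT; split=> //.
by exists (I t) => //; exact: HI.
Qed.

End PicardLimit.

Section WellPosedness.
Context {R : realType} {d k : nat}.
Notation incr Y := (fun u v : R => Y v - Y u).

Lemma lipschitz_le (p T : R) (X : R -> 'rV[R]_d)
    (F : (R -> 'rV[R]_k) -> R -> 'M[R]_(d, k))
    (F' : (R -> 'rV[R]_k) -> (R -> 'M[R]_(d, k)) -> R -> 'M[R]_(d, d * k))
    (K C L : R) : C <= L ->
  lipschitz_conditions p T X F F' K C -> lipschitz_conditions p T X F F' K L.
Proof.
move=> CL lip Y Y' Z Z' cY cZ s t s0 st tT nY nZ.
have [h1 h2] := lip _ _ _ _ cY cZ s t s0 st tT nY nZ.
split; [apply: le_trans h1 _ | apply: le_trans h2 _].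
- apply: lee_wpmul2r; last by rewrite lee_fin.
  by rewrite adde_ge0 ?lee_fin// pvar2_ge0.
- apply: lee_wpmul2r; last by rewrite lee_fin.
  by rewrite !adde_ge0 ?lee_fin// pvar2_ge0.
Qed.

Lemma solution_picard (p T : R) (X : R -> 'rV[R]_d) XX (y : R -> 'rV[R]_k)
    (y' : R -> 'M[R]_(d, k))
    (F : (R -> 'rV[R]_k) -> R -> 'M[R]_(d, k))
    (F' : (R -> 'rV[R]_k) -> (R -> 'M[R]_(d, k)) -> R -> 'M[R]_(d, d * k)) Y Y' :
  is_solution p T X F F' XX y y' Y Y' <->
  controlled ev1 p X T Y Y' /\ picard T X XX y y' F F' Y Y' Y Y'.
Proof.
split=> [[cY hY' hY]|[cY pY]].
- split=> // t t0 tT; split; first by apply: hY'; rewrite t0.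
  by apply: hY; rewrite t0.
- split=> // t /andP[t0 tT]; first by have [] := pY t t0 tT.
  by have [] := pY t t0 tT.
Qed.

Lemma solution_unique (p T : R) (X : R -> 'rV[R]_d) XX (y : R -> 'rV[R]_k)
    (y' : R -> 'M[R]_(d, k))
    (F : (R -> 'rV[R]_k) -> R -> 'M[R]_(d, k))
    (F' : (R -> 'rV[R]_k) -> (R -> 'M[R]_(d, k)) -> R -> 'M[R]_(d, d * k)) Y Y' Z Z' :
  2 < p -> p < 3 -> 0 < T -> rough_path p T X XX ->
  on_interval T F F' -> nonanticipative p T X F F' ->
  (forall K : R, 0 < K ->
     exists2 C : R, 0 < C & lipschitz_conditions p T X F F' K C) ->
  is_solution p T X F F' XX y y' Y Y' -> is_solution p T X F F' XX y y' Z Z' ->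
  forall t, 0 <= t <= T -> Z t = Y t /\ Z' t = Y' t.
Proof.
move=> p2 p3 T0 rpX onint nonant lip /solution_picard[cY pY] /solution_picard[cZ pZ].
have ev0 : 0 <= evc R d := le_trans ler01 evc_ge1.
have [p0 p20] : 0 < p /\ 0 < p / 2 by split; lra.
have [_ _ _ [x x0 Xx] [z z0 XXz]] := rough_path_facts p2 T0 rpX.
have [_ _ [mY mY0 Y'm] [rY rY0 RY]] := controlled_facts p2 T0 cY.
have [_ _ [mZ mZ0 Z'm] [rZ rZ0 RZ]] := controlled_facts p2 T0 cZ.
have YA := deriv_le p0 mY0 Y'm; have ZA := deriv_le p0 mZ0 Z'm.
(* A + B1 + B2 lies above the norms of both solutions and is positive; the Lipschitz constant is
   taken for this value. *)
pose A := 1 + `|Y' 0| + mY + (`|Z' 0| + mZ).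
have A0 : 0 < A.
  by have := normr_ge0 (Y' 0); have := normr_ge0 (Z' 0); rewrite /A; lra.
pose B1 := mY + mZ; pose B2 := rY + rZ.
have K0 : 0 < A + B1 + B2 by rewrite /B1 /B2; lra.
have [C C0 lipC] := lip _ K0.
have L1 : 1 <= Num.max 1 C by rewrite le_max lexx.
have lipL := lipschitz_le (_ : C <= Num.max 1 C) lipC.
have {}lipL : lipschitz_conditions p T X F F' (A + B1 + B2) (Num.max 1 C).
  by apply: lipL; rewrite le_max lexx orbT.
pose c := x + z.
have c0 : 0 <= c by exact: addr_ge0.
have Xc : vb p (incr X) 0 T c by apply: vb_le Xx => //; rewrite ?(ltW p0) ?lerDl.
have XXc : vb (p / 2) XX 0 T c by apply: vb_le XXz => //; rewrite ?(ltW p20) ?lerDr.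
have nY (n : nat) s t : 0 <= s -> s < t -> t <= T ->
    (cnorm ev1 p X Y Y' s t <= (A + B1 + B2)%:E)%E.
  apply: cnorm_sub => //.
  - exact: addr_ge0.
  - exact: addr_ge0.
  - move=> u u0 uT; apply: le_trans (YA u u0 uT) _.
    by have := normr_ge0 (Z' 0); rewrite /A; lra.
  - by apply: vb_le Y'm => //; rewrite ?(ltW p0) ?lerDl.
  - by apply: vb_le RY => //; rewrite ?(ltW p20) ?lerDl.
have nZ (n : nat) s t : 0 <= s -> s < t -> t <= T ->
    (cnorm ev1 p X Z Z' s t <= (A + B1 + B2)%:E)%E.
  apply: cnorm_sub => //.
  - exact: addr_ge0.
  - exact: addr_ge0.
  - move=> u u0 uT; apply: le_trans (ZA u u0 uT) _.
    by have := normr_ge0 (Y' 0); rewrite /A; lra.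
  - by apply: vb_le Z'm => //; rewrite ?(ltW p0) ?lerDr.
  - by apply: vb_le RZ => //; rewrite ?(ltW p20) ?lerDr.
have init (W : R -> 'rV[R]_k) W' : picard T X XX y y' F F' W W' W W' -> W 0 = y 0.
  move=> pW; have [_ [I HI ->]] := pW 0 (lexx _) (ltW T0).
  by rewrite (is_rough_integral_refl HI) addr0.
have YZ0 (n m : nat) : Y 0 = Z 0 by rewrite (init _ _ pY) (init _ _ pZ).
have cl := sequences_close p2 p3 T0 rpX c0 Xc XXc (ltW K0) L1 lipL onint nonant
  (Y := fun=> Y) (Z := fun=> Z) (Y' := fun=> Y') (Z' := fun=> Z')
  (fun=> cY) (fun=> cZ) nY nZ (fun=> pY) (fun=> pZ) YZ0.
move=> t /andP[t0 tT].
have close_t e : 0 < e -> `|Y' t - Z' t| <= e /\ `|Y t - Z t| <= 2 * (evc R d * e * c + e).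
  move=> e0; have [N HN] := cl e e0.
  have HN' : close_upto p X (fun=> Y) (fun=> Z) (fun=> Y') (fun=> Z') e N.+1 T.
    by move=> a b Na Nb; apply: HN; exact: ltnW.
  split.
    exact: (close_deriv p2 T0 onint nonant (fun=> cY) (fun=> cZ)
      (fun=> pY) (fun=> pZ) YZ0 (ltW e0) HN' (leqnn _) (leqnn _) t0 tT).
  have h := close_path p2 T0 c0 Xc onint nonant (fun=> cY) (fun=> cZ)
      (fun=> pY) (fun=> pZ) YZ0 (ltW e0) (lexx T) HN' (leqnn _) (leqnn _).
  have h0 : 0 <= 2 * (evc R d * e * c + e).
    apply: mulr_ge0 => //; apply: addr_ge0; last exact: ltW.
    by apply: mulr_ge0 => //; rewrite mulr_ge0// ltW.
  move: t0; rewrite le_eqVlt => /orP[/eqP<-|t0].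
    by rewrite (YZ0 0%N 0%N) subrr normr0.
  by have := vb_point p0 h0 h (lexx _) t0 tT; rewrite /= (YZ0 0%N 0%N) subrr subr0.
split; apply/esym/eqP; rewrite -subr_eq0 -normr_le0; apply/ler_addgt0Pr => e e0.
- rewrite add0r; have kap0 : 0 < 2 * (evc R d * c + 1) by rewrite mulr_gt0// ltr_wpDl// mulr_ge0.
  have [_ /le_trans] := close_t (e / (2 * (evc R d * c + 1))) (divr_gt0 e0 kap0); apply.
  have : 2 * (evc R d * c + 1) * (e / (2 * (evc R d * c + 1))) = e.
    by rewrite mulrC divfK// gt_eqF.
  by move: (e / _) => q <-; rewrite le_eqVlt; apply/orP; left; apply/eqP; ring.
- by rewrite add0r; have [] := close_t e e0.
Qed.

(** The order of the quantifiers matters: [B] is built from [al], [be] and [ga] before the data are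
    given. [M2] depends on [M1], [G] on both, [eps] on [G] and [n] on [eps]; the Lipschitz constant
    is taken last, for K = A + B1 + B2. *)
Lemma solution_exists_bounded (p al be ga : R) : 2 < p -> p < 3 ->
  0 <= al -> 0 <= be -> 0 <= ga ->
  exists B : R, forall (T : R) (X : R -> 'rV[R]_d) XX (y : R -> 'rV[R]_k)
    (y' : R -> 'M[R]_(d, k))
    (F : (R -> 'rV[R]_k) -> R -> 'M[R]_(d, k))
    (F' : (R -> 'rV[R]_k) -> (R -> 'M[R]_(d, k)) -> R -> 'M[R]_(d, d * k)) (CF : R),
  0 < T -> rough_path p T X XX -> controlled ev1 p X T y y' ->
  on_interval T F F' -> nonanticipative p T X F F' ->
  0 < CF -> growth_conditions p T X F F' CF ->
  (forall K : R, 0 < K ->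
     exists2 C : R, 0 < C & lipschitz_conditions p T X F F' K C) ->
  (cnorm ev1 p X y y' 0 T <= al%:E)%E -> CF <= be ->
  (rp_norm p X XX 0 T <= ga%:E)%E ->
  exists (Y : R -> 'rV[R]_k) (Y' : R -> 'M[R]_(d, k)),
    is_solution p T X F F' XX y y' Y Y' /\
    (cnorm ev1 p X Y Y' 0 T <= B%:E)%E.
Proof.
move=> p2 p3 al0 be0 ga0.
have ev0 : 0 <= evc R d := le_trans ler01 evc_ge1.
have C0 : 0 <= rough_const R d p by exact: rough_const_ge0.
have [p0 p20] : 0 < p /\ 0 < p / 2 by split; lra.
(* The factor 2 appears because y' at time t is bounded by its initial value plus its variation.
   Each constant is hidden behind an equation, so as to remain an atom for [lra]. *)
have [a [a0 aE]] : exists a, 0 <= a /\ a = 2 * al.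
  by eexists; split; last reflexivity; exact: mulr_ge0.
have [A [A0 AE]] : exists A, 0 <= A /\ A = a + be.
  by eexists; split; last reflexivity; exact: addr_ge0.
have [M1 [M10 M1E]] : exists M1, 0 <= M1 /\ M1 = 2 * (a + 1).
  by eexists; split; last reflexivity; rewrite mulr_ge0// addr_ge0.
have [M2 [M20 M2E]] : exists M2, 0 <= M2 /\ M2 = 2 * (a + be * (2 + M1)).
  by eexists; split; last reflexivity; rewrite mulr_ge0// addr_ge0// mulr_ge0// addr_ge0.
have ala : al <= a by rewrite aE; lra.
have al2 : al + al <= a by rewrite aE; lra.
have aM1 : a <= M1 by rewrite M1E; lra.
have aM2 : a <= M2.
  have : 0 <= be * (2 + M1) by rewrite mulr_ge0// addr_ge0.
  by rewrite M2E; move: (be * _) => q q0; lra.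
have [G [G0 GE]] : exists G, 0 <= G /\ G = 4 * be * (1 + (A + M2 + M1)) ^+ 2.
  by eexists; split; last reflexivity; rewrite mulr_ge0 ?exprn_ge0 ?addr_ge0// mulr_ge0.
have [B0 [B00 aB0 B0E]] : exists B0, [/\ 0 <= B0, a <= B0 &
    B0 = a + (2 * rough_const R d p + evc R d) * (G * ga)].
  by eexists; split; last reflexivity; rewrite ?lerDl ?(addr_ge0, mulr_ge0)// !(addr_ge0, mulr_ge0).
have q1 : 0 <= A + M2 by exact: addr_ge0.
have q2 : 0 <= 4 * G * (rough_const R d p + evc R d) by rewrite !(addr_ge0, mulr_ge0).
have [eps [eps0 eps1 epsA epsG]] : exists eps, [/\ 0 < eps, eps <= 1,
    (A + M2) * eps <= 1 & 4 * G * (rough_const R d p + evc R d) * eps <= 1].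
  have q3 : 0 < 1 + (A + M2) + 4 * G * (rough_const R d p + evc R d).
    by rewrite ltr_wpDr// ltr_wpDr.
  move: (4 * G * _) q2 q3 => g g0 q3; move: (A + M2) q1 q3 => h h0 q3.
  exists (1 + h + g)^-1; split.
  - by rewrite invr_gt0.
  - by rewrite invf_le1//; lra.
  - by rewrite ler_pdivrMr//; lra.
  - by rewrite ler_pdivrMr//; lra.
have quant0 := quantum_gt0 p (p / 2) eps0.
have [n nE] : exists n : nat, ga `^ p + ga `^ (p / 2) < n%:R * quantum p (p / 2) eps.
  exists (Num.truncn ((ga `^ p + ga `^ (p / 2)) / quantum p (p / 2) eps)).+1.
  by rewrite -ltr_pdivrMr// truncnS_gt.
have [B1 [B10 B1E]] : exists B1, 0 <= B1 /\
    B1 = (n%:R * (M2 `^ p + (2 * A) `^ p)) `^ p^-1.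
  by eexists; split; last reflexivity; exact: powR_ge0.
have [B2 [B20 B2E]] : exists B2, 0 <= B2 /\ B2 = (n%:R * (M1 `^ (p / 2) +
    (n%:R * (B0 + evc R d * (A * ga)) + evc R d * (A * ga)) `^ (p / 2))) `^ (p / 2)^-1.
  by eexists; split; last reflexivity; exact: powR_ge0.
exists (A + B1 + B2) => T X XX y y' F F' CF T0 rpX cy onint nonant CF0 growth lip ny CFbe nX.
have [_ y1 y2 y3] := cnorm_le p2 (ltW T0) ny.
have Xc : vb p (incr X) 0 T ga.
  apply/pvar2_le => //; [exact: ltW|]; apply: le_trans nX.
  by rewrite /rp_norm leeDl// pvar2_ge0.
have XXc : vb (p / 2) XX 0 T ga.
  apply/pvar2_le => //; [exact: ltW|]; apply: le_trans nX.
  by rewrite /rp_norm leeDr// pvar2_ge0.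
have ya t : 0 <= t -> t <= T -> `|y' t| <= a.
  move=> t0 tT; apply: le_trans (deriv_le p0 al0 y2 t0 tT) _.
  by apply: le_trans al2; rewrite lerD2r.
have y'a := vb_le (ltW p0) al0 ala y2.
have Ra := vb_le (ltW p20) al0 ala y3.
have ball0 : in_ball p T X XX eps A M1 M2 B0 y y'.
  apply: (ball_data XX eps p2 cy ya y'a Ra a0) => //.
  by rewrite AE lerDl.
(* Pairs outside the ball are sent to themselves, so that [choice] gives a total map to iterate. *)
have step (YY : (R -> 'rV[R]_k) * (R -> 'M[R]_(d, k))) :
    exists UU : (R -> 'rV[R]_k) * (R -> 'M[R]_(d, k)),
    in_ball p T X XX eps A M1 M2 B0 YY.1 YY.2 ->
    in_ball p T X XX eps A M1 M2 B0 UU.1 UU.2 /\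
    picard T X XX y y' F F' YY.1 YY.2 UU.1 UU.2.
  have [bY|nbY] := pselect (in_ball p T X XX eps A M1 M2 B0 YY.1 YY.2); last by exists YY.
  have [cY _ _ _] := bY; have [cFY _] := nonant _ _ cY.
  have [I HI] := rough_integral_path p2 p3 T0 rpX cFY.
  exists (fun t => y t + I t, fun t => y' t + F YY.1 t) => _; split.
  - apply: (ball_step p2 p3 T0 rpX cy nonant CF0 CFbe growth ya y'a Ra Xc XXc ga0 a0
      _ _ _ _ eps0 eps1 epsA epsG _ bY HI).
    + by rewrite AE.
    + by rewrite M1E.
    + by rewrite M2E.
    + by rewrite GE.
    + by rewrite B0E.
  - by move=> t t0 tT; split=> //; exists (I t) => //; exact: HI.
have [Phi PhiP] := choice step.
pose S (i : nat) := iter i Phi (y, y').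
have Sball i : in_ball p T X XX eps A M1 M2 B0 (S i).1 (S i).2.
  by elim: i => [//|i IH]; have [] := PhiP _ IH.
have Spic i : picard T X XX y y' F F' (S i).1 (S i).2 (S i.+1).1 (S i.+1).2.
  by have [] := PhiP _ (Sball i).
have bounds i : vb p (incr (S i).2) 0 T B1 /\
    vb (p / 2) (remainder ev1 X (S i).1 (S i).2) 0 T B2.
  rewrite B1E B2E.
  exact: ball_bounds p2 T0 rpX Xc XXc ga0 eps0 A0 M10 M20 B00 nE (Sball i).
have cS i : controlled ev1 p X T (S i).1 (S i).2 by have [] := Sball i.
have SA i t : 0 <= t -> t <= T -> `|(S i).2 t| <= A by have [_ h _ _] := Sball i; exact: h.
have S0 i : (S i).1 0 = y 0.
  case: i => [//|i]; have [_ [I HI ->]] := Spic i 0 (lexx _) (ltW T0).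
  by rewrite (is_rough_integral_refl HI) addr0.
have K0 : 0 < A + B1 + B2.
  apply: (ltr_wpDr B20); apply: (ltr_wpDr B10); rewrite AE.
  by apply: (ltr_wpDl a0); exact: lt_le_trans CFbe.
have [C C1 lipC] := lip _ K0.
have L1 : 1 <= Num.max 1 C by rewrite le_max lexx.
have lipL : lipschitz_conditions p T X F F' (A + B1 + B2) (Num.max 1 C).
  by apply: lipschitz_le lipC; rewrite le_max lexx orbT.
have [Z [Z' [cZ pZ ZA ZB RZ]]] := picard_limit p2 p3 T0 rpX ga0 Xc XXc A0 B10 B20
  L1 lipL onint nonant cS SA (fun i => (bounds i).1) (fun i => (bounds i).2) Spic S0.
exists Z, Z'; split; first exact/solution_picard.
exact: le_cnorm p2 (ltW T0) B10 B20 ZA ZB RZ.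
Qed.

End WellPosedness.

Section MonotoneMajorant.
Context {R : realType}.

(** The bounds [B n] come from a choice and need not increase with n, whereas the partial sums of
    their absolute values do. *)
Lemma monotone_majorant (B : nat -> R) : exists f : R -> R -> R -> R,
  [/\ forall a b c, 0 <= f a b c,
      forall a b c a' b' c', a <= a' -> b <= b' -> c <= c' ->
        f a b c <= f a' b' c' &
      forall a b c, exists n : nat,
        [/\ a <= n%:R, b <= n%:R, c <= n%:R & B n <= f a b c]].
Proof.
pose N (a b c : R) := (Num.truncn (Num.max a (Num.max b c))).+1.
exists (fun a b c => \sum_(0 <= i < (N a b c).+1) `|B i|); split.
- by move=> a b c; apply: sumr_ge0.
- move=> a b c a' b' c' aa bb cc.
  have NN : (N a b c <= N a' b' c')%N.
    by rewrite ltnS; apply: le_truncn; rewrite !ge_max !le_max aa bb cc !orbT.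
  rewrite (big_cat_nat (n := (N a b c).+1) (p := (N a' b' c').+1) (leq0n _))//= lerDl.
  exact: sumr_ge0.
- move=> a b c; exists (N a b c).
  have : Num.max a (Num.max b c) <= (N a b c)%:R by exact/ltW/truncnS_gt.
  rewrite !ge_max => /and3P[-> -> ->]; split=> //.
  rewrite big_nat_recr//=; apply: le_trans (ler_norm _) _.
  by rewrite lerDr; exact: sumr_ge0.
Qed.

End MonotoneMajorant.

Section FiniteNorms.
Context {R : realType} {d k : nat}.

Lemma controlled_cnorm_fin (p T : R) (X : R -> 'rV[R]_d) (Y : R -> 'rV[R]_k)
    (Y' : R -> 'M[R]_(d, k)) : 2 < p -> 0 < T -> controlled ev1 p X T Y Y' ->
  cnorm ev1 p X Y Y' 0 T \is a fin_num.
Proof.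
move=> p2 T0 /(controlled_facts p2 T0)[_ _ [m m0 Ym] [r r0 Yr]].
have := le_cnorm p2 (ltW T0) m0 r0 (lexx _) Ym Yr.
move=> /le_lt_trans/(_ (ltry _)); rewrite ge0_fin_numE//.
by rewrite /cnorm !adde_ge0 ?lee_fin// pvar2_ge0.
Qed.

Lemma rough_path_norm_fin (p T : R) (X : R -> 'rV[R]_d) XX : 2 < p -> 0 < T ->
  rough_path p T X XX -> rp_norm p X XX 0 T \is a fin_num.
Proof.
move=> p2 T0 [[_ vX] [_ _ vXX] _]; rewrite /rp_norm fin_numD.
by rewrite !ge0_fin_numE ?pvar2_ge0// vX.
Qed.

End FiniteNorms.

Theorem theorem2p3 (R : realType) (d k : nat) (p : R) (p_gt2 : 2 < p)
    (p_lt3 : p < 3) :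
  exists Kp : R -> R -> R -> R,
    (forall a b c : R, 0 <= a -> 0 <= b -> 0 <= c -> 0 <= Kp a b c) /\
    (forall a b c a' b' c' : R, 0 <= a -> 0 <= b -> 0 <= c ->
       a <= a' -> b <= b' -> c <= c' -> Kp a b c <= Kp a' b' c') /\
    forall (T : R) (X : R -> 'rV[R]_d) (XX : R -> R -> 'M[R]_d)
      (y : R -> 'rV[R]_k) (y' : R -> 'M[R]_(d, k))
      (F : (R -> 'rV[R]_k) -> R -> 'M[R]_(d, k))
      (F' : (R -> 'rV[R]_k) -> (R -> 'M[R]_(d, k)) -> R -> 'M[R]_(d, d * k))
      (CF : R),
    0 < T ->
    rough_path p T X XX ->
    controlled ev1 p X T y y' ->
    on_interval T F F' ->
    nonanticipative p T X F F' ->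
    0 < CF ->
    growth_conditions p T X F F' CF ->
    (forall K : R, 0 < K ->
       exists2 CK : R, 0 < CK & lipschitz_conditions p T X F F' K CK) ->
    exists (Y : R -> 'rV[R]_k) (Y' : R -> 'M[R]_(d, k)),
      [/\ is_solution p T X F F' XX y y' Y Y',
          forall (Z : R -> 'rV[R]_k) (Z' : R -> 'M[R]_(d, k)),
            is_solution p T X F F' XX y y' Z Z' ->
            forall t : R, 0 <= t <= T -> Z t = Y t /\ Z' t = Y' t &
          (cnorm ev1 p X Y Y' 0 T <=
             (Kp (fine (cnorm ev1 p X y y' 0 T)) CF
                 (fine (rp_norm p X XX 0 T)))%:E)%E].
Proof.
(* All three arguments of [Kp] are rounded up to a common integer, so that one bound per integer is
   enough to choose [Kp] before the data. *)
have /choice[B HB] := fun n : nat =>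
  @solution_exists_bounded R d k p n%:R n%:R n%:R p_gt2 p_lt3
    (ler0n _ n) (ler0n _ n) (ler0n _ n).
have [Kp [Kp0 Kp_mono KpB]] := monotone_majorant B.
exists Kp; split; first by move=> a b c _ _ _; exact: Kp0.
split; first by move=> a b c a' b' c' _ _ _; exact: Kp_mono.
move=> T X XX y y' F F' CF T0 rpX cy onint nonant CF0 growth lip.
have [n [yn Cn Xn Bn]] := KpB (fine (cnorm ev1 p X y y' 0 T)) CF
  (fine (rp_norm p X XX 0 T)).
have [||Y [Y' [solY nY]]] :=
  HB n T X XX y y' F F' CF T0 rpX cy onint nonant CF0 growth lip _ Cn _.
- by rewrite -(fineK (controlled_cnorm_fin p_gt2 T0 cy)) lee_fin.
- by rewrite -(fineK (rough_path_norm_fin p_gt2 T0 rpX)) lee_fin.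
exists Y, Y'; split=> //.
- move=> Z Z' solZ; exact: solution_unique solY solZ.
- by apply: le_trans nY _; rewrite lee_fin.
Qed.
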